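(* There is an isomorphism of $A$-algebras $$\mathrm H_n(Q)\;\simeq\;\bigoplus_{\lambda}\mathrm{Mat}_{m_\lambda}\big(\mathrm H_\lambda(Q)\big),$$ where the direct sum is over all $d$-compositions $\lambda=(\lambda_1,\dots,\lambda_d)$ of $n$, $m_\lambda=\frac{n!}{\lambda_1!\cdots\lambda_d!}$, and $\mathrm H_\lambda(Q)=\mathrm H_{\lambda_1}(Q^1)\otimes_A\cdots\otimes_A\mathrm H_{\lambda_d}(Q^d)$.
   Context: Let $A$ be a commutative ring, $d,n\ge1$ integers, $J=\{1,\dots,d\}$, and $\mathcal K$ a finite set with a partition $\mathcal K=\bigsqcup_{j\in J}\mathcal K_j$. Let $Q=(Q_{k,k'})_{k,k'\in\mathcal K}$ be a matrix of polynomials $Q_{k,k'}\in A[u,v]$ such that $Q_{k,k'}(u,v)=Q_{k',k}(v,u)$, $Q_{k,k}=0$, and $Q_{k,k'}=1$ whenever $k\in\mathcal K_j$, $k'\in\mathcal K_{j'}$ with $j\ne j'$. For $j\in J$ let $Q^j=(Q_{k,k'})_{k,k'\in\mathcal K_j}$. $\mathfrak S_n$ acts on $n$-tuples by $\sigma\cdot(x_1,\dots,x_n)=(x_{\sigma^{-1}(1)},\dots,x_{\sigma^{-1}(n)})$ and $s_a=(a,a+1)$. The quiver Hecke algebra $\mathrm H_n(Q)$ is the unital associative $A$-algebra generated by $e(k)$ ($k=(k_1,\dots,k_n)\in\mathcal K^n$), $y_1,\dots,y_n$, $\psi_1,\dots,\psi_{n-1}$ with relations: $\sum_{k\in\mathcal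 K^n}e(k)=1$; $e(k)e(k')=\delta_{k,k'}e(k)$; $y_ae(k)=e(k)y_a$; $\psi_ae(k)=e(s_a\cdot k)\psi_a$; $y_ay_b=y_by_a$; $\psi_ay_b=y_b\psi_a$ if $b\neq a,a+1$; $\psi_a\psi_b=\psi_b\psi_a$ if $|a-b|>1$; $\psi_ay_{a+1}e(k)=(y_a\psi_a+\delta_{k_a,k_{a+1}})e(k)$; $y_{a+1}\psi_ae(k)=(\psi_ay_a+\delta_{k_a,k_{a+1}})e(k)$; $\psi_a^2e(k)=Q_{k_a,k_{a+1}}(y_a,y_{a+1})e(k)$; and $\psi_{a+1}\psi_a\psi_{a+1}e(k)=\psi_a\psi_{a+1}\psi_ae(k)+\frac{Q_{k_a,k_{a+1}}(y_a,y_{a+1})-Q_{k_{a+2},k_{a+1}}(y_{a+2},y_{a+1})}{y_a-y_{a+2}}e(k)$ if $k_a=k_{a+2}$ (the fraction being the polynomial quotient), $\psi_{a+1}\psi_a\psi_{a+1}e(k)=\psi_a\psi_{a+1}\psi_ae(k)$ if $k_a\ne k_{a+2}$. $\mathrm H_{m}(Q^j)$ is defined in the same way from $\mathcal K_j$ and $Q^j$, with $\mathrm H_0(Q^j)=A$. A $d$-composition of $n$ is a tuple $\lambda=(\lambda_1,\dots,\lambda_d)$ of non-negative integers with sum $n$. *)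

(* Defs.v *)
From HB Require Import structures.
From mathcomp Require Import perm all_boot all_algebra.
From mathcomp Require Import boolp.
From mathcomp Require Import finmap monalg.

Set Implicit Arguments.
Unset Strict Implicit.
Unset Printing Implicit Defensive.

Import GRing.Theory.
Local Open Scope ring_scope.
Local Open Scope quotient_scope.

(* Unital associative A-algebras, as rings V with a structure morphism from A
   to the centre of V; the scalar multiple of x by a is [algmap a * x].
   MathComp's [algType A] is not suitable, as it requires 1 != 0: a quiver Hecke
   algebra is the zero ring when its index set is empty and n > 0. *)
HB.mixin Record PzRing_isPzAlgebra (A : pzRingType) V of GRing.PzRing V := {
  algmap : A -> V;
  algmap_zmod_morphism : zmod_morphism algmap;
  algmap_monoid_morphism : monoid_morphism algmap;
  algmap_central : forall a x, algmap a * x = x * algmap a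
}.

#[short(type="pzAlgType")]
HB.structure Definition PzAlgebra (A : pzRingType) :=
  {V of GRing.PzRing V & PzRing_isPzAlgebra A V}.

Definition alg_morphism (A : pzRingType) (B C : pzAlgType A) (f : B -> C) :=
  [/\ zmod_morphism f, monoid_morphism f & forall a, f (algmap a) = algmap a].

Definition alg_isomorphic (A : pzRingType) (B C : pzAlgType A) : Prop :=
  exists f : B -> C, alg_morphism f /\ bijective f.

Section AlgebraTheory.
Variables (A : pzRingType) (V : pzAlgType A).
HB.instance Definition _ :=
  GRing.isZmodMorphism.Build A V (@algmap A V) algmap_zmod_morphism.
HB.instance Definition _ :=
  GRing.isMonoidMorphism.Build A V (@algmap A V) algmap_monoid_morphism.
End AlgebraTheory.

(* The quotient of an algebra B by the congruence generated by a relation R,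
   that is, by the two-sided ideal generated by the x - y with R x y. *)
Section Quotient.
Variables (A : pzRingType) (B : pzAlgType A) (R : B -> B -> Prop).

Inductive acong : B -> B -> Prop :=
| acong_rel x y : R x y -> acong x y
| acong_refl x : acong x x
| acong_sym x y : acong x y -> acong y x
| acong_trans x y z : acong x y -> acong y z -> acong x z
| acong_add x x' y y' : acong x x' -> acong y y' -> acong (x + y) (x' + y')
| acong_mul x x' y y' : acong x x' -> acong y y' -> acong (x * y) (x' * y').

Definition acongb (x y : B) : bool := `[< acong x y >].

Fact acongb_equiv : equiv_class_of acongb.
Proof.
split=> [x|x y|y x z].
- exact/asboolP/acong_refl.
- by apply/asboolP/asboolP; apply: acong_sym.
- by move=> /asboolP xy /asboolP yz; apply/asboolP; apply: acong_trans yz.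
Qed.

Canonical acong_equiv := EquivRelPack acongb_equiv.

Definition quotalg := {eq_quot acong_equiv}.
HB.instance Definition _ := Choice.on quotalg.
HB.instance Definition _ := EqQuotient.on quotalg.

Definition quotpi (x : B) : quotalg := \pi_quotalg x.

Lemma quotpiP x y : quotpi x = quotpi y <-> acong x y.
Proof.
split=> [/eqP | xy]; last by apply/eqP; rewrite eqmodE; apply/asboolP.
by rewrite eqmodE => /asboolP.
Qed.

Lemma quotpi_surj (u : quotalg) : exists x, u = quotpi x.
Proof. by exists (repr u); rewrite /quotpi reprK. Qed.

Let acong_repr x : acong (repr (quotpi x)) x.
Proof. by apply/quotpiP; rewrite {1}/quotpi reprK. Qed.

Definition quot_add (u v : quotalg) := quotpi (repr u + repr v).
Definition quot_opp (u : quotalg) := quotpi (- repr u).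
Definition quot_mul (u v : quotalg) := quotpi (repr u * repr v).

Let quot_addE x y : quot_add (quotpi x) (quotpi y) = quotpi (x + y).
Proof. by apply/quotpiP/acong_add; apply: acong_repr. Qed.

Let quot_oppE x : quot_opp (quotpi x) = quotpi (- x).
Proof.
apply/quotpiP; rewrite -mulN1r -[- x]mulN1r.
by apply: acong_mul; [apply: acong_refl | apply: acong_repr].
Qed.

Let quot_mulE x y : quot_mul (quotpi x) (quotpi y) = quotpi (x * y).
Proof. by apply/quotpiP/acong_mul; apply: acong_repr. Qed.

Fact quot_addA : associative quot_add.
Proof.
move=> u v w; have [x ->] := quotpi_surj u; have [y ->] := quotpi_surj v.
by have [z ->] := quotpi_surj w; rewrite !quot_addE addrA.
Qed.

Fact quot_addC : commutative quot_add.
Proof. by move=> u v; rewrite /quot_add addrC. Qed.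

Fact quot_add0 : left_id (quotpi 0) quot_add.
Proof. by move=> u; have [x ->] := quotpi_surj u; rewrite quot_addE add0r. Qed.

Fact quot_addN : left_inverse (quotpi 0) quot_opp quot_add.
Proof.
by move=> u; have [x ->] := quotpi_surj u; rewrite quot_oppE quot_addE addNr.
Qed.

HB.instance Definition _ := GRing.isZmodule.Build quotalg
  quot_addA quot_addC quot_add0 quot_addN.

Fact quot_mulA : associative quot_mul.
Proof.
move=> u v w; have [x ->] := quotpi_surj u; have [y ->] := quotpi_surj v.
by have [z ->] := quotpi_surj w; rewrite !quot_mulE mulrA.
Qed.

Fact quot_mul1l : left_id (quotpi 1) quot_mul.
Proof. by move=> u; have [x ->] := quotpi_surj u; rewrite quot_mulE mul1r. Qed.

Fact quot_mul1r : right_id (quotpi 1) quot_mul.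
Proof. by move=> u; have [x ->] := quotpi_surj u; rewrite quot_mulE mulr1. Qed.

Fact quot_mulDl : left_distributive quot_mul quot_add.
Proof.
move=> u v w; have [x ->] := quotpi_surj u; have [y ->] := quotpi_surj v.
by have [z ->] := quotpi_surj w; rewrite !(quot_addE, quot_mulE) mulrDl.
Qed.

Fact quot_mulDr : right_distributive quot_mul quot_add.
Proof.
move=> u v w; have [x ->] := quotpi_surj u; have [y ->] := quotpi_surj v.
by have [z ->] := quotpi_surj w; rewrite !(quot_addE, quot_mulE) mulrDr.
Qed.

HB.instance Definition _ := GRing.Zmodule_isPzRing.Build quotalg
  quot_mulA quot_mul1l quot_mul1r quot_mulDl quot_mulDr.

Lemma quotpi_zmod_morphism : zmod_morphism quotpi.
Proof. by move=> x y; rewrite -quot_addE -quot_oppE. Qed.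

Lemma quotpi_monoid_morphism : monoid_morphism quotpi.
Proof. by split=> // x y; rewrite -quot_mulE. Qed.

HB.instance Definition _ :=
  GRing.isZmodMorphism.Build B quotalg quotpi quotpi_zmod_morphism.
HB.instance Definition _ :=
  GRing.isMonoidMorphism.Build B quotalg quotpi quotpi_monoid_morphism.

Definition quot_algmap (a : A) : quotalg := quotpi (algmap a).

Fact quot_algmap_zmod_morphism : zmod_morphism quot_algmap.
Proof. by move=> a b; rewrite /quot_algmap !rmorphB. Qed.

Fact quot_algmap_monoid_morphism : monoid_morphism quot_algmap.
Proof. by split=> [|a b]; rewrite /quot_algmap ?rmorph1 ?rmorphM. Qed.

Fact quot_algmap_central a (u : quotalg) :
  quot_algmap a * u = u * quot_algmap a.
Proof.
have [x ->] := quotpi_surj u.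
by rewrite /quot_algmap -!rmorphM /= algmap_central.
Qed.

HB.instance Definition _ := PzRing_isPzAlgebra.Build A quotalg
  quot_algmap_zmod_morphism quot_algmap_monoid_morphism quot_algmap_central.

End Quotient.

Section FreeAlgebra.
Variables (A : comNzRingType) (G : choiceType).

Definition freealg := {malg A[{fmonom G}]}.
HB.instance Definition _ := GRing.Lalgebra.on freealg.

Definition free_algmap (a : A) : freealg := a%:MP.

Fact free_algmap_zmod_morphism : zmod_morphism free_algmap.
Proof. exact: raddfB. Qed.

Fact free_algmap_monoid_morphism : monoid_morphism free_algmap.
Proof. by split=> [|a b]; rewrite /free_algmap ?rmorph1 ?rmorphM. Qed.

Fact free_algmap_central a (x : freealg) : free_algmap a * x = x * free_algmap a.
Proof.
rewrite /free_algmap mul_malgC; apply/malgP => k.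
rewrite mcoeffZ (mcoeffMrw _ (fsubset_refl _) msuppU_le) big_seq_fset1.
rewrite mcoeffUU mulrC {1}[x]monalgE raddf_sum mulr_suml.
by apply: eq_bigr => l _; rewrite /= mcoeffU mulm1 mulrnAl.
Qed.

HB.instance Definition _ := PzRing_isPzAlgebra.Build A freealg
  free_algmap_zmod_morphism free_algmap_monoid_morphism free_algmap_central.

End FreeAlgebra.

(* Locked because unfolding << fmu g >> makes unification diverge *)
HB.lock Definition fgen (A : comNzRingType) (G : choiceType) (g : G) :
  freealg A G := << fmu g >>.
Canonical fgen_unlockable := Unlockable fgen.unlock.
Arguments fgen {A G}.

(* The A-algebra with generating set G and defining relations R *)
Definition presalg (A : comNzRingType) (G : choiceType)
    (R : freealg A G -> freealg A G -> Prop) : pzAlgType A :=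
  quotalg R.

Section PresentedAlgebra.
Variables (A : comNzRingType) (G : choiceType).
Variable R : freealg A G -> freealg A G -> Prop.
Variables (S : pzAlgType A) (h : G -> S).

Definition free_eval (x : freealg A G) : S :=
  \sum_(m <- msupp x) algmap x@_m * \prod_(g <- m : seq G) h g.

Lemma free_evalEw (d : {fset {fmonom G}}) x : (msupp x `<=` d)%fset ->
  free_eval x = \sum_(m <- d) algmap x@_m * \prod_(g <- m : seq G) h g.
Proof.
move=> le; rewrite [LHS](big_fset_incl _ le) => //= m _ /mcoeff_outdom ->.
by rewrite rmorph0 mul0r.
Qed.

Lemma free_evalU c m :
  free_eval << c *g m >> = algmap c * \prod_(g <- m : seq G) h g.
Proof. by rewrite (free_evalEw msuppU_le) big_seq_fset1 mcoeffUU. Qed.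

Lemma free_eval_gen g : free_eval (fgen g) = h g.
Proof. by rewrite unlock free_evalU fmU big_seq1 rmorph1 mul1r. Qed.

Lemma free_eval_zmod_morphism : zmod_morphism free_eval.
Proof.
move=> x y; pose d := (msupp x `|` msupp y `|` msupp (x - y))%fset.
rewrite !(@free_evalEw d) ?fsubsetUr // /d.
- rewrite -sumrB; apply: eq_bigr => m _.
  by rewrite mcoeffB rmorphB mulrBl.
- by rewrite -fsetUA fsetUCA fsubsetUl.
- by rewrite -fsetUA fsubsetUl.
Qed.

HB.instance Definition _ := GRing.isZmodMorphism.Build (freealg A G) S
  free_eval free_eval_zmod_morphism.

Lemma free_eval_monoid_morphism : monoid_morphism free_eval.
Proof.
split=> [|x y]; first by rewrite free_evalU fm1 big_nil rmorph1 mulr1.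
rewrite malgME raddf_sum mulr_suml; apply: eq_bigr => m _.
rewrite raddf_sum mulr_sumr; apply: eq_bigr => l _ /=.
rewrite free_evalU fmM big_cat /= rmorphM -!mulrA; congr (_ * _).
by rewrite !mulrA; congr (_ * _); rewrite algmap_central.
Qed.

HB.instance Definition _ := GRing.isMonoidMorphism.Build (freealg A G) S
  free_eval free_eval_monoid_morphism.

Lemma free_eval_algmap a : free_eval (algmap a) = algmap a.
Proof. by rewrite free_evalU fm1 big_nil mulr1. Qed.

Hypothesis hR : forall x y, R x y -> free_eval x = free_eval y.

Lemma presalg_lift : exists f : presalg R -> S,
  alg_morphism f /\ forall g, f (quotpi R (fgen g)) = h g.
Proof.
have evR x y : acong R x y -> free_eval x = free_eval y.
  elim=> {x y} [x y /hR //|//|x y _ -> //|x y z _ -> _ -> //|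
    x x' y y' _ ex _ ey|x x' y y' _ ex _ ey].
    by rewrite !rmorphD /= ex ey.
  by rewrite !rmorphM /= ex ey.
pose f (u : presalg R) := free_eval (repr u).
have fE x : f (quotpi R x) = free_eval x.
  by apply: evR; apply/quotpiP; rewrite {1}/quotpi reprK.
exists f; split=> [|g]; last by rewrite fE free_eval_gen.
split=> [u v||a]; last by rewrite fE free_eval_algmap.
  have [x ->] := quotpi_surj u; have [y ->] := quotpi_surj v.
  by rewrite -rmorphB !fE rmorphB.
split=> [|u v]; first by rewrite -(rmorph1 (quotpi R)) fE rmorph1.
have [x ->] := quotpi_surj u; have [y ->] := quotpi_surj v.
by rewrite -rmorphM !fE rmorphM.
Qed.

Lemma presalg_lift_unique (f f' : presalg R -> S) :
    alg_morphism f -> alg_morphism f' ->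
    (forall g, f (quotpi R (fgen g)) = f' (quotpi R (fgen g))) -> f =1 f'.
Proof.
move=> [fB [f1 fM] fa] [f'B [f'1 f'M] f'a] ff' u.
have f0 : f 0 = 0 by rewrite -(subrr 0) fB subrr.
have f'0 : f' 0 = 0 by rewrite -(subrr 0) f'B subrr.
have fD x y : f (x + y) = f x + f y.
  by rewrite -[y in LHS]opprK fB -[- y]sub0r fB f0 sub0r opprK.
have f'D x y : f' (x + y) = f' x + f' y.
  by rewrite -[y in LHS]opprK f'B -[- y]sub0r f'B f'0 sub0r opprK.
have monE (s : seq G) : f (quotpi R << FMonom s >>) = f' (quotpi R << FMonom s >>).
  elim: s => [|g s IHs].
    by rewrite -fmoneE (rmorph1 (quotpi R)) f1 f'1.
  have -> : << FMonom (g :: s) >> = fgen g * << FMonom s >> :> freealg A G.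
    have -> : FMonom (g :: s) = mmul (fmu g) (FMonom s).
      by apply/eqP; rewrite fmP fmM fmU.
    apply/malgP => k; rewrite unlock (mcoeffMlw _ msuppU_le msuppU_le).
    by rewrite !big_seq_fset1 !mcoeffUU mulr1 mcoeffU.
  by rewrite rmorphM /= fM f'M ff' IHs.
have [x ->] := quotpi_surj u; rewrite [x]monalgE.
elim/big_ind: _ => [|y z fy fz|m _]; first by rewrite rmorph0 f0 f'0.
  by rewrite rmorphD /= fD f'D fy fz.
have -> : << x@_m *g m >> = (x@_m)%:MP * << m >> :> {malg A[{fmonom G}]}.
  by rewrite mul_malgC; apply/malgP => k; rewrite mcoeffZ !mcoeffU mulr_natr.
have algE c : quotpi R (c%:MP) = algmap c by [].
rewrite (rmorphM (quotpi R)) /= fM f'M algE fa f'a; congr (_ * _).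
by case: m => s; apply: monE.
Qed.

End PresentedAlgebra.

(* A finite direct sum of algebras, with componentwise operations *)
Section ProductAlgebra.
Variables (A : pzRingType) (I : finType) (B : I -> pzAlgType A).

Definition prodalg := {dffun forall i, B i}.
HB.instance Definition _ := Choice.on prodalg.
Implicit Types x y : prodalg.

Definition prod_zero : prodalg := [ffun=> 0].
Definition prod_opp x : prodalg := [ffun i => - x i].
Definition prod_add x y : prodalg := [ffun i => x i + y i].
Definition prod_one : prodalg := [ffun=> 1].
Definition prod_mul x y : prodalg := [ffun i => x i * y i].
Definition prod_algmap (a : A) : prodalg := [ffun=> algmap a].

Fact prod_addA : associative prod_add.
Proof. by move=> x y z; apply/ffunP => i; rewrite !ffunE addrA. Qed.
Fact prod_addC : commutative prod_add.
Proof. by move=> x y; apply/ffunP => i; rewrite !ffunE addrC. Qed.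
Fact prod_add0 : left_id prod_zero prod_add.
Proof. by move=> x; apply/ffunP => i; rewrite !ffunE add0r. Qed.
Fact prod_addN : left_inverse prod_zero prod_opp prod_add.
Proof. by move=> x; apply/ffunP => i; rewrite !ffunE addNr. Qed.

HB.instance Definition _ := GRing.isZmodule.Build prodalg
  prod_addA prod_addC prod_add0 prod_addN.

Fact prod_mulA : associative prod_mul.
Proof. by move=> x y z; apply/ffunP => i; rewrite !ffunE mulrA. Qed.
Fact prod_mul1l : left_id prod_one prod_mul.
Proof. by move=> x; apply/ffunP => i; rewrite !ffunE mul1r. Qed.
Fact prod_mul1r : right_id prod_one prod_mul.
Proof. by move=> x; apply/ffunP => i; rewrite !ffunE mulr1. Qed.
Fact prod_mulDl : left_distributive prod_mul prod_add.
Proof. by move=> x y z; apply/ffunP => i; rewrite !ffunE mulrDl. Qed.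
Fact prod_mulDr : right_distributive prod_mul prod_add.
Proof. by move=> x y z; apply/ffunP => i; rewrite !ffunE mulrDr. Qed.

HB.instance Definition _ := GRing.Zmodule_isPzRing.Build prodalg
  prod_mulA prod_mul1l prod_mul1r prod_mulDl prod_mulDr.

Fact prod_algmap_zmod_morphism : zmod_morphism prod_algmap.
Proof. by move=> a b; apply/ffunP => i; rewrite !ffunE rmorphB. Qed.
Fact prod_algmap_monoid_morphism : monoid_morphism prod_algmap.
Proof.
by split=> [|a b]; apply/ffunP => i; rewrite !ffunE ?rmorph1 ?rmorphM.
Qed.
Fact prod_algmap_central a x : prod_algmap a * x = x * prod_algmap a.
Proof. by apply/ffunP => i; rewrite !ffunE algmap_central. Qed.

HB.instance Definition _ := PzRing_isPzAlgebra.Build A prodalg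
  prod_algmap_zmod_morphism prod_algmap_monoid_morphism prod_algmap_central.

End ProductAlgebra.

Section MatrixAlgebra.
Variables (A : pzRingType) (m : nat) (B : pzAlgType A).

Definition matalg := 'M[B]_m.
HB.instance Definition _ := GRing.PzRing.on matalg.

Definition mat_algmap (a : A) : matalg := (algmap a)%:M.

Fact mat_algmap_zmod_morphism : zmod_morphism mat_algmap.
Proof. by move=> a b; rewrite /mat_algmap rmorphB raddfB. Qed.
Fact mat_algmap_monoid_morphism : monoid_morphism mat_algmap.
Proof.
by split=> [|a b]; rewrite /mat_algmap ?rmorph1 // rmorphM scalar_mxM.
Qed.
Fact mat_algmap_central a (x : matalg) : mat_algmap a * x = x * mat_algmap a.
Proof.
rewrite [LHS](mul_scalar_mx _ x); apply/matrixP => i j.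
rewrite [RHS]mxE (bigD1 j) //= big1.
  by rewrite !mxE eqxx mulr1n addr0 algmap_central.
by move=> k kj; rewrite !mxE (negPf kj) mulr0.
Qed.

HB.instance Definition _ := PzRing_isPzAlgebra.Build A matalg
  mat_algmap_zmod_morphism mat_algmap_monoid_morphism mat_algmap_central.

End MatrixAlgebra.

(* The tensor product over A of a finite family of algebras. The generator of
   x : prodalg B stands for the pure tensor of the x i; as products of pure
   tensors are pure tensors, the underlying module is the free module on the
   x modulo multilinearity. *)
Section TensorAlgebra.
Variables (A : comNzRingType) (I : finType) (B : I -> pzAlgType A).

Inductive tensor_rel : freealg A (prodalg B) -> freealg A (prodalg B) -> Prop :=
| tensor_linear i a (x y z : prodalg B) :
    (forall j, j != i -> x j = y j /\ x j = z j) ->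
    x i = algmap a * y i + z i ->
    tensor_rel (fgen x) (algmap a * fgen y + fgen z)
| tensor_mul (x y : prodalg B) : tensor_rel (fgen x * fgen y) (fgen (x * y))
| tensor_one : tensor_rel (fgen (1 : prodalg B)) 1.

Definition tensoralg : pzAlgType A := presalg tensor_rel.

End TensorAlgebra.

(* A polynomial in A[u, v] is an element of {poly {poly A}} in which u is the
   outer indeterminate. Below the arguments x, y, z commute only modulo the
   relations of the algebra, hence a fixed order in the monomials. *)
Definition eval2 (A : comNzRingType) (V : pzAlgType A)
    (P : {poly {poly A}}) (x y : V) : V :=
  \sum_(i < size P) \sum_(j < size P`_i) algmap P`_i`_j * x ^+ i * y ^+ j.

Definition eval3 (A : comNzRingType) (V : pzAlgType A)
    (P : {poly {poly {poly A}}}) (x y z : V) : V :=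
  \sum_(i < size P) x ^+ i * eval2 P`_i y z.

Section QuiverHecke.
Variables (A : comNzRingType) (K : finType) (Q : K -> K -> {poly {poly A}}).
Variable n : nat.

Definition qh_gen : Type := ({ffun 'I_n -> K} + 'I_n + 'I_n.-1)%type.
HB.instance Definition _ := Choice.on qh_gen.
Notation F := (freealg A qh_gen).

Definition qh_e (k : {ffun 'I_n -> K}) : F := fgen (inl (inl k)).
Definition qh_y (b : 'I_n) : F := fgen (inl (inr b)).
Definition qh_psi (a : 'I_n.-1) : F := fgen (inr a).

Definition place_act (s : 'S_n) (k : {ffun 'I_n -> K}) : {ffun 'I_n -> K} :=
  [ffun b => k ((s^-1)%g b)].

(* The positions a and a + 1 of 'I_n attached to an index a of 'I_n.-1 *)
Fact qh_snd_subproof (a : 'I_n.-1) : (a.+1 < n)%N.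
Proof. by case: n a => [|m] [a] //=. Qed.

Definition qh_fst (a : 'I_n.-1) : 'I_n := widen_ord (leq_pred n) a.
Definition qh_snd (a : 'I_n.-1) : 'I_n := Ordinal (qh_snd_subproof a).

Definition qh_s (a : 'I_n.-1) : 'S_n := tperm (qh_fst a) (qh_snd a).

(* The quotient of P(u, v) - P'(w, v) by u - w, as a polynomial in u (outer),
   w (middle) and v (inner). The division is exact when P = P'. *)
Definition ddiff (P P' : {poly {poly A}}) : {poly {poly {poly A}}} :=
  Pdiv.Ring.rdivp (map_poly polyC P - P'%:P) ('X - 'X%:P).

Local Notation e := qh_e.
Local Notation y := qh_y.
Local Notation psi := qh_psi.
Local Notation fst := qh_fst.
Local Notation snd := qh_snd.

Inductive qh_rel : F -> F -> Prop :=
| qh_e_sum : qh_rel (\sum_k e k) 1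
| qh_e_idem k k' : qh_rel (e k * e k') ((k == k')%:R * e k)
| qh_y_e b k : qh_rel (y b * e k) (e k * y b)
| qh_psi_e a k : qh_rel (psi a * e k) (e (place_act (qh_s a) k) * psi a)
| qh_y_y b c : qh_rel (y b * y c) (y c * y b)
| qh_psi_y a b : b != fst a -> b != snd a ->
    qh_rel (psi a * y b) (y b * psi a)
| qh_psi_psi (a b : 'I_n.-1) : (a.+1 < b)%N || (b.+1 < a)%N ->
    qh_rel (psi a * psi b) (psi b * psi a)
| qh_psi_y_snd a (k : {ffun 'I_n -> K}) :
    qh_rel (psi a * y (snd a) * e k)
      ((y (fst a) * psi a + (k (fst a) == k (snd a))%:R) * e k)
| qh_y_snd_psi a (k : {ffun 'I_n -> K}) :
    qh_rel (y (snd a) * psi a * e k)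
      ((psi a * y (fst a) + (k (fst a) == k (snd a))%:R) * e k)
| qh_psi_sqr a (k : {ffun 'I_n -> K}) :
    qh_rel (psi a ^+ 2 * e k)
      (eval2 (Q (k (fst a)) (k (snd a))) (y (fst a)) (y (snd a)) * e k)
| qh_braid_eq (a b : 'I_n.-1) (k : {ffun 'I_n -> K}) : b = a.+1 :> nat ->
    k (fst a) = k (snd b) ->
    qh_rel (psi b * psi a * psi b * e k)
      (psi a * psi b * psi a * e k
       + eval3 (ddiff (Q (k (fst a)) (k (snd a))) (Q (k (snd b)) (k (snd a))))
           (y (fst a)) (y (snd b)) (y (snd a)) * e k)
| qh_braid_neq (a b : 'I_n.-1) (k : {ffun 'I_n -> K}) : b = a.+1 :> nat ->
    k (fst a) <> k (snd b) ->
    qh_rel (psi b * psi a * psi b * e k) (psi a * psi b * psi a * e k).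

Definition qhecke : pzAlgType A := presalg qh_rel.

End QuiverHecke.

Lemma ddiffP (A : comNzRingType) (P : {poly {poly A}}) :
  ddiff P P * ('X - 'X%:P) = map_poly polyC P - P%:P.
Proof.
have : root (map_poly polyC P - P%:P) 'X.
  rewrite rootE hornerD hornerN hornerC -[(map_poly _ _).['X]]/(P \Po 'X).
  by rewrite comp_polyXr subrr.
case/factor_theorem => D DE; rewrite /ddiff DE.
by rewrite Pdiv.RingMonic.rdivp_mull ?monicXsubC.
Qed.

Section QuiverHeckeZero.
Variables (A : comNzRingType) (K : finType) (Q : K -> K -> {poly {poly A}}).

HB.instance Definition _ := @PzRing_isPzAlgebra.Build A A^o id
  (fun _ _ => erefl) (conj erefl (fun _ _ => erefl)) (@mulrC A).

(* With the general definition, H_0(Q) is A. *)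
Lemma qhecke0 : bijective (@algmap A (qhecke Q 0)).
Proof.
pose h (g : qh_gen K 0) : A^o := if g is inl (inl _) then 1 else 0.
have k0 (k k' : {ffun 'I_0 -> K}) : k = k' by apply/ffunP => -[].
pose k1 : {ffun 'I_0 -> K} :=
  [ffun i : 'I_0 => False_rect K (notF (ltn_ord i))].
have sum1 (V : nmodType) (E : {ffun 'I_0 -> K} -> V) : \sum_k E k = E k1.
  by rewrite (bigD1 k1) //= big1 ?addr0 // => k /eqP[]; apply: k0.
have hR x y : qh_rel Q x y -> free_eval h x = free_eval h y.
  have no (i : 'I_0) : False by case: i.
  case=> {x y}; [| | by move=> b; case: (no b) | by move=> a; case: (no a) ..].
    rewrite sum1 (free_eval_gen h (inl (inl k1))).
    by rewrite (free_eval_monoid_morphism h).1.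
  move=> k k'; rewrite (k0 k k') eqxx mul1r.
  rewrite (free_eval_monoid_morphism h).2 (free_eval_gen h (inl (inl k'))).
  exact: mulr1.
have [f [fA fg]] := presalg_lift hR; have [fB [f1 fM] fa] := fA.
exists f; first exact: fa.
pose g u : qhecke Q 0 := algmap (f u).
have gA : alg_morphism g.
  split=> [u v||a]; first by rewrite /g fB rmorphB.
    by split=> [|u v]; rewrite /g ?f1 ?fM ?rmorph1 ?rmorphM.
  by rewrite /g fa.
have idA : alg_morphism (@id (qhecke Q 0)) by [].
apply: (presalg_lift_unique gA idA) => -[[k|[]//]|[]//].
rewrite /g fg /= rmorph1; symmetry; apply/quotpiP.
apply: acong_trans (acong_rel (qh_e_sum Q 0)).
by rewrite sum1 (k0 k k1); apply: acong_refl.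
Qed.

End QuiverHeckeZero.

Definition block (K : finType) (X : {set K}) : finType := {k : K | k \in X}.

Definition subQ (A : comNzRingType) (K : finType) (X : {set K})
    (Q : K -> K -> {poly {poly A}}) (k k' : block X) : {poly {poly A}} :=
  Q (val k) (val k').

Definition dcomposition (d n : nat) : finType :=
  {l : {ffun 'I_d -> 'I_n.+1} | (\sum_j l j == n)%N}.

Definition multinom (d n : nat) (l : dcomposition d n) : nat :=
  (n`! %/ \prod_j (val l j)`!)%N.

Definition qheckecomp (A : comNzRingType) (d : nat) (K : finType)
    (KJ : 'I_d -> {set K}) (Q : K -> K -> {poly {poly A}}) (n : nat)
    (l : dcomposition d n) : pzAlgType A :=
  tensoralg (fun j => qhecke (subQ (X := KJ j) Q) (val l j)).

(* Main.v *)
(* Let t be a sequence of n blocks, e(t) the sum of the e(k) with k_a in the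
   block t_a for all a, and let l range over the contents of the t's. A crossing
   psi_a of two strands in different blocks squares to 1 and satisfies the braid
   relations and the relations with the y_b without error term. Hence the product
   u_t of the psi_a's along a shortest path from the sorted sequence st of content
   l to t does not depend on the path, u_t is invertible with inverse v_t, and
   conjugation by u_t renumbers the strands.
     In one direction, H_n(Q) acts on the free right H_l(Q)-module on the t of
   content l: e(k) and y_a act diagonally, by the generator attached to the strand
   number #{b < a | t_b = t_a} of the block t_a, and psi_a sends t to s_a t with
   coefficient 1, or with coefficient psi if t_a = t_(a+1). Checking the relations
   column by column gives Phi. In the other direction, the factors H_(l_j)(Q^j)
   embed in e(st) H_n(Q) e(st), which gives Th on H_l(Q), and
   Psi(X) = sum_(t, t') u_t Th(X_(t, t')) v_t'. Both composites are the identity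
   because Psi(Phi(x) X) = x Psi(X) holds on the generators x, and because
   Phi(u_t), Phi(Th(b)) and Phi(v_t) are known on the column st. No basis theorem
   for H_n(Q) is needed. *)
From HB Require Import structures.
Require Import Defs.
From mathcomp Require Import perm all_boot all_algebra.
From mathcomp Require Import finmap monalg zify.

Set Implicit Arguments.
Unset Strict Implicit.
Unset Printing Implicit Defensive.

Import GRing.Theory.
Local Open Scope ring_scope.

(** * Presented algebras, tensor products and corners *)

(** The relations are indexed by whole words k in K^n, while every argument touches at most three
    positions. So e(k) is replaced by the local idempotents eps_a(x), the sums of the e(k) with k_a
    = x. [qhsys] states the relations in these terms, and the matrices, the corner of e(st) and the
    block algebras are all treated as such systems. Since Q is 1 across blocks, the error terms of
    mixed crossings disappear: psi_a^2 = Q(y_a, y_(a+1)) is 1, the Kronecker deltas are 0, and a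
    braid whose outer strands have one colour and whose middle strand lies in another block is
    corrected by a divided difference of the constant 1. Only braids of three strands in one block
    can keep a correction, and comparing two sorting paths never meets one. The law Psi(Phi(x) X) =
    x Psi(X) takes the place of multiplicativity of Psi: at X = 1 it gives Psi_l(Phi_l(x)) = x 1_l,
    where 1_l is the sum of the e(t) with t of content l, and the 1_l sum to 1. *)

Definition alg_closed (A : pzRingType) (V : pzAlgType A) (P : V -> Prop) :=
  [/\ forall a, P (algmap a), forall x y, P x -> P y -> P (x + y)
    & forall x y, P x -> P y -> P (x * y)].

Lemma alg_closed_sum (A : pzRingType) (V : pzAlgType A) (P : V -> Prop)
    (I : Type) (r : seq I) (C : pred I) (F : I -> V) :
  alg_closed P -> (forall i, P (F i)) -> P (\sum_(i <- r | C i) F i).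
Proof.
move=> [Pa PD _] PF; elim/big_ind: _ => //.
by rewrite -(rmorph0 (@algmap A V)); apply: Pa.
Qed.

Lemma alg_closed_prod (A : pzRingType) (V : pzAlgType A) (P : V -> Prop)
    (I : Type) (r : seq I) (C : pred I) (F : I -> V) :
  alg_closed P -> (forall i, P (F i)) -> P (\prod_(i <- r | C i) F i).
Proof.
move=> [Pa _ PM] PF; elim/big_ind: _ => //.
by rewrite -(rmorph1 (@algmap A V)); apply: Pa.
Qed.

Lemma alg_morphism_rmorphism (A : pzRingType) (V W : pzAlgType A) (f : V -> W) :
  alg_morphism f -> exists2 g : {rmorphism V -> W}, f = g
    & forall a, g (algmap a) = algmap a.
Proof.
move=> [fB fM fa].
pose g : {rmorphism V -> W} := HB.pack f
  (GRing.isZmodMorphism.Build _ _ f fB) (GRing.isMonoidMorphism.Build _ _ f fM).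
by exists g.
Qed.

(** Every element is the class of a linear combination of words in the generators. This is the form
    in which uniqueness of maps out of a presented algebra is used below. *)
Lemma presalg_ind (A : comNzRingType) (G : choiceType)
    (R : freealg A G -> freealg A G -> Prop) (P : presalg R -> Prop) :
  alg_closed P -> (forall g, P (quotpi R (fgen g))) -> forall u, P u.
Proof.
move=> PC Pg u; have [Pa PD PM] := PC.
have Pmon (s : seq G) : P (quotpi R << FMonom s >>).
  elim: s => [|g s IHs].
    by rewrite -fmoneE (rmorph1 (quotpi R)) -(rmorph1 (@algmap A _)); apply: Pa.
  have -> : << FMonom (g :: s) >> = fgen g * << FMonom s >> :> freealg A G.
    have -> : FMonom (g :: s) = mmul (fmu g) (FMonom s).
      by apply/eqP; rewrite fmP fmM fmU.
    apply/malgP => k; rewrite unlock (mcoeffMlw _ msuppU_le msuppU_le).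
    by rewrite !big_seq_fset1 !mcoeffUU mulr1 mcoeffU.
  by rewrite rmorphM /=; apply: PM.
have [x ->] := quotpi_surj u; rewrite [x]monalgE raddf_sum /=.
apply: alg_closed_sum PC _ => m.
have -> : << x@_m *g m >> = (x@_m)%:MP * << m >> :> {malg A[{fmonom G}]}.
  by rewrite mul_malgC; apply/malgP => k; rewrite mcoeffZ !mcoeffU mulr_natr.
rewrite (rmorphM (quotpi R)) /=; apply: PM; first exact: Pa.
by case: m => s; apply: Pmon.
Qed.

Section Eval.
Variables (A : comNzRingType).

Lemma eval2_morph (V W : pzAlgType A) (f : V -> W) P x y :
  alg_morphism f -> f (eval2 P x y) = eval2 P (f x) (f y).
Proof.
case/alg_morphism_rmorphism=> g -> ga; rewrite /eval2 rmorph_sum.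
apply: eq_bigr => i _; rewrite rmorph_sum; apply: eq_bigr => j _.
by rewrite !rmorphM !rmorphXn /= ga.
Qed.

Lemma eval3_morph (V W : pzAlgType A) (f : V -> W) P x y z :
  alg_morphism f -> f (eval3 P x y z) = eval3 P (f x) (f y) (f z).
Proof.
move=> fA; have [g fg _] := alg_morphism_rmorphism fA; subst f.
rewrite /eval3 rmorph_sum; apply: eq_bigr => i _.
by rewrite rmorphM rmorphXn /= (eval2_morph _ _ _ fA).
Qed.

Lemma eval2_1 (V : pzAlgType A) (x y : V) : eval2 1 x y = 1.
Proof.
rewrite /eval2 size_poly1 big_ord1 coefC /= size_poly1 big_ord1 coefC /=.
by rewrite !expr0 !mulr1 rmorph1.
Qed.

Lemma eval3_0 (V : pzAlgType A) (x y z : V) : eval3 0 x y z = 0.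
Proof. by rewrite /eval3 size_poly0 big_ord0. Qed.

(** This removes the correction of a braid whose middle strand is in another block than the two
    outer ones. *)
Lemma ddiff1 : ddiff (1 : {poly {poly A}}) 1 = 0.
Proof. by rewrite /ddiff rmorph1 subrr Pdiv.Ring.rdiv0p. Qed.

End Eval.

Section OrderedProducts.
Variables (R : pzRingType) (I : eqType).
Implicit Types (r : seq I) (F G : I -> R).

Lemma prod_single r F j : uniq r -> j \in r -> (forall i, i != j -> F i = 1) ->
  \prod_(i <- r) F i = F j.
Proof.
move=> + + F1; elim: r => // i r IHr /= /andP[ir Ur].
rewrite inE big_cons => /orP[/eqP ij|jr].
  rewrite -ij big1_seq ?mulr1 // => k /andP[_ kr]; apply: F1.
  by apply: contraNneq ir => kj; rewrite -ij -kj.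
rewrite IHr // F1 ?mul1r //.
by apply: contraNneq ir => ->.
Qed.

Lemma comm_prod_seq r F x :
  {in r, forall i, GRing.comm x (F i)} -> GRing.comm x (\prod_(i <- r) F i).
Proof. by move=> xF; rewrite big_seq; apply: commr_prod. Qed.

(** A factor G i only has to pass the F j with j after i, so nothing is asked of F i and G i at the
    same index; in a tensor product of noncommutative algebras nothing more is available. *)
Lemma prodM_comm r F G : uniq r ->
    {in r &, forall i j, i != j -> GRing.comm (F i) (G j)} ->
  \prod_(i <- r) (F i * G i) = \prod_(i <- r) F i * \prod_(i <- r) G i.
Proof.
elim: r => [|i r IHr] /=; first by rewrite !big_nil mulr1.
case/andP=> ir Ur FG; rewrite !big_cons IHr //; last first.
  by move=> j k jr kr; apply: FG; rewrite inE ?jr ?kr orbT.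
have GF : G i * \prod_(j <- r) F j = \prod_(j <- r) F j * G i.
  apply: comm_prod_seq => j jr; apply/commr_sym/FG; rewrite ?inE ?eqxx ?jr ?orbT //.
  by apply: contraNneq ir => <-.
by rewrite -!mulrA; congr (_ * _); rewrite !mulrA GF.
Qed.

End OrderedProducts.

(** * Pure tensors and the universal property of the tensor product *)

Section TensorProduct.
Variables (A : comNzRingType) (I : finType) (B : I -> pzAlgType A).
Local Notation T := (tensoralg B).

Definition pure (x : prodalg B) : T := quotpi (@tensor_rel A I B) (fgen x).

Lemma pure_linear i a (x y z : prodalg B) :
    (forall j, j != i -> x j = y j /\ x j = z j) ->
    x i = algmap a * y i + z i ->
  pure x = algmap a * pure y + pure z.
Proof.
move=> xyz xi; rewrite -[algmap a]/(quotpi (@tensor_rel A I B) (algmap a)).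
rewrite /pure -rmorphM -rmorphD; apply/quotpiP/acong_rel.
exact: tensor_linear xyz xi.
Qed.

Lemma pureM x y : pure (x * y) = pure x * pure y.
Proof.
by rewrite /pure -rmorphM; apply/quotpiP/acong_sym/acong_rel/tensor_mul.
Qed.

Lemma pure1 : pure 1 = 1.
Proof.
by rewrite -(rmorph1 (quotpi (@tensor_rel A I B)));
  apply/quotpiP/acong_rel/tensor_one.
Qed.

Definition slot j (x : B j) : prodalg B :=
  [ffun i => dfwith (fun i => 1 : B i) x i].

Lemma slot_in j (x : B j) : slot x j = x.
Proof. by rewrite ffunE dfwith_in. Qed.

Lemma slot_out i j (x : B j) : i != j -> slot x i = 1.
Proof. by move=> ij; rewrite ffunE dfwith_out // eq_sym. Qed.

Definition tensor_in j (x : B j) : T := pure (slot x).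

Lemma prodalg_mulE (x y : prodalg B) i : (x * y) i = x i * y i.
Proof. by rewrite ffunE. Qed.

Lemma prodalg_1E i : (1 : prodalg B) i = 1.
Proof. by rewrite ffunE. Qed.

Lemma slotM j (x y : B j) : slot (x * y) = slot x * slot y.
Proof.
apply/ffunP => i; rewrite prodalg_mulE.
have [->|ij] := eqVneq i j; first by rewrite !slot_in.
by rewrite !slot_out // mulr1.
Qed.

Lemma slot1 j : slot (1 : B j) = 1.
Proof.
apply/ffunP => i; rewrite prodalg_1E.
by have [->|ij] := eqVneq i j; rewrite (slot_in, slot_out).
Qed.

Lemma tensor_in_lin j a (x y : B j) :
  tensor_in (algmap a * x + y) = algmap a * tensor_in x + tensor_in y.
Proof.
apply: (@pure_linear j) => [i ij|]; first by rewrite !slot_out.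
by rewrite !slot_in.
Qed.

Lemma tensor_in_morphism j : alg_morphism (@tensor_in j).
Proof.
have sub : zmod_morphism (@tensor_in j).
  move=> x y; have -> : x - y = algmap (-1) * y + x.
    by rewrite rmorphN rmorph1 mulN1r addrC.
  by rewrite tensor_in_lin rmorphN rmorph1 mulN1r addrC.
split=> // [|a].
  by split=> [|x y]; rewrite /tensor_in ?slot1 ?pure1 ?slotM ?pureM.
have t0 : tensor_in (0 : B j) = 0 by rewrite -(subrr 0) sub subrr.
rewrite -[algmap a]mulr1 -[X in tensor_in X]addr0 tensor_in_lin t0 addr0.
by rewrite /tensor_in slot1 pure1 mulr1.
Qed.

Lemma tensor_in_comm i j (x : B i) (y : B j) : i != j ->
  GRing.comm (tensor_in x) (tensor_in y).
Proof.
move=> ij; rewrite /GRing.comm /tensor_in -!pureM; congr pure.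
apply/ffunP => k; rewrite !prodalg_mulE.
have [->|ki] := eqVneq k i; first by rewrite (slot_out _ ij) mulr1 mul1r.
by rewrite (slot_out _ ki) mulr1 mul1r.
Qed.

(** At each index all slots but one are 1, so the slots multiply to x. Hence the images of the
    factors generate the tensor product. *)
Lemma pure_prod x : pure x = \prod_j tensor_in (x j).
Proof.
have xE : x = \prod_j slot (x j).
  apply/ffunP => i.
  have -> : (\prod_j slot (x j)) i = \prod_j (slot (x j) i).
    by elim/big_rec2: _ => [|j y z _ <-]; rewrite ?prodalg_1E ?prodalg_mulE.
  rewrite (@prod_single _ _ _ _ i) ?index_enum_uniq ?mem_index_enum ?slot_in //.
  by move=> j ji; rewrite slot_out // eq_sym.
by rewrite {1}xE (big_morph pure pureM pure1).
Qed.

Lemma tensoralg_ind (P : T -> Prop) :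
  alg_closed P -> (forall j x, P (@tensor_in j x)) -> forall u, P u.
Proof.
move=> PC PI; apply: presalg_ind => // x.
by rewrite -/(pure x) pure_prod; apply: alg_closed_prod.
Qed.

Section Lift.
Variables (S : pzAlgType A) (f : forall j, B j -> S).
Hypothesis fA : forall j, alg_morphism (@f j).
Hypothesis fC : forall i j x y, i != j -> GRing.comm (@f i x) (@f j y).

(** A pure tensor goes to the ordered product of the images of its components. Multilinearity in the
    index i follows by cutting [index_enum] at i, and multiplicativity from the commutation of
    images of different factors. *)
Lemma tensor_lift : exists F : T -> S, alg_morphism F /\
  forall j x, F (@tensor_in j x) = @f j x.
Proof.
have f1 j : @f j 1 = 1 by have [_ []] := fA j.
have fM j : {morph @f j : x y / x * y} by have [_ []] := fA j.
pose h (x : prodalg B) := \prod_j @f j (x j).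
have hR x y : tensor_rel x y -> free_eval h x = free_eval h y.
  case=> {x y} [i a x y z xyz xi|x y|].
  - rewrite rmorphD rmorphM /= free_eval_algmap !free_eval_gen /h.
    have [r1 [r2 [rE i1 i2]]] : exists r1 r2, [/\ index_enum I = r1 ++ i :: r2,
        i \notin r1 & i \notin r2].
      have := index_enum_uniq I; have := mem_index_enum i.
      case/splitPr=> r1 r2; rewrite cat_uniq /= => /and3P[_].
      rewrite negb_or => /andP[i1 _] /andP[i2 _]; exists r1, r2.
      by split=> //.
    have same (r : seq I) (w : prodalg B) : i \notin r ->
        (forall j, j != i -> x j = w j) ->
        \prod_(j <- r) f (x j) = \prod_(j <- r) f (w j).
      move=> ir xw; rewrite !big_seq; apply: eq_bigr => j jr; rewrite xw //.
      by apply: contraNneq ir => <-.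
    have xy j : j != i -> x j = y j by case/xyz.
    have xz j : j != i -> x j = z j by case/xyz.
    rewrite rE !big_cat !big_cons /= xi.
    rewrite -!(same r1 y) // -!(same r2 y) // -!(same r1 z) // -!(same r2 z) //.
    have [g fg ga] := alg_morphism_rmorphism (fA i).
    rewrite fg rmorphD rmorphM ga mulrDl mulrDr /= !mulrA; congr (_ + _).
    by rewrite -algmap_central.
  - rewrite rmorphM /= !free_eval_gen /h -prodM_comm ?index_enum_uniq //.
      by apply: eq_bigr => j _; rewrite prodalg_mulE fM.
    by move=> i j _ _; apply: fC.
  - rewrite free_eval_gen rmorph1 /h big1 // => j _.
    by rewrite prodalg_1E f1.
have [F [FA Fg]] := presalg_lift hR; exists F; split=> // j x.
rewrite Fg /h (@prod_single _ _ _ _ j) ?index_enum_uniq ?mem_index_enum //.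
  by rewrite slot_in.
by move=> i ij; rewrite slot_out.
Qed.

End Lift.

End TensorProduct.

(* The type depends on the proof that e is idempotent, so that the ring
   structure below can be inferred from it. *)
Record corner (A : pzRingType) (V : pzAlgType A) (e : V) (ee : e * e = e) : Type :=
  Corner {corner_val : V; _ : e * corner_val * e == corner_val}.

Section Corner.
Variables (A : pzRingType) (V : pzAlgType A) (e : V).
Hypothesis ee : e * e = e.
Local Notation corner := (corner ee).

HB.instance Definition _ := [isSub for @corner_val A V e ee].
HB.instance Definition _ := [Choice of corner by <:].
Implicit Types x y z : corner.

Lemma cornerP x : e * val x * e = val x.
Proof. by case: x => x /= /eqP. Qed.

Lemma corner_mull x : e * val x = val x.
Proof. by rewrite -cornerP !mulrA ee. Qed.

Lemma corner_mulr x : val x * e = val x.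
Proof. by rewrite -cornerP -!mulrA ee. Qed.

Lemma corner_proof u : e * (e * u * e) * e == e * u * e.
Proof. by rewrite !mulrA ee -!mulrA ee. Qed.

(** Compression by e is defined on all of V and fixes the elements of the corner, so each operation
    of the corner is that of V followed by it. *)
Definition in_corner u : corner := Corner ee (corner_proof u).

Lemma in_cornerE u : e * u * e = u -> val (in_corner u) = u.
Proof. by []. Qed.

Definition corner_add x y := in_corner (val x + val y).
Definition corner_opp x := in_corner (- val x).
Definition corner_mul x y := in_corner (val x * val y).

Lemma corner_addE x y : val (corner_add x y) = val x + val y.
Proof. by rewrite in_cornerE // mulrDr mulrDl !cornerP. Qed.
Lemma corner_oppE x : val (corner_opp x) = - val x.
Proof. by rewrite in_cornerE // mulrN mulNr !cornerP. Qed.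
Lemma corner_mulE x y : val (corner_mul x y) = val x * val y.
Proof. by rewrite in_cornerE // mulrA corner_mull -mulrA corner_mulr. Qed.
Lemma corner_0E : val (in_corner 0) = 0.
Proof. by rewrite in_cornerE // mulr0 mul0r. Qed.
Lemma corner_1E : val (in_corner 1) = e.
Proof. by rewrite /= mulr1 ee. Qed.

Let cE := (corner_addE, corner_oppE, corner_mulE, corner_0E, corner_1E).

Fact corner_addA : associative corner_add.
Proof. by move=> x y z; apply: val_inj; rewrite !cE addrA. Qed.
Fact corner_addC : commutative corner_add.
Proof. by move=> x y; apply: val_inj; rewrite !cE addrC. Qed.
Fact corner_add0 : left_id (in_corner 0) corner_add.
Proof. by move=> x; apply: val_inj; rewrite !cE add0r. Qed.
Fact corner_addN : left_inverse (in_corner 0) corner_opp corner_add.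
Proof. by move=> x; apply: val_inj; rewrite !cE addNr. Qed.

HB.instance Definition _ := GRing.isZmodule.Build corner
  corner_addA corner_addC corner_add0 corner_addN.

Fact corner_mulA : associative corner_mul.
Proof. by move=> x y z; apply: val_inj; rewrite !cE mulrA. Qed.
Fact corner_mul1l : left_id (in_corner 1) corner_mul.
Proof. by move=> x; apply: val_inj; rewrite !cE corner_mull. Qed.
Fact corner_mul1r : right_id (in_corner 1) corner_mul.
Proof. by move=> x; apply: val_inj; rewrite !cE corner_mulr. Qed.
Fact corner_mulDl : left_distributive corner_mul corner_add.
Proof. by move=> x y z; apply: val_inj; rewrite !cE mulrDl. Qed.
Fact corner_mulDr : right_distributive corner_mul corner_add.
Proof. by move=> x y z; apply: val_inj; rewrite !cE mulrDr. Qed.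

HB.instance Definition _ := GRing.Zmodule_isPzRing.Build corner
  corner_mulA corner_mul1l corner_mul1r corner_mulDl corner_mulDr.

Definition corner_algmap (a : A) := in_corner (algmap a).

Lemma corner_algmapE a : val (corner_algmap a) = algmap a * e.
Proof. by rewrite /= -algmap_central -mulrA ee. Qed.

Fact corner_algmap_zmod_morphism : zmod_morphism corner_algmap.
Proof.
move=> a b; apply: val_inj; rewrite corner_algmapE rmorphB mulrBl.
by rewrite [RHS]corner_addE corner_oppE !corner_algmapE.
Qed.
Fact corner_algmap_monoid_morphism : monoid_morphism corner_algmap.
Proof.
split=> [|a b]; apply: val_inj.
  by rewrite corner_algmapE rmorph1 mul1r corner_1E.
rewrite [RHS]corner_mulE !corner_algmapE rmorphM.
by rewrite -!mulrA (mulrA e) -algmap_central -mulrA ee.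
Qed.
Fact corner_algmap_central a x : corner_algmap a * x = x * corner_algmap a.
Proof.
apply: val_inj; rewrite ![LHS]corner_mulE [RHS]corner_mulE !corner_algmapE.
by rewrite -mulrA corner_mull !mulrA -algmap_central -mulrA corner_mulr.
Qed.

HB.instance Definition _ := PzRing_isPzAlgebra.Build A corner
  corner_algmap_zmod_morphism corner_algmap_monoid_morphism
  corner_algmap_central.

End Corner.

(** * Local systems of generators *)

(** The transposition s_a on all natural numbers: positions are plain numbers with side conditions a
    < n, so that a + 1 and ranks need no casts. *)
Definition sw (a b : nat) : nat :=
  if b == a then a.+1 else if b == a.+1 then a else b.

Lemma swK a : involutive (sw a).
Proof. by move=> b; rewrite /sw; do 4?case: ifP; lia. Qed.

Lemma sw_lt n a b : (a.+1 < n)%N -> (sw a b < n)%N = (b < n)%N.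
Proof. by rewrite /sw; do 2?case: ifP; lia. Qed.

Lemma swl a : sw a a = a.+1. Proof. by rewrite /sw eqxx. Qed.
Lemma swr a : sw a a.+1 = a. Proof. by rewrite /sw eqxx; case: ifP; lia. Qed.
Lemma sw_out a b : b != a -> b != a.+1 -> sw a b = b.
Proof. by rewrite /sw => /negPf -> /negPf ->. Qed.

(** * Words of commuting local idempotents *)

Section IdempotentWords.
Variables (R : pzRingType) (K : finType) (n : nat) (eps : nat -> K -> R).
Hypothesis eps_sum : forall a, (a < n)%N -> \sum_x eps a x = 1.
Hypothesis eps_idem : forall a x x', (a < n)%N ->
  eps a x * eps a x' = (x == x')%:R * eps a x.
Hypothesis epsC : forall a b x x', (a < n)%N -> (b < n)%N ->
  eps a x * eps b x' = eps b x' * eps a x.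

(** Used at two levels: with colours in K it is e(k), and with blocks it is e(t). *)
Definition word (w : 'I_n -> K) : R := \prod_(a < n) eps a (w a).

Lemma eq_word w w' : w =1 w' -> word w = word w'.
Proof. by move=> ww'; apply: eq_bigr => a _; rewrite ww'. Qed.

Lemma eps_wordC a x w : (a < n)%N -> eps a x * word w = word w * eps a x.
Proof. by move=> an; apply: commr_prod => b _; apply: epsC. Qed.

Lemma eps_word (a : 'I_n) x w : eps a x * word w = (x == w a)%:R * word w.
Proof.
rewrite /word; have := mem_index_enum a.
case/splitPr=> r1 r2; rewrite !big_cat !big_cons /= mulrA.
have -> : eps a x * \prod_(i <- r1) eps i (w i) =
          \prod_(i <- r1) eps i (w i) * eps a x.
  by apply: commr_prod => b _; apply: epsC.
rewrite mulrA -mulrA (mulrA _ _ (\prod_(i <- r2) _)) -(mulrA _ (eps a x)).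
rewrite eps_idem // (_ : (x == w a)%:R * eps a x = (x == w a)%:R * eps a (w a)).
  by case: eqP => _; rewrite ?mul1r ?mulrA // !mul0r ?mulr0 ?mul0r.
by case: eqP => [->//|_]; rewrite !mul0r.
Qed.

Lemma word_eps (a : 'I_n) x w : word w * eps a x = (x == w a)%:R * word w.
Proof. by rewrite -eps_wordC // eps_word. Qed.

Lemma wordl w z : (forall a : 'I_n, eps a (w a) * z = z) -> word w * z = z.
Proof.
move=> wz; rewrite /word; elim/big_rec: _ => [|a u _ uz]; first by rewrite mul1r.
by rewrite -mulrA uz wz.
Qed.

Lemma wordr w z : (forall a : 'I_n, z * eps a (w a) = z) -> z * word w = z.
Proof.
move=> wz; rewrite /word; elim/big_rec: _ => [|a u _ uz]; first by rewrite mulr1.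
by rewrite mulrA wz.
Qed.

Lemma eps_word1 (a : 'I_n) w : eps a (w a) * word w = word w.
Proof. by rewrite eps_word eqxx mul1r. Qed.

Lemma word_eps1 (a : 'I_n) w : word w * eps a (w a) = word w.
Proof. by rewrite word_eps eqxx mul1r. Qed.

Lemma word_idem w : word w * word w = word w.
Proof. by apply: wordl => a; apply: eps_word1. Qed.

Lemma word_orth w w' (a : 'I_n) : w a != w' a -> word w * word w' = 0.
Proof.
move=> ww'; rewrite -(word_eps1 a w) -mulrA eps_word (negPf ww').
by rewrite mul0r mulr0.
Qed.

Lemma word_mul (k k' : {ffun 'I_n -> K}) :
  word k * word k' = (k == k')%:R * word k.
Proof.
have [->|kk'] := eqVneq k k'; first by rewrite word_idem mul1r.
have [a ka] : exists a, k a != k' a.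
  apply/existsP; rewrite -negb_forall; apply: contra kk' => /forallP kk'.
  by apply/eqP/ffunP => a; apply/eqP/kk'.
by rewrite (word_orth ka) mul0r.
Qed.

Lemma word_sum : \sum_(k : {ffun 'I_n -> K}) word k = 1.
Proof.
rewrite /word -(bigA_distr_bigA (fun (a : 'I_n) x => eps a x)).
by rewrite big1 // => a _; apply: eps_sum.
Qed.

Lemma eps_sum_word (a : 'I_n) x :
  eps a x = \sum_(k : {ffun 'I_n -> K} | k a == x) word k.
Proof.
rewrite -[LHS]mulr1 -word_sum mulr_sumr [RHS]big_mkcond /=.
apply: eq_bigr => k _; rewrite eps_word eq_sym.
by case: eqP => _; rewrite ?mul1r ?mul0r.
Qed.

(** Both sides equal w' z w: moved through z, each factor of w' becomes a factor of w and is
    absorbed there, and each factor of w is absorbed by w' in the same way. *)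
Lemma word_swap a z w : (a.+1 < n)%N ->
    (forall b x, (b < n)%N -> z * eps b x = eps (sw a b) x * z) ->
    forall w' : 'I_n -> K, (forall b c : 'I_n, c = sw a b :> nat -> w' c = w b) ->
  z * word w = word w' * z.
Proof.
move=> an zeps w' ww'.
have sb (b : 'I_n) : (sw a b < n)%N by rewrite sw_lt.
have bE (b : 'I_n) : b = sw a (Ordinal (sb b)) :> nat by rewrite /= swK.
transitivity (word w' * z * word w).
  rewrite -mulrA [RHS]wordl // => b; rewrite (ww' _ _ (bE b)) mulrA.
  by rewrite [X in eps X _]bE -zeps // -mulrA eps_word1.
rewrite -[RHS](@wordr w) // => b; rewrite -mulrA zeps // mulrA.
by rewrite -(ww' b (Ordinal (sb b))) // (word_eps1 (Ordinal (sb b))).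
Qed.

End IdempotentWords.

Section Systems.
Variables (A : comNzRingType) (K : finType) (Q : K -> K -> {poly {poly A}}).

(** Being 0 for different outer colours, it merges the two braid relations into one. *)
Definition braid_corr (x x' x'' : K) : {poly {poly {poly A}}} :=
  if x == x'' then ddiff (Q x x') (Q x'' x') else 0.

(** The relations of H_n(Q) with eps a x for the sum of the e(k) such that k_a = x. Each relation
    mentions only the positions that it moves, so a relation of one block can be transported without
    knowing the colours of the other strands. *)
Record qhsys (V : pzAlgType A) (n : nat) (eps : nat -> K -> V)
    (y psi : nat -> V) : Prop := QHSys {
  sys_sum : forall a, (a < n)%N -> \sum_x eps a x = 1;
  sys_idem : forall a x x', (a < n)%N ->
    eps a x * eps a x' = (x == x')%:R * eps a x;
  sys_epsC : forall a b x x', (a < n)%N -> (b < n)%N ->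
    eps a x * eps b x' = eps b x' * eps a x;
  sys_yeps : forall a b x, (a < n)%N -> (b < n)%N ->
    y b * eps a x = eps a x * y b;
  sys_psieps : forall a b x, (a.+1 < n)%N -> (b < n)%N ->
    psi a * eps b x = eps (sw a b) x * psi a;
  sys_yy : forall a b, (a < n)%N -> (b < n)%N -> y a * y b = y b * y a;
  sys_psiy : forall a b, (a.+1 < n)%N -> (b < n)%N -> b != a -> b != a.+1 ->
    psi a * y b = y b * psi a;
  sys_psipsi : forall a b, (a.+1 < n)%N -> (b.+1 < n)%N -> (a.+1 < b)%N ->
    psi a * psi b = psi b * psi a;
  sys_psiy1 : forall a x x', (a.+1 < n)%N ->
    psi a * y a.+1 * (eps a x * eps a.+1 x') =
    (y a * psi a + (x == x')%:R) * (eps a x * eps a.+1 x');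
  sys_y1psi : forall a x x', (a.+1 < n)%N ->
    y a.+1 * psi a * (eps a x * eps a.+1 x') =
    (psi a * y a + (x == x')%:R) * (eps a x * eps a.+1 x');
  sys_psi2 : forall a x x', (a.+1 < n)%N ->
    psi a * psi a * (eps a x * eps a.+1 x') =
    eval2 (Q x x') (y a) (y a.+1) * (eps a x * eps a.+1 x');
  sys_braid : forall a x x' x'', (a.+2 < n)%N ->
    psi a.+1 * psi a * psi a.+1 * (eps a x * (eps a.+1 x' * eps a.+2 x'')) =
    (psi a * psi a.+1 * psi a
     + eval3 (braid_corr x x' x'') (y a) (y a.+2) (y a.+1)) *
    (eps a x * (eps a.+1 x' * eps a.+2 x''))
}.

(** All that is used of a quiver Hecke algebra later: its relations, maps out of it, and induction
    on its generators. It is stated for any H, which keeps the quotient of the free algebra out of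
    the computations. *)
Definition qh_universal (H : pzAlgType A) (n : nat) (eps : nat -> K -> H)
    (y psi : nat -> H) :=
  [/\ qhsys n eps y psi,
      forall (V : pzAlgType A) (eps' : nat -> K -> V) (y' psi' : nat -> V),
        qhsys n eps' y' psi' -> exists f : H -> V, [/\ alg_morphism f,
          forall a x, (a < n)%N -> f (eps a x) = eps' a x,
          forall a, (a < n)%N -> f (y a) = y' a
        & forall a, (a.+1 < n)%N -> f (psi a) = psi' a]
    & forall P : H -> Prop, alg_closed P ->
        (forall a x, (a < n)%N -> P (eps a x)) ->
        (forall a, (a < n)%N -> P (y a)) ->
        (forall a, (a.+1 < n)%N -> P (psi a)) -> forall u, P u].

End Systems.

Section Lift.
Variables (A : comNzRingType) (K : finType) (Q : K -> K -> {poly {poly A}}).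
Variable n : nat.

Lemma qh_s_inv (a : 'I_n.-1) (b : 'I_n) : (qh_s a)^-1%g b = sw a b :> nat.
Proof.
rewrite tpermV /sw; case: tpermP => [->|->|] /=; rewrite ?eqxx //.
  by case: ifP; lia.
by move=> /eqP/negPf ba /eqP/negPf bb; rewrite -!(inj_eq val_inj) /= in ba bb;
  rewrite ba bb.
Qed.


(** * The defining relations evaluated in a local system *)

Section RelationImages.
Variables (V F : pzAlgType A) (eps : nat -> K -> V) (y psi : nat -> V).
Hypothesis S : qhsys Q n eps y psi.
Variables (ev : F -> V) (E : {ffun 'I_n -> K} -> F) (Y : 'I_n -> F).
Variable (P : 'I_n.-1 -> F).
Hypothesis evA : alg_morphism ev.
Hypothesis evE : forall k, ev (E k) = word eps k.
Hypothesis evY : forall b, ev (Y b) = y b.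
Hypothesis evP : forall a, ev (P a) = psi a.
Implicit Types (k : {ffun 'I_n -> K}) (a : 'I_n.-1) (b c : 'I_n).

Let evM u v : ev (u * v) = ev u * ev v.
Proof. by have [_ []] := evA. Qed.

Let evD u v : ev (u + v) = ev u + ev v.
Proof. by have [g -> _] := alg_morphism_rmorphism evA; rewrite rmorphD. Qed.

Let ev_nat m : ev m%:R = m%:R.
Proof. by have [g -> _] := alg_morphism_rmorphism evA; rewrite rmorph_nat. Qed.

Let aP a : (a.+1 < n)%N. Proof. exact: qh_snd_subproof. Qed.

Let W1 := eps_word1 (sys_idem S) (sys_epsC S).

(** The word of k absorbs its own factors at a and a + 1, so a local relation at these two positions
    extends to the whole word. *)
Let W2 k a z z' :
    z * (eps a (k (qh_fst a)) * eps a.+1 (k (qh_snd a))) =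
    z' * (eps a (k (qh_fst a)) * eps a.+1 (k (qh_snd a))) ->
  z * word eps k = z' * word eps k.
Proof.
have -> : word eps k = eps a (k (qh_fst a)) * eps a.+1 (k (qh_snd a)) *
                       word eps k.
  by rewrite -mulrA (W1 (qh_snd a)) (W1 (qh_fst a)).
by move=> zz; rewrite (mulrA z) (mulrA z') zz.
Qed.

Let W3 k (a b : 'I_n.-1) : b = a.+1 :> nat ->
  psi b * psi a * psi b * word eps k =
  (psi a * psi b * psi a
   + eval3 (braid_corr Q (k (qh_fst a)) (k (qh_snd a)) (k (qh_snd b)))
       (y (qh_fst a)) (y (qh_snd b)) (y (qh_snd a))) * word eps k.
Proof.
move=> ba; have := aP b; rewrite ba => a2.
have -> : word eps k = eps a (k (qh_fst a)) * (eps a.+1 (k (qh_snd a)) *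
                       eps a.+2 (k (qh_snd b))) * word eps k.
  rewrite -!mulrA -ba (W1 (qh_snd b)) ba (W1 (qh_snd a)).
  by rewrite (W1 (qh_fst a)).
rewrite (_ : y (qh_snd b) = y a.+2); last by rewrite /= ba.
by rewrite !(mulrA _ _ (word eps k)); congr (_ * _); apply: sys_braid S _ _ _ _ _.
Qed.

Lemma ev_sum_e : ev (\sum_k E k) = ev 1.
Proof.
have [g gE _] := alg_morphism_rmorphism evA.
rewrite [in LHS]gE rmorph_sum gE rmorph1 -gE (eq_bigr _ (fun k _ => evE k)).
exact: word_sum (sys_sum S).
Qed.

Lemma ev_e_e k k' : ev (E k * E k') = ev ((k == k')%:R * E k).
Proof.
by rewrite !evM ev_nat !evE; apply: word_mul (sys_idem S) (sys_epsC S) _ _.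
Qed.

Lemma ev_y_e b k : ev (Y b * E k) = ev (E k * Y b).
Proof.
by rewrite !evM evY evE; apply: commr_prod => a _; apply: sys_yeps S _ _ _ _ _.
Qed.

Lemma ev_psi_e a k : ev (P a * E k) = ev (E (place_act (qh_s a) k) * P a).
Proof.
rewrite !evM evP !evE.
apply: (word_swap (sys_idem S) (sys_epsC S) (aP a)) => [c x cn|c c' cc'].
  exact: sys_psieps S _ _ _ _ _.
by rewrite ffunE; congr (k _); apply: val_inj; rewrite /= qh_s_inv cc' swK.
Qed.

Lemma ev_y_y b c : ev (Y b * Y c) = ev (Y c * Y b).
Proof. by rewrite !evM !evY; apply: sys_yy S _ _ _ _. Qed.

Lemma ev_psi_y a b : b != qh_fst a -> b != qh_snd a -> ev (P a * Y b) = ev (Y b * P a).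
Proof. by move=> ba ba1; rewrite !evM evY evP; apply: sys_psiy S _ _ _ _ _ _. Qed.

Lemma ev_psi_psi (a b : 'I_n.-1) : (a.+1 < b)%N || (b.+1 < a)%N ->
  ev (P a * P b) = ev (P b * P a).
Proof.
rewrite !evM !evP; case/orP=> ab; first exact: sys_psipsi S _ _ _ _ ab.
by rewrite (sys_psipsi S (aP b) (aP a) ab).
Qed.

Lemma ev_psi_y_snd a k : ev (P a * Y (qh_snd a) * E k) =
  ev ((Y (qh_fst a) * P a + (k (qh_fst a) == k (qh_snd a))%:R) * E k).
Proof.
by rewrite !(evM, evD) ev_nat !evY evP evE; apply/(W2 (a := a))/(sys_psiy1 S).
Qed.

Lemma ev_y_snd_psi a k : ev (Y (qh_snd a) * P a * E k) =
  ev ((P a * Y (qh_fst a) + (k (qh_fst a) == k (qh_snd a))%:R) * E k).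
Proof.
by rewrite !(evM, evD) ev_nat !evY evP evE; apply/(W2 (a := a))/(sys_y1psi S).
Qed.

Lemma ev_psi_sqr a k : ev (P a ^+ 2 * E k) =
  ev (eval2 (Q (k (qh_fst a)) (k (qh_snd a))) (Y (qh_fst a)) (Y (qh_snd a)) * E k).
Proof.
rewrite expr2 !evM (eval2_morph _ _ _ evA) !evY evP evE.
exact/(W2 (a := a))/(sys_psi2 S).
Qed.

Lemma ev_braid_eq (a b : 'I_n.-1) k : b = a.+1 :> nat ->
    k (qh_fst a) = k (qh_snd b) ->
  ev (P b * P a * P b * E k) =
  ev (P a * P b * P a * E k
    + eval3 (ddiff (Q (k (qh_fst a)) (k (qh_snd a))) (Q (k (qh_snd b)) (k (qh_snd a))))
        (Y (qh_fst a)) (Y (qh_snd b)) (Y (qh_snd a)) * E k).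
Proof.
move=> ba kk; rewrite !(evM, evD) (eval3_morph _ _ _ _ evA) !evY !evP !evE.
by rewrite -mulrDl W3 // /braid_corr kk eqxx.
Qed.

Lemma ev_braid_neq (a b : 'I_n.-1) k : b = a.+1 :> nat ->
    k (qh_fst a) <> k (qh_snd b) ->
  ev (P b * P a * P b * E k) = ev (P a * P b * P a * E k).
Proof.
move=> ba kk; rewrite !evM !evP !evE W3 // /braid_corr; case: eqP => // _.
by rewrite eval3_0 addr0.
Qed.

End RelationImages.

Lemma qh_lift (V : pzAlgType A) (eps : nat -> K -> V) (y psi : nat -> V) :
    qhsys Q n eps y psi ->
  exists f : qhecke Q n -> V, alg_morphism f /\
    [/\ forall k, f (quotpi (qh_rel Q (n:=n)) (qh_e A k)) = word eps k,
        forall b, f (quotpi (qh_rel Q (n:=n)) (qh_y A K b)) = y b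
      & forall a, f (quotpi (qh_rel Q (n:=n)) (qh_psi A K a)) = psi a].
Proof.
move=> S.
pose h (g : qh_gen K n) : V := match g with
  | inl (inl k) => word eps k | inl (inr b) => y b | inr a => psi a end.
have he k : free_eval h (qh_e A k) = word eps k by exact: free_eval_gen.
have hy b : free_eval h (qh_y A K b) = y b by exact: free_eval_gen.
have hp a : free_eval h (qh_psi A K a) = psi a by exact: free_eval_gen.
have hA : alg_morphism (free_eval h).
  split; [exact: free_eval_zmod_morphism | exact: free_eval_monoid_morphism |].
  exact: free_eval_algmap.
have hR x x' : qh_rel Q x x' -> free_eval h x = free_eval h x'.
  case=> {x x'}.
  - exact: (ev_sum_e S hA he).
  - exact: (ev_e_e S hA he).
  - exact: (ev_y_e S hA he hy).
  - exact: (ev_psi_e S hA he hp).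
  - exact: (ev_y_y S hA hy).
  - exact: (ev_psi_y S hA hy hp).
  - exact: (ev_psi_psi S hA hp).
  - exact: (ev_psi_y_snd S hA he hy hp).
  - exact: (ev_y_snd_psi S hA he hy hp).
  - exact: (ev_psi_sqr S hA he hy hp).
  - exact: (ev_braid_eq S hA he hy hp).
  - exact: (ev_braid_neq S hA he hp).
have [f [fA fg]] := presalg_lift hR; exists f; split=> //.
by split=> [k|b|a]; [apply: (fg (inl (inl k)))|apply: (fg (inl (inr b)))|apply: (fg (inr a))].
Qed.
End Lift.

(** * The local system obtained from the defining relations *)

Section LocalGenerators.
Variables (A : comNzRingType) (K : finType) (Q : K -> K -> {poly {poly A}}).
Variables (n : nat) (H : pzAlgType A).
Variables (E : {ffun 'I_n -> K} -> H) (Y : 'I_n -> H) (P : 'I_n.-1 -> H).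
Implicit Types (k : {ffun 'I_n -> K}) (a : 'I_n.-1) (b c : 'I_n).

(** The existential over ordinals lets a be any number; past n the sum is empty. The default 0 does
    the same for [qh_ynat] and [qh_psinat]. *)
Definition qh_eps (a : nat) (x : K) : H :=
  \sum_(k : {ffun 'I_n -> K} | [exists i : 'I_n, (i == a :> nat) && (k i == x)]) E k.
Definition qh_ynat (a : nat) : H := oapp Y 0 (insub a).
Definition qh_psinat (a : nat) : H := oapp P 0 (insub a).

Lemma qh_epsE b x : qh_eps b x = \sum_(k : {ffun 'I_n -> K} | k b == x) E k.
Proof.
apply: eq_bigl => k; apply/existsP/idP => [[c /andP[/eqP cb]]|kb].
  by rewrite (val_inj cb).
by exists b; rewrite eqxx.
Qed.

Lemma qh_ynatE b : qh_ynat b = Y b.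
Proof. by rewrite /qh_ynat valK. Qed.
Lemma qh_psinatE a : qh_psinat a = P a.
Proof. by rewrite /qh_psinat valK. Qed.

Hypothesis E_sum : \sum_k E k = 1.
Hypothesis EE : forall k k', E k * E k' = (k == k')%:R * E k.
Hypothesis YE : forall b k, Y b * E k = E k * Y b.
Hypothesis PE : forall a k, P a * E k = E (place_act (qh_s a) k) * P a.
Hypothesis YY : forall b c, Y b * Y c = Y c * Y b.
Hypothesis PY : forall a b, b != qh_fst a -> b != qh_snd a -> P a * Y b = Y b * P a.
Hypothesis PP : forall a a' : 'I_n.-1, (a.+1 < a')%N || (a'.+1 < a)%N ->
  P a * P a' = P a' * P a.
Hypothesis PY1 : forall a k, P a * Y (qh_snd a) * E k =
  (Y (qh_fst a) * P a + (k (qh_fst a) == k (qh_snd a))%:R) * E k.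
Hypothesis Y1P : forall a k, Y (qh_snd a) * P a * E k =
  (P a * Y (qh_fst a) + (k (qh_fst a) == k (qh_snd a))%:R) * E k.
Hypothesis PP2 : forall a k, P a ^+ 2 * E k =
  eval2 (Q (k (qh_fst a)) (k (qh_snd a))) (Y (qh_fst a)) (Y (qh_snd a)) * E k.
Hypothesis PPP_eq : forall (a a' : 'I_n.-1) k, a' = a.+1 :> nat ->
    k (qh_fst a) = k (qh_snd a') ->
  P a' * P a * P a' * E k = P a * P a' * P a * E k
    + eval3 (ddiff (Q (k (qh_fst a)) (k (qh_snd a))) (Q (k (qh_snd a')) (k (qh_snd a))))
        (Y (qh_fst a)) (Y (qh_snd a')) (Y (qh_snd a)) * E k.
Hypothesis PPP_neq : forall (a a' : 'I_n.-1) k, a' = a.+1 :> nat ->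
    k (qh_fst a) <> k (qh_snd a') ->
  P a' * P a * P a' * E k = P a * P a' * P a * E k.

Lemma eps_E b x k : qh_eps b x * E k = (x == k b)%:R * E k.
Proof.
rewrite qh_epsE mulr_suml (eq_bigr _ (fun k' _ => EE k' k)) big_mkcond /=.
rewrite (bigD1 k) //= eqxx mul1r big1 ?addr0 => [|k' /negPf kk'].
  by rewrite eq_sym; case: eqP; rewrite ?mul1r ?mul0r.
by rewrite kk' mul0r if_same.
Qed.

Lemma E_ext u v : (forall k, u * E k = v * E k) -> u = v.
Proof.
move=> uv; rewrite -[u]mulr1 -[v]mulr1 -E_sum !mulr_sumr.
by apply: eq_bigr => k _.
Qed.

Let mulnC (m : nat) (u v : H) : u * (m%:R * v) = m%:R * (u * v).
Proof. by rewrite !mulr_natl mulrnAr. Qed.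

(** On E k a local idempotent is 0 or 1, so only the words k with the prescribed colours at b and c
    have to be checked. *)
Let local2 (b c : 'I_n) x x' k (u v : H) :
    (x = k b -> x' = k c -> u * E k = v * E k) ->
  u * (qh_eps b x * qh_eps c x') * E k = v * (qh_eps b x * qh_eps c x') * E k.
Proof.
move=> uv; rewrite -!mulrA !eps_E !mulnC !eps_E.
by do 2![case: eqP => ?]; rewrite ?mul0r ?mul1r ?mulr0 //; apply: uv.
Qed.

Lemma local_system : qhsys Q n qh_eps qh_ynat qh_psinat.
Proof.
have yb b : qh_ynat b = Y b := qh_ynatE b.
have pa a : qh_psinat a = P a := qh_psinatE a.
have yfst a : qh_ynat a = Y (qh_fst a) := yb (qh_fst a).
have ysnd a : qh_ynat a.+1 = Y (qh_snd a) := yb (qh_snd a).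
have ordE m : (m.+1 < n)%N -> exists a : 'I_n.-1, m = a.
  move=> mn; have mn1 : (m < n.-1)%N by lia.
  by exists (Ordinal mn1).
split.
- move=> a an; rewrite -E_sum.
  rewrite (partition_big (fun k : {ffun 'I_n -> K} => k (Ordinal an)) predT) //=.
  by apply: eq_bigr => x _; rewrite (qh_epsE (Ordinal an)).
- move=> a x x' an; apply: E_ext => k; rewrite -!mulrA !(eps_E (Ordinal an)).
  rewrite mulnC (eps_E (Ordinal an)).
  by do 3![case: eqP => ?]; rewrite ?mul0r ?mul1r ?mulr0 //; congruence.
- move=> a b x x' an bn; apply: E_ext => k; rewrite -!mulrA.
  rewrite !(eps_E (Ordinal an)) !(eps_E (Ordinal bn)) !mulnC.
  rewrite !(eps_E (Ordinal an)) !(eps_E (Ordinal bn)).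
  by rewrite mulnC.
- move=> a b x an bn; rewrite (qh_epsE (Ordinal an)) (yb (Ordinal bn)).
  by rewrite mulr_sumr mulr_suml; apply: eq_bigr => k _.
- move=> m b x mn bn; have [a ma] := ordE m mn; rewrite ma in mn *.
  have sn : (sw a b < n)%N by rewrite sw_lt.
  apply: E_ext => k; rewrite pa -mulrA (eps_E (Ordinal bn)) mulnC PE -[RHS]mulrA PE.
  rewrite [RHS]mulrA (eps_E (Ordinal sn)) ffunE -[RHS]mulrA; congr ((x == k _)%:R * _).
  by apply: val_inj; rewrite /= qh_s_inv swK.
- by move=> a b an bn; rewrite (yb (Ordinal an)) (yb (Ordinal bn)).
- move=> m b mn bn; have [a ma] := ordE m mn; rewrite ma pa => ba ba1.
  by rewrite (yb (Ordinal bn)) PY.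
- move=> m m' mn mn'; have [a ->] := ordE m mn; have [a' ->] := ordE m' mn'.
  by move=> aa; rewrite !pa PP // aa.
- move=> m x x' mn; have [a ->] := ordE m mn; rewrite pa yfst ysnd.
  by apply: E_ext => k; apply: (@local2 (qh_fst a) (qh_snd a)) => -> ->; apply: PY1.
- move=> m x x' mn; have [a ->] := ordE m mn; rewrite pa yfst ysnd.
  by apply: E_ext => k; apply: (@local2 (qh_fst a) (qh_snd a)) => -> ->; apply: Y1P.
- move=> m x x' mn; have [a ->] := ordE m mn; rewrite pa yfst ysnd -expr2.
  by apply: E_ext => k; apply: (@local2 (qh_fst a) (qh_snd a)) => -> ->; apply: PP2.
- move=> m x x' x'' mn; have mn1 : (m.+1 < n)%N by lia.
  have [a ma] := ordE m mn1; have [a' ma'] := ordE m.+1 mn.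
  have aa : a' = a.+1 :> nat by rewrite -ma' ma.
  have pa' : qh_psinat a.+1 = P a' by rewrite -pa -ma' ma.
  rewrite ma pa' pa yfst ysnd; have -> : qh_ynat a.+2 = Y (qh_snd a') by rewrite -yb /= aa.
  apply: E_ext => k; have -> : qh_eps a.+2 = qh_eps (qh_snd a') by rewrite /= aa.
  have e3 : qh_eps a x * (qh_eps a.+1 x' * qh_eps (qh_snd a') x'') * E k =
      (x'' == k (qh_snd a'))%:R * ((x' == k (qh_snd a))%:R *
      ((x == k (qh_fst a))%:R * E k)).
    rewrite -!mulrA (eps_E (qh_snd a')) mulnC (eps_E (qh_snd a)) mulnC mulnC.
    by rewrite (eps_E (qh_fst a)).
  rewrite -[LHS]mulrA -[RHS]mulrA e3.
  do 3![case: eqP => ?]; rewrite ?mul0r ?mul1r ?mulr0 //; subst.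
  rewrite /braid_corr mulrDl; case: eqP => kk; first exact: PPP_eq.
  by rewrite eval3_0 mul0r addr0; apply: PPP_neq.
Qed.

Section Closure.
Variable C : H -> Prop.
Hypothesis CC : alg_closed C.
Hypothesis C_eps : forall (a : nat) x, (a < n)%N -> C (qh_eps a x).
Hypothesis C_y : forall a : nat, (a < n)%N -> C (qh_ynat a).
Hypothesis C_psi : forall a : nat, (a.+1 < n)%N -> C (qh_psinat a).

(** The local idempotents recover e(k) as a product, so a property closed under products passes from
    them to the generators of the presentation. *)
Lemma word_E k : word qh_eps k = E k.
Proof.
apply: E_ext => k'; rewrite EE.
have [->|kk'] := eqVneq k k'.
  by rewrite mul1r wordl // => b; rewrite eps_E eqxx mul1r.
have [b kb] : exists b, k b != k' b.
  apply/existsP; rewrite -negb_forall; apply: contra kk' => /forallP kk'.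
  by apply/eqP/ffunP => b; apply/eqP/kk'.
rewrite mul0r -(word_eps1 (sys_idem local_system) (sys_epsC local_system) b).
by rewrite -mulrA eps_E (negPf kb) mul0r mulr0.
Qed.

Lemma closed_generators : [/\ forall k, C (E k), forall b, C (Y b)
  & forall a, C (P a)].
Proof.
split=> [k|b|a].
- by rewrite -word_E; apply: (alg_closed_prod _ _ CC) => a; apply: C_eps.
- by rewrite -qh_ynatE; apply: C_y.
- by rewrite -qh_psinatE; apply: C_psi; apply: qh_snd_subproof.
Qed.

End Closure.

End LocalGenerators.

Section QuiverHeckeUniversal.
Variables (A : comNzRingType) (K : finType) (Q : K -> K -> {poly {poly A}}).
Variable n : nat.
Local Notation H := (qhecke Q n).
Local Notation pi := (quotpi (qh_rel Q (n:=n))).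

Definition heps : nat -> K -> H := qh_eps (fun k => pi (qh_e A k)).
Definition hy : nat -> H := qh_ynat (fun b => pi (qh_y A K b)).
Definition hpsi : nat -> H := qh_psinat (fun a => pi (qh_psi A K a)).

Lemma qhecke_universal : qh_universal Q n heps hy hpsi.
Proof.
(* The projection is made a variable until the relations have been transported, so that only its
   being a morphism is visible. *)
have [p pE] : exists p : freealg A (qh_gen K n) -> H, p = pi by exists pi.
pose E k : H := p (qh_e A k).
pose Y b : H := p (qh_y A K b).
pose P a : H := p (qh_psi A K a).
have piA : alg_morphism p.
  by rewrite pE; split; [apply: quotpi_zmod_morphism | apply: quotpi_monoid_morphism |].
have [piB [pi1 piM] _] := piA.
have pi0 : p 0 = 0 by rewrite -(subrr 0) piB subrr.
have piD u v : p (u + v) = p u + p v.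
  by rewrite -{1}[v]opprK piB -[- v]sub0r piB pi0 sub0r opprK.
have pin m : p m%:R = m%:R.
  by elim: m => [|m IHm]; rewrite ?pi0 // -!natr1 piD pi1 IHm.
have rel u v : qh_rel Q u v -> p u = p v by move=> uv; rewrite pE; apply/quotpiP/acong_rel.
have E_sum : \sum_k E k = 1.
  by rewrite -pi1 -(rel _ _ (qh_e_sum Q n)) (big_morph p piD pi0).
have EE k k' : E k * E k' = (k == k')%:R * E k.
  by rewrite -pin -!piM; apply/rel/qh_e_idem.
have YE b k : Y b * E k = E k * Y b by rewrite -!piM; apply/rel/qh_y_e.
have PE a k : P a * E k = E (place_act (qh_s a) k) * P a.
  by rewrite -!piM; apply/rel/qh_psi_e.
have YY b c : Y b * Y c = Y c * Y b by rewrite -!piM; apply/rel/qh_y_y.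
have PY a b : b != qh_fst a -> b != qh_snd a -> P a * Y b = Y b * P a.
  by move=> ba ba1; rewrite -!piM; apply/rel/qh_psi_y.
have PP (a a' : 'I_n.-1) : (a.+1 < a')%N || (a'.+1 < a)%N ->
    P a * P a' = P a' * P a.
  by move=> aa; rewrite -!piM; apply/rel/qh_psi_psi.
have PY1 a k : P a * Y (qh_snd a) * E k =
    (Y (qh_fst a) * P a + (k (qh_fst a) == k (qh_snd a))%:R) * E k.
by rewrite -pin -!piM -piD -piM; apply/rel/qh_psi_y_snd.
have Y1P a k : Y (qh_snd a) * P a * E k =
    (P a * Y (qh_fst a) + (k (qh_fst a) == k (qh_snd a))%:R) * E k.
  by rewrite -pin -!piM -piD -piM; apply/rel/qh_y_snd_psi.
have PP2 a k : P a ^+ 2 * E k =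
    eval2 (Q (k (qh_fst a)) (k (qh_snd a))) (Y (qh_fst a)) (Y (qh_snd a)) * E k.
  rewrite expr2 -(eval2_morph _ _ _ piA) -!piM -expr2; exact/rel/qh_psi_sqr.
have PPP_eq (a a' : 'I_n.-1) (k : {ffun 'I_n -> K}) : a' = a.+1 :> nat ->
    k (qh_fst a) = k (qh_snd a') ->
    P a' * P a * P a' * E k = P a * P a' * P a * E k
    + eval3 (ddiff (Q (k (qh_fst a)) (k (qh_snd a))) (Q (k (qh_snd a')) (k (qh_snd a))))
        (Y (qh_fst a)) (Y (qh_snd a')) (Y (qh_snd a)) * E k.
  move=> aa kk; rewrite -(eval3_morph _ _ _ _ piA) -!piM -piD.
  exact/rel/qh_braid_eq.
have PPP_neq (a a' : 'I_n.-1) (k : {ffun 'I_n -> K}) : a' = a.+1 :> nat ->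
    k (qh_fst a) <> k (qh_snd a') ->
    P a' * P a * P a' * E k = P a * P a' * P a * E k.
  by move=> aa kk; rewrite -!piM; apply/rel/qh_braid_neq.
subst p.
have sysH : qhsys Q n heps hy hpsi.
  exact (local_system E_sum EE YE PE YY PY PP PY1 Y1P PP2 PPP_eq PPP_neq).
split=> // [V eps' y' psi' S'|C CC C_eps C_y C_psi].
  have [f [fA [fe fy fp]]] := qh_lift S'; exists f; split=> //.
  - move=> a x an; have [g fg _] := alg_morphism_rmorphism fA.
    rewrite /heps (qh_epsE _ (Ordinal an)).
    rewrite (eps_sum_word (sys_sum S') (sys_idem S') (sys_epsC S') (Ordinal an)).
    by rewrite fg rmorph_sum -fg; apply: eq_bigr => k _; apply: fe.
  - by move=> a an; rewrite /hy (qh_ynatE _ (Ordinal an)) fy.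
  - move=> a an; have an1 : (a < n.-1)%N by lia.
    by rewrite /hpsi (qh_psinatE _ (Ordinal an1)) fp.
have [CE CY CP] := closed_generators E_sum EE YE PE YY PY PP PY1 Y1P PP2 PPP_eq
  PPP_neq CC C_eps C_y C_psi.
apply: presalg_ind CC _ => -[[k|b]|a]; [exact: CE|exact: CY|exact: CP].
Qed.

End QuiverHeckeUniversal.

(** * Block sequences *)

Section NatScope.
Local Open Scope nat_scope.

Section Ranks.
Variable T : eqType.
Implicit Types f g : nat -> T.

Definition cnt f n j := count (fun b => f b == j) (iota 0 n).
Definition rank f a := cnt f a (f a).

Lemma cntS f n j : cnt f n.+1 j = cnt f n j + (f n == j).
Proof. by rewrite /cnt -addn1 iotaD count_cat /= addn0. Qed.

Lemma cnt_mono f m n j : m <= n -> cnt f m j <= cnt f n j.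
Proof.
elim: n => [|n IHn]; first by rewrite leqn0 => /eqP ->.
by rewrite leq_eqVlt cntS => /orP[/eqP ->|/IHn]; rewrite ?cntS //; lia.
Qed.

Lemma eq_cnt f g n j : (forall b, b < n -> f b = g b) -> cnt f n j = cnt g n j.
Proof.
by move=> fg; apply: eq_in_count => b; rewrite mem_iota => /fg ->.
Qed.

Lemma eq_rank f g a : f =1 g -> rank f a = rank g a.
Proof. by move=> fg; rewrite /rank fg; apply: eq_cnt => b _. Qed.

Lemma rank_lt f n a : a < n -> rank f a < cnt f n (f a).
Proof.
by move=> an; apply: leq_trans (cnt_mono _ _ an); rewrite cntS eqxx addn1.
Qed.

Lemma rankS f a : f a.+1 = f a -> rank f a.+1 = (rank f a).+1.
Proof. by move=> fa; rewrite /rank cntS fa eqxx addn1. Qed.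

Lemma rank_inj f a b : f a = f b -> rank f a = rank f b -> a = b.
Proof.
move=> fab; have [ab|ba|//] := ltngtP a b.
  by move: (rank_lt f ab); rewrite fab [rank f b]/rank => + E; rewrite E ltnn.
by move: (rank_lt f ba); rewrite -fab -[cnt f a _]/(rank f a) => + E; rewrite E ltnn.
Qed.

Lemma rank_surj f n j r : r < cnt f n j ->
  exists a, [/\ a < n, f a = j & rank f a = r].
Proof.
elim: n => [|n IHn]; rewrite ?cntS //; case: eqP => fn rn.
  have [rn'|rn'] := ltnP r (cnt f n j); last first.
    by exists n; split=> //; rewrite /rank fn; lia.
  by have [a [an fa ra]] := IHn rn'; exists a; split=> //; lia.
by rewrite addn0 in rn; have [a [an fa ra]] := IHn rn; exists a; split=> //; lia.
Qed.

Lemma perm_sw n a : a.+1 < n -> perm_eq [seq sw a b | b <- iota 0 n] (iota 0 n).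
Proof.
move=> an; apply: uniq_perm; rewrite ?iota_uniq //.
  by rewrite map_inj_uniq ?iota_uniq //; apply: can_inj (@swK a).
move=> b; rewrite -{1}[b](swK a) mem_map; last by apply: can_inj (@swK a).
by rewrite !mem_iota /= sw_lt.
Qed.

Lemma cnt_sw f n a j : a.+1 < n -> cnt (f \o sw a) n j = cnt f n j.
Proof.
move=> an; rewrite /cnt -(permP (perm_sw an)) count_map.
by apply: eq_count => b /=; rewrite swK.
Qed.

(** Exchanging two different letters keeps the order among equal letters, so every strand keeps its
    number. *)
Lemma rank_sw f a c : f a != f a.+1 -> rank (f \o sw a) (sw a c) = rank f c.
Proof.
move=> fa; rewrite /rank /= swK.
have below m j : m <= a -> cnt (f \o sw a) m j = cnt f m j.
  by move=> ma; apply: eq_cnt => b bm /=; rewrite sw_out //; lia.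
have [->|ca] := eqVneq c a.
  by rewrite swl cntS below //= swl eq_sym (negPf fa) addn0.
have [->|ca1] := eqVneq c a.+1; first by rewrite swr cntS below // (negPf fa) addn0.
rewrite sw_out //; have [cla|acl] := ltnP c a; first by apply: below; lia.
by apply: cnt_sw; lia.
Qed.

Lemma rank_ltn f a b : f a = f b -> a < b -> rank f a < rank f b.
Proof. by move=> fab /(rank_lt f); rewrite fab. Qed.

(** Two equal adjacent letters have consecutive ranks, and no other position with that letter has
    one of these ranks. *)
Lemma rank_sw_eq f a b : f a.+1 = f a -> f b = f a ->
  rank f (sw a b) = sw (rank f a) (rank f b).
Proof.
move=> fa fb; have [->|ba] := eqVneq b a; first by rewrite !swl rankS.
have [->|ba1] := eqVneq b a.+1; first by rewrite rankS // !swr.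
rewrite !sw_out -?rankS //.
  by apply: contra ba => /eqP /(rank_inj fb) ->.
by apply: contra ba1 => /eqP /rank_inj ->; rewrite ?fa.
Qed.

(** Inverse of a |-> (f a, rank f a): the position of the strand number r of the block j. If there
    is none, the value is n. *)
Definition pos f n j r :=
  find (fun a => (f a == j) && (rank f a == r)) (iota 0 n).

Lemma posP f n j r : r < cnt f n j ->
  [/\ pos f n j r < n, f (pos f n j r) = j & rank f (pos f n j r) = r].
Proof.
case/rank_surj=> a [an fa ra]; rewrite /pos; set p := fun _ => _.
have hp : has p (iota 0 n).
  by apply/hasP; exists a; rewrite ?mem_iota // /p fa ra !eqxx.
have pn : find p (iota 0 n) < n by rewrite -[X in _ < X](size_iota 0) -has_find.
by have := nth_find 0 hp; rewrite nth_iota // /p => /andP[/eqP ? /eqP ?].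
Qed.

End Ranks.

Section Sequences.
Variables (d n : nat) (j0 : 'I_d).
Implicit Types t : n.-tuple 'I_d.

Definition at_ t (a : nat) : 'I_d := nth j0 t a.

Definition swt (a : nat) t : n.-tuple 'I_d := [tuple at_ t (sw a i) | i < n].

Lemma at_inj t t' : (forall a, a < n -> at_ t a = at_ t' a) -> t = t'.
Proof.
move=> tt'; apply/val_inj/(@eq_from_nth _ j0); rewrite !size_tuple //.
Qed.

Lemma at_swt a t b : a.+1 < n -> at_ (swt a t) b = at_ t (sw a b).
Proof.
move=> an; have [bn|nb] := ltnP b n.
  by rewrite {1}/at_ -(tnth_nth j0 _ (Ordinal bn)) tnth_mktuple.
by rewrite /at_ !nth_default ?size_tuple // leqNgt sw_lt // -leqNgt.
Qed.

Lemma swtK a t : a.+1 < n -> swt a (swt a t) = t.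
Proof. by move=> an; apply: at_inj => b _; rewrite !at_swt // swK. Qed.

Lemma swt_id a t : a.+1 < n -> at_ t a = at_ t a.+1 -> swt a t = t.
Proof.
move=> an ta; apply: at_inj => b _; rewrite at_swt // /sw.
by do 2?case: eqP => [->|_].
Qed.

Lemma swt_comm a b t : a.+1 < n -> b.+1 < n -> a.+1 < b ->
  swt a (swt b t) = swt b (swt a t).
Proof.
move=> an bn ab; apply: at_inj => c _; rewrite !at_swt //; congr (at_ t _).
by rewrite /sw; do !case: ifP; lia.
Qed.

Lemma swt_braid a t : a.+2 < n ->
  swt a.+1 (swt a (swt a.+1 t)) = swt a (swt a.+1 (swt a t)).
Proof.
move=> an; apply: at_inj => c _; rewrite !at_swt //; try lia.
by congr (at_ t _); rewrite /sw; do !case: ifP; lia.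
Qed.

Lemma count_cnt t j : count_mem j t = cnt (at_ t) n j.
Proof.
rewrite -[in LHS](mkseq_nth j0 t) /mkseq count_map size_tuple.
by apply: eq_count => b.
Qed.

Lemma count_swt a t j : a.+1 < n -> count_mem j (swt a t) = count_mem j t.
Proof.
move=> an; rewrite !count_cnt -[RHS](cnt_sw _ _ an); apply: eq_cnt => b _.
exact: at_swt.
Qed.

Lemma rank_swt a t c : a.+1 < n -> at_ t a != at_ t a.+1 ->
  rank (at_ (swt a t)) (sw a c) = rank (at_ t) c.
Proof.
move=> an ta; rewrite -(rank_sw c ta); apply: eq_rank => b; exact: at_swt.
Qed.

(** A potential for sorting: the factor n - a drops by one from a to a + 1, so undoing a descent at
    a lowers the sum by t_a - t_(a+1). *)
Definition sort_weight t := \sum_(a < n) (n - a) * at_ t a.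

Lemma sort_weight_swt a t : a.+1 < n -> at_ t a.+1 < at_ t a -> sort_weight (swt a t) < sort_weight t.
Proof.
move=> an ta; have an' : a < n by lia.
have sp (F : nat -> nat) : \sum_(i < n) F i = F a + (F a.+1
    + \sum_(i < n | (i != a :> nat) && (i != a.+1 :> nat)) F i).
  rewrite (bigD1 (Ordinal an')) //= (bigD1 (Ordinal an)) /=; last first.
    by apply/eqP => /(congr1 val) /=; lia.
  by congr (_ + (_ + _)); apply: eq_bigl => i; rewrite -!(inj_eq val_inj).
rewrite /sort_weight !(sp (fun i => (n - i) * at_ _ i)) !at_swt // swl swr.
rewrite (eq_bigr (fun i : 'I_n => (n - i) * at_ t i)).
  have -> : n - a = (n - a.+1).+1 by lia.
  rewrite !mulSn; move: (_ * at_ t a.+1) (_ * at_ t a) (\sum_(i < n | _) _) => u v w.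
  by lia.
by move=> i /andP[i1 i2]; rewrite at_swt // sw_out.
Qed.

Definition tsorted t := forall a, a.+1 < n -> at_ t a <= at_ t a.+1.

Lemma tsorted_or_descent t : tsorted t \/
  exists2 a, a.+1 < n & at_ t a.+1 < at_ t a.
Proof.
case: (altP (@allP _ (fun a => (a.+1 < n) ==> (at_ t a <= at_ t a.+1)) (iota 0 n))).
  move=> ts; left=> a an; apply: (implyP (ts a _)) => //.
  by rewrite mem_iota; lia.
case/allPn=> a _; rewrite negb_imply -ltnNge => /andP[an ta].
by right; exists a.
Qed.

Lemma sort_weight_ind (P : n.-tuple 'I_d -> Prop) :
  (forall t, (forall t', sort_weight t' < sort_weight t -> P t') -> P t) -> forall t, P t.
Proof.
move=> PI t; have [m] := ubnP (sort_weight t); elim: m t => // m IHm t tm.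
by apply: PI => t' tt'; apply: IHm; lia.
Qed.

(** Bubble sort as an induction principle: undoing a descent lowers [sort_weight], and a sequence
    without descents is sorted. *)
Lemma descent_ind (P : n.-tuple 'I_d -> Prop) :
    (forall t, tsorted t -> P t) ->
    (forall t a, a.+1 < n -> at_ t a.+1 < at_ t a -> P (swt a t) -> P t) ->
  forall t, P t.
Proof.
move=> Ps Pd; apply: sort_weight_ind => t IH; have [|[a an ta]] := tsorted_or_descent t.
  exact: Ps.
by apply: (Pd t a) => //; apply/IH/sort_weight_swt.
Qed.

Lemma tsorted_le t a b : tsorted t -> a <= b -> b < n -> at_ t a <= at_ t b.
Proof.
move=> ts; elim: b => [|b IHb]; first by rewrite leqn0 => /eqP ->.
rewrite leq_eqVlt => /orP[/eqP -> //|ab] bn.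
by apply: leq_trans (IHb ab _) (ts _ bn); lia.
Qed.

Lemma tsorted_eq t t' : tsorted t -> tsorted t' ->
  (forall j, count_mem j t = count_mem j t') -> t = t'.
Proof.
have sortE u : tsorted u -> sorted (fun i j : 'I_d => i <= j) u.
  by move=> us; apply/(sortedP j0) => a; rewrite size_tuple => /us.
move=> /sortE ts /sortE ts' tt'; apply: val_inj.
apply: (sorted_eq _ _ ts ts'); first by move=> ? ? ?; apply: leq_trans.
  by move=> i j ij; apply/val_inj/anti_leq.
by apply/allP => j _; apply/eqP/tt'.
Qed.

(** In a sorted sequence each block fills an interval, so consecutive strands of a block are
    adjacent. This is why a crossing of H_(l_j)(Q^j) can be realised by a single psi of H_n(Q). *)
Lemma pos_tsorted t j r : tsorted t -> r.+1 < cnt (at_ t) n j ->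
  pos (at_ t) n j r.+1 = (pos (at_ t) n j r).+1.
Proof.
move=> ts rj; have rj' : r < cnt (at_ t) n j by lia.
have [p1 p2 p3] := posP rj'; have [q1 q2 q3] := posP rj.
move: p1 p2 p3 q1 q2 q3; set p := pos _ _ _ r; set q := pos _ _ _ _.
move=> p1 p2 p3 q1 q2 q3.
have pq : p < q.
  rewrite ltnNge; apply/negP => /(cnt_mono (at_ t) j).
  by move: p3 q3; rewrite /rank p2 q2 => -> ->; rewrite ltnn.
have tp : at_ t p.+1 = at_ t p.
  apply/val_inj/anti_leq/andP; split; last by apply: ts; lia.
  by rewrite p2 -q2; apply: tsorted_le.
apply: (@rank_inj _ (at_ t)); first by rewrite tp p2 q2.
by rewrite rankS // p3 q3.
Qed.

End Sequences.

(** Recurrence on the first letter j: removing it leaves a sequence of content c - delta_j, and the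
    factorials lose the factor c_j. The terms c_j n! then add up to (n+1)!. The multiplicative form
    avoids the division in [multinom]. *)
Lemma card_tuple_content d n (c : 'I_d -> nat) : \sum_j c j = n ->
  #|[set t : n.-tuple 'I_d | [forall j, count_mem j t == c j]]|
    * \prod_j (c j)`! = n`!.
Proof.
elim: n c => [|n IHn] c cn.
  have c0 j : c j = 0 by apply/eqP; rewrite -leqn0 -cn (bigD1 j) //= leq_addr.
  rewrite big1 => [|j _]; last by rewrite c0.
  rewrite muln1 (eq_card1 (x := [tuple])) // => t.
  by rewrite [t]tuple0 !inE eqxx; apply/forallP => j; rewrite c0.
pose c' j i := c i - (i == j).
have c'n j : 0 < c j -> \sum_i c' j i = n.
  move=> cj; have := cn; rewrite (bigD1 j) //= => cn'.
  rewrite (bigD1 j) //= /c' eqxx (eq_bigr c).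
    by move: cn' cj; move: (\sum_(i < d | _) _) => u; lia.
  by move=> i ij; rewrite eq_sym in ij; rewrite eq_sym (negPf ij) subn0.
have c'prod j : 0 < c j -> \prod_i (c i)`! = c j * \prod_i (c' j i)`!.
  move=> cj; rewrite (bigD1 j) //= [in RHS](bigD1 j) //= mulnA /c' eqxx subn1.
  rewrite -[in LHS](prednK cj) factS prednK //; congr (_ * _).
  by apply: eq_bigr => i ij; rewrite (negPf ij) subn0.
rewrite -sum1_card (partition_big (@thead _ _) predT) //= big_distrl /=.
transitivity (\sum_j c j * n`!); last by rewrite -big_distrl /= cn.
(* If c j = 0, the truncated subtraction in [c'] does not lower the total, but then no sequence
   begins with j. *)
apply: eq_bigr => j _; have [cj0|cj] := posnP (c j).
  rewrite cj0 mul0n big_pred0 ?mul0n // => t; rewrite inE.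
  apply/negP => /andP[/forallP/(_ j) + /eqP tj].
  by rewrite cj0 {1}(tuple_eta t) /= tj eqxx.
rewrite (c'prod _ cj) -(IHn _ (c'n _ cj)) mulnCA; congr (_ * (_ * _)).
rewrite -sum1_card (reindex_onto
  (fun t : n.-tuple 'I_d => cons_tuple j t : n.+1.-tuple 'I_d)
  (fun t : n.+1.-tuple 'I_d => behead_tuple t : n.-tuple 'I_d)) /=; last first.
  by move=> t /andP[_ /eqP <-]; apply: val_inj; rewrite [in RHS](tuple_eta t).
apply: eq_bigl => t; rewrite !inE theadE eqxx andbT.
have -> : behead_tuple (cons_tuple j t) = t by apply: val_inj.
rewrite eqxx andbT; apply: eq_forallb => i /=; rewrite /c'.
have [->|_] := eqVneq i j; move: (count_mem _ _) => m; rewrite ?eqxx; lia.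
Qed.

Section Compositions.
Variables (d n : nat).
Implicit Types (l : dcomposition d n) (t : n.-tuple 'I_d).

Definition has_content l t := [forall j, count_mem j t == val l j :> nat].

Lemma has_contentP l t :
  reflect (forall j, count_mem j t = val l j) (has_content l t).
Proof. by apply: (iffP forallP) => H j; apply/eqP. Qed.

Lemma card_has_content l : #|[set t | has_content l t]| = multinom l.
Proof.
have := card_tuple_content (eqP (valP l)); rewrite /multinom => <-.
rewrite mulnK ?prodn_gt0 // => j; exact: fact_gt0.
Qed.

(** The bijection between the row numbers of the matrix algebra and the sequences of content l. *)
Definition tau l (i : 'I_(multinom l)) : n.-tuple 'I_d :=
  enum_val (cast_ord (esym (card_has_content l)) i).

Lemma tau_inj l : injective (@tau l).
Proof. by move=> i i' /enum_val_inj/cast_ord_inj. Qed.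

Lemma tau_content l i : has_content l (@tau l i).
Proof. by have := enum_valP (cast_ord (esym (card_has_content l)) i); rewrite inE. Qed.

Lemma tau_surj l t : has_content l t -> exists i, @tau l i = t.
Proof.
move=> lt; have ti : t \in [set t | has_content l t] by rewrite inE.
exists (cast_ord (card_has_content l) (enum_rank_in ti t)).
by rewrite /tau cast_ordK enum_rankK_in.
Qed.

Lemma has_content_uniq l l' t : has_content l t -> has_content l' t -> l = l'.
Proof.
move=> /has_contentP lt /has_contentP lt'; apply/val_inj/ffunP => j.
by apply: val_inj; rewrite /= -lt -lt'.
Qed.

Lemma content_exists t : exists l, has_content l t.
Proof.
have le j : count_mem j t < n.+1 by rewrite ltnS -[X in _ <= X](size_tuple t) count_size.
have lP : \sum_j [ffun j => Ordinal (le j)] j == n.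
  rewrite (eq_bigr (fun j => count_mem j t)) => [|j _]; last by rewrite ffunE.
  apply/eqP; rewrite -[RHS](size_tuple t).
  elim: (val t) => [|x s IHs]; first by rewrite big1.
  rewrite big_split /= IHs (bigD1 x) //= eqxx big1 // => i.
  by rewrite eq_sym => /negPf ->.
exists (Sub [ffun j => Ordinal (le j)] lP); apply/has_contentP => j.
by rewrite SubK ffunE.
Qed.

Lemma sum_tau (V : nmodType) (F : n.-tuple 'I_d -> V) :
  (\sum_t F t = \sum_l \sum_(i < multinom l) F (@tau l i))%R.
Proof.
have [c cP] := fin_all_exists content_exists.
rewrite (partition_big c predT) //=; apply: eq_bigr => l _.
rewrite (eq_bigl (fun t => t \in [set t | has_content l t])); last first.
  move=> t; rewrite inE; apply/eqP/idP => [<- //|lt].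
  exact: has_content_uniq (cP t) lt.
rewrite big_enum_val (reindex (cast_ord (esym (card_has_content l)))) //=.
apply: onW_bij; exists (cast_ord (card_has_content l)).
  exact: cast_ordKV.
exact: cast_ordK.
Qed.

(** Some sequence has content l because their number times a product of factorials is n!, which is
    not 0; undoing descents then sorts it within its content. *)
Lemma tsorted_exists (j0 : 'I_d) l : exists t, has_content l t /\ tsorted j0 t.
Proof.
have [t lt] : exists t, has_content l t.
  have m0 : 0 < multinom l.
    have p0 : 0 < \prod_j (val l j)`! by rewrite prodn_gt0 // => j; apply: fact_gt0.
    rewrite -card_has_content -(ltn_pmul2r p0).
    by rewrite mul0n (card_tuple_content (eqP (valP l))) fact_gt0.
  by exists (tau (Ordinal m0)); apply: tau_content.
move: t lt; apply: (descent_ind (j0 := j0)) => [t ts|t a an _ IH] /has_contentP lt.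
  by exists t; split=> //; apply/has_contentP.
by apply: IH; apply/has_contentP => j; rewrite count_swt.
Qed.

End Compositions.

End NatScope.

(** * The action on block sequences *)

Section MonomialMatrices.
Variables (A : comNzRingType) (B : pzAlgType A) (m : nat) (I : eqType).
Variable tau : 'I_m -> I.
Hypothesis tau_inj : injective tau.
Local Notation M := (matalg m B).
Implicit Types (X Y : M) (t s : I) (u v z : B).

(** The element t z of the free right B-module on the sequences; it is 0 if t is not one of the
    indices. *)
Definition dcol t z : 'cV[B]_m := \col_i (if tau i == t then z else 0).

Definition monomial (f : I -> I) (w : I -> B) : M :=
  \matrix_(i, i') (if tau i == f (tau i') then w (tau i') else 0).

(* The column t of X has the single entry u, in the row s. *)
Definition acts X s t u := forall z, (X : 'M[B]_m) *m dcol t z = dcol s (u * z).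

Lemma dcolD t z z' : dcol t (z + z') = dcol t z + dcol t z'.
Proof. by apply/colP => i; rewrite !mxE; case: ifP => _; rewrite ?addr0. Qed.

Lemma dcol0 t : dcol t 0 = 0.
Proof. by apply/colP => i; rewrite !mxE if_same. Qed.

Lemma mulmx_dcol X i z k : ((X : 'M[B]_m) *m dcol (tau i) z) k 0 = X k i * z.
Proof.
rewrite mxE (bigD1 i) //= mxE eqxx big1 ?addr0 // => j ji.
by rewrite mxE (inj_eq tau_inj) (negPf ji) mulr0.
Qed.

Lemma acts_monomial f w i : acts (monomial f w) (f (tau i)) (tau i) (w (tau i)).
Proof.
move=> z; apply/colP => k; rewrite mulmx_dcol !mxE.
by case: eqP; rewrite ?mul0r.
Qed.

Lemma acts_eq X Y :
  (forall i, exists s u, acts X s (tau i) u /\ acts Y s (tau i) u) -> X = Y.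
Proof.
move=> XY; apply/matrixP => k i; have [s [u [Xu Yu]]] := XY i.
have := congr1 (fun c : 'cV[B]_m => c k 0) (etrans (Xu 1) (esym (Yu 1))).
by rewrite !mulmx_dcol !mulr1.
Qed.

Lemma actsM X Y r s t u v :
  acts Y s t v -> acts X r s u -> acts (X * Y) r t (u * v).
Proof.
move=> Yv Xu z; rewrite -[X * Y]/((X : 'M[B]_m) *m (Y : 'M[B]_m)).
by rewrite -mulmxA Yv Xu mulrA.
Qed.

Lemma actsD X Y s t u v : acts X s t u -> acts Y s t v -> acts (X + Y) s t (u + v).
Proof. by move=> Xu Yv z; rewrite mulmxDl Xu Yv mulrDl dcolD. Qed.

Lemma acts0 s t : acts 0 s t 0.
Proof. by move=> z; rewrite mul0mx mul0r dcol0. Qed.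

(** A coefficient 0 leaves the target row undetermined, hence the arbitrary s; relations whose two
    sides both vanish on a column are settled with it. *)
Lemma acts_mul0 X Y s t : acts Y t t 0 -> acts (X * Y) s t 0.
Proof.
move=> Y0 z; rewrite -[X * Y]/((X : 'M[B]_m) *m (Y : 'M[B]_m)).
by rewrite -mulmxA Y0 mul0r !dcol0 mulmx0.
Qed.

Lemma acts_algmap a t : acts (algmap a) t t (algmap a).
Proof.
move=> z; rewrite [LHS](mul_scalar_mx _ (dcol t z)); apply/colP => i.
by rewrite !mxE; case: eqP => _; rewrite ?mulr0.
Qed.

Lemma acts1 t : acts 1 t t 1.
Proof. by rewrite -(rmorph1 (@algmap A M)) -(rmorph1 (@algmap A B)); apply: acts_algmap. Qed.

Lemma acts_nat p t : acts p%:R t t p%:R.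
Proof.
elim: p => [|p IHp]; first exact: acts0.
by rewrite -!natr1; apply: actsD IHp (acts1 t).
Qed.

Lemma acts_sum (J : Type) (r : seq J) (P : pred J) (F : J -> M) (w : J -> B) s t :
  (forall j, acts (F j) s t (w j)) ->
  acts (\sum_(j <- r | P j) F j) s t (\sum_(j <- r | P j) w j).
Proof.
move=> Fw; elim/big_rec2: _ => [|j u X _ Xu]; first exact: acts0.
exact: actsD.
Qed.

Lemma actsX X t u p : acts X t t u -> acts (X ^+ p) t t (u ^+ p).
Proof.
move=> Xu; elim: p => [|p IHp]; first exact: acts1.
by rewrite !exprS; apply: actsM IHp Xu.
Qed.

Lemma acts_eval2 P X Y t u v : acts X t t u -> acts Y t t v ->
  acts (eval2 P X Y) t t (eval2 P u v).
Proof.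
move=> Xu Yv; apply: acts_sum => i; apply: acts_sum => j.
by apply: actsM (actsX _ Yv) _; apply: actsM (actsX _ Xu) (acts_algmap _ _).
Qed.

Lemma acts_eval3 P X Y Z t u v w : acts X t t u -> acts Y t t v ->
  acts Z t t w -> acts (eval3 P X Y Z) t t (eval3 P u v w).
Proof.
move=> Xu Yv Zw; apply: acts_sum => i.
by apply: actsM (acts_eval2 _ Yv Zw) (actsX _ Xu).
Qed.

End MonomialMatrices.

Section MatrixSystem.
Variables (A : comNzRingType) (K : finType) (Q : K -> K -> {poly {poly A}}).
Variables (d n : nat) (j0 : 'I_d) (KJ : 'I_d -> {set K}).
Hypothesis KJ_disjoint : forall j j' : 'I_d, j != j' -> [disjoint KJ j & KJ j'].
Hypothesis Q_blocks : forall (j j' : 'I_d) (k k' : K),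
  j != j' -> k \in KJ j -> k' \in KJ j' -> Q k k' = 1.

Variables (B : pzAlgType A) (c : 'I_d -> nat).
Variables (EK : 'I_d -> nat -> K -> B) (YK PK : 'I_d -> nat -> B).
Variable C : 'I_d -> B -> Prop.
Hypothesis sysK : forall j, qhsys Q (c j) (EK j) (YK j) (PK j).
Hypothesis EK_supp : forall j r x, (r < c j)%N -> x \notin KJ j -> EK j r x = 0.
Hypothesis CC : forall i j u v, i != j -> C i u -> C j v -> u * v = v * u.
Hypothesis CE : forall j r x, (r < c j)%N -> C j (EK j r x).
Hypothesis CY : forall j r, (r < c j)%N -> C j (YK j r).
Hypothesis CP : forall j r, (r.+1 < c j)%N -> C j (PK j r).

Local Notation "t .@ a" := (at_ j0 t a) (at level 2, format "t .@ a").
Local Notation rk t a := (rank (at_ j0 t) a).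
Local Notation swt := (swt j0).
Implicit Types t : n.-tuple 'I_d.

Definition eps_at t a x := EK t.@a (rk t a) x.
Definition y_at t a := YK t.@a (rk t a).
Definition psi_at t a := if t.@a == t.@(a.+1) then PK t.@a (rk t a) else 1.

Section Column.
Variable t : n.-tuple 'I_d.
Hypothesis ct : forall j, count_mem j t = c j.

Lemma rk_lt a : (a < n)%N -> (rk t a < c t.@a)%N.
Proof. by move=> an; rewrite -ct (count_cnt j0); apply: rank_lt. Qed.

Lemma rkS_lt a : (a.+1 < n)%N -> t.@a = t.@(a.+1) -> ((rk t a).+1 < c t.@a)%N.
Proof. by move=> an ta; rewrite -rankS // ta; apply: rk_lt. Qed.

(** The idempotents of a block vanish on colours outside it. So either the product is 0, or the two
    colours lie in different blocks, where the delta term is 0 and Q is 1. *)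
Lemma eps_at_mixed a b x x' : (a < n)%N -> (b < n)%N -> t.@a != t.@b ->
  eps_at t a x * eps_at t b x' = 0 \/
  [/\ x \in KJ t.@a, x' \in KJ t.@b, x != x', Q x x' = 1 & Q x' x = 1].
Proof.
move=> an bn tab; case: (boolP (x \in KJ t.@a)) => [xa|xa]; last first.
  by left; rewrite /eps_at EK_supp ?mul0r // rk_lt.
case: (boolP (x' \in KJ t.@b)) => [xb|xb]; last first.
  by left; rewrite [eps_at t b x']/eps_at EK_supp ?mulr0 // rk_lt.
have tba : t.@b != t.@a by rewrite eq_sym.
right; split=> //; [|exact: Q_blocks tab _ _|exact: Q_blocks tba _ _].
apply: contraTneq xb => <-; have /pred0P/(_ x) := KJ_disjoint tab.
by rewrite /= xa /= => ->.
Qed.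

Lemma eps_atC a b x x' : (a < n)%N -> (b < n)%N ->
  eps_at t a x * eps_at t b x' = eps_at t b x' * eps_at t a x.
Proof.
move=> an bn; have [tab|tab] := eqVneq t.@a t.@b.
  have := rk_lt an; rewrite /eps_at tab => ra.
  by apply: (sys_epsC (sysK _)) => //; apply: rk_lt.
by apply: CC tab _ _; apply: CE; apply: rk_lt.
Qed.

Lemma y_at_eps a b x : (a < n)%N -> (b < n)%N ->
  y_at t b * eps_at t a x = eps_at t a x * y_at t b.
Proof.
move=> an bn; have [tab|tab] := eqVneq t.@b t.@a.
  have := rk_lt bn; rewrite /eps_at /y_at tab => ra.
  by apply: (sys_yeps (sysK _)) => //; apply: rk_lt.
by apply: CC tab _ _; [apply: CY|apply: CE]; apply: rk_lt.
Qed.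

Lemma y_atC a b : (a < n)%N -> (b < n)%N -> y_at t a * y_at t b = y_at t b * y_at t a.
Proof.
move=> an bn; have [tab|tab] := eqVneq t.@a t.@b.
  have := rk_lt an; rewrite /y_at tab => ra.
  by apply: (sys_yy (sysK _)) => //; apply: rk_lt.
by apply: CC tab _ _; apply: CY; apply: rk_lt.
Qed.

Lemma eps_at_sw a b x : (a.+1 < n)%N -> t.@a != t.@(a.+1) ->
  eps_at (swt a t) (sw a b) x = eps_at t b x.
Proof. by move=> an ta; rewrite /eps_at at_swt // swK rank_swt. Qed.

Lemma y_at_sw a b : (a.+1 < n)%N -> t.@a != t.@(a.+1) ->
  y_at (swt a t) (sw a b) = y_at t b.
Proof. by move=> an ta; rewrite /y_at at_swt // swK rank_swt. Qed.

Lemma psi_at_eps a b x : (a.+1 < n)%N -> (b < n)%N ->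
  psi_at t a * eps_at t b x = eps_at (swt a t) (sw a b) x * psi_at t a.
Proof.
move=> an bn; rewrite /psi_at; case: eqVneq => ta; last first.
  by rewrite eps_at_sw // mulr1 mul1r.
rewrite swt_id //; have ra := rkS_lt an ta; have rb := rk_lt bn.
rewrite /eps_at; have [tab|tab] := eqVneq t.@a t.@b; last first.
  rewrite sw_out; first exact: CC tab (CP ra) (CE x rb).
    by apply: contraNneq tab => ->.
  by apply: contraNneq tab => ->; rewrite ta.
have -> : t.@(sw a b) = t.@a.
  by rewrite /sw; case: eqP => [_ //|_]; case: eqP.
rewrite (rank_sw_eq (f := at_ j0 t)) // -tab in rb *.
exact: sys_psieps (sysK _) _ _ _ ra rb.
Qed.

Lemma psi_at_y a b : (a.+1 < n)%N -> (b < n)%N -> b != a -> b != a.+1 ->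
  psi_at t a * y_at t b = y_at (swt a t) b * psi_at t a.
Proof.
move=> an bn ba ba1; rewrite /psi_at; case: eqVneq => ta; last first.
  by rewrite -{2}(sw_out ba ba1) y_at_sw // mulr1 mul1r.
rewrite swt_id //; have ra := rkS_lt an ta; have rb := rk_lt bn.
rewrite /y_at; have [tab|tab] := eqVneq t.@a t.@b; last exact: CC tab (CP ra) (CY rb).
rewrite -tab in rb *; apply: (sys_psiy (sysK _)) => //.
  by apply: contraNneq ba => rba; apply/eqP/(rank_inj _ rba).
by apply: contraNneq ba1; rewrite -rankS // => rba; apply/eqP/(rank_inj _ rba); rewrite -tab.
Qed.

(** A swap of different letters away from a and a + 1 changes neither these letters nor their ranks,
    and a swap of equal letters changes nothing. *)
Lemma psi_at_far a b : (a.+1 < n)%N -> (b.+1 < n)%N ->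
  (a.+1 < b)%N || (b.+1 < a)%N -> psi_at (swt b t) a = psi_at t a.
Proof.
move=> an bn ab; have [tb|tb] := eqVneq t.@b t.@(b.+1); first by rewrite swt_id.
have sa : sw b a = a by rewrite sw_out; lia.
have sa1 : sw b a.+1 = a.+1 by rewrite sw_out; lia.
have ra : rk (swt b t) a = rk t a by rewrite -[in LHS]sa rank_swt.
by rewrite /psi_at !at_swt // sa sa1 ra.
Qed.

Lemma psi_atC a b : (a.+1 < n)%N -> (b.+1 < n)%N -> (a.+1 < b)%N ->
  psi_at t a * psi_at t b = psi_at t b * psi_at t a.
Proof.
move=> an bn ab; rewrite /psi_at; case: eqVneq => ta; last by rewrite mul1r mulr1.
case: eqVneq => tb; last by rewrite mul1r mulr1.
have ra := rkS_lt an ta; have rb := rkS_lt bn tb.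
have [tab|tab] := eqVneq t.@a t.@b; last exact: CC tab (CP ra) (CP rb).
rewrite -tab in rb *; apply: (sys_psipsi (sysK _)) => //.
by rewrite -rankS //; apply: rank_ltn; rewrite // -ta.
Qed.

(** A correction needs equal outer colours, hence equal outer blocks; the middle block then differs,
    both values of Q are 1, and [ddiff1] applies. *)
Lemma braid_corr_at a x x' x'' : (a.+2 < n)%N ->
    ~~ ((t.@a == t.@(a.+1)) && (t.@(a.+1) == t.@(a.+2))) ->
  eps_at t a x * (eps_at t a.+1 x' * eps_at t a.+2 x'') = 0 \/
  braid_corr Q x x' x'' = 0.
Proof.
move=> an neq; have [an1 an2] : (a.+1 < n)%N /\ (a < n)%N by lia.
have [t02|t02] := eqVneq t.@a t.@(a.+2); last first.
  have [e0|[_ _ /negPf xx _ _]] := eps_at_mixed x x'' an2 an t02.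
    by left; rewrite (eps_atC x') // mulrA e0 mul0r.
  by right; rewrite /braid_corr xx.
have t01 : t.@a != t.@(a.+1).
  by move: neq; rewrite -t02 eq_sym andbb.
have [e0|[_ _ _ Q1 _]] := eps_at_mixed x x' an2 an1 t01.
  by left; rewrite mulrA e0 mul0r.
right; rewrite /braid_corr; case: eqP => // <-.
by rewrite Q1 ddiff1.
Qed.

Lemma eps_atS a x : t.@a = t.@(a.+1) -> eps_at t a.+1 x = EK t.@a (rk t a).+1 x.
Proof. by move=> ta; rewrite /eps_at -ta -rankS. Qed.

Lemma y_atS a : t.@a = t.@(a.+1) -> y_at t a.+1 = YK t.@a (rk t a).+1.
Proof. by move=> ta; rewrite /y_at -ta -rankS. Qed.

Lemma psi_at_same a : t.@a = t.@(a.+1) -> psi_at t a = PK t.@a (rk t a).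
Proof. by move=> ta; rewrite /psi_at ta eqxx. Qed.

Lemma psi_at_diff a : t.@a != t.@(a.+1) -> psi_at t a = 1.
Proof. by rewrite /psi_at => /negPf ->. Qed.

End Column.

(** Among three letters that are not all equal at most one pair agrees. So each side has at most one
    factor other than 1, the crossing of that pair, and it remains to see that its strand number is
    the same on both sides. *)
Lemma psi_at_braid t a : (a.+2 < n)%N ->
    ~~ ((t.@a == t.@(a.+1)) && (t.@(a.+1) == t.@(a.+2))) ->
  psi_at (swt a (swt a.+1 t)) a.+1 * psi_at (swt a.+1 t) a * psi_at t a.+1 =
  psi_at (swt a.+1 (swt a t)) a * psi_at (swt a t) a.+1 * psi_at t a.
Proof.
move=> an neq; have an1 : (a.+1 < n)%N by lia.
have s1 : sw a.+1 a = a by rewrite sw_out; lia.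
have s2 : sw a a.+2 = a.+2 by rewrite sw_out; lia.
(* In [r1] and [r2] the agreeing pair is adjacent and crosses before or after the third strand has
   passed it; in [r3] it is the outer pair, and the middle strand has left on one side or the
   other. *)
have r1 : t.@(a.+1) != t.@(a.+2) -> t.@a != t.@(a.+2) ->
    rk (swt a (swt a.+1 t)) a.+1 = rk t a.
  move=> t12 t02; have t' : (swt a.+1 t).@a != (swt a.+1 t).@(a.+1).
    by rewrite !at_swt // s1 swl.
  by have := rank_swt a an1 t'; rewrite swl => ->; have := rank_swt a an t12; rewrite s1.
have r2 : t.@a != t.@(a.+1) -> t.@a != t.@(a.+2) ->
    rk (swt a.+1 (swt a t)) a = rk t a.+1.
  move=> t01 t02; have t' : (swt a t).@(a.+1) != (swt a t).@(a.+2).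
    by rewrite !at_swt // s2 swr.
  by have := rank_swt a an t'; rewrite s1 => ->; have := rank_swt a.+1 an1 t01; rewrite swr.
have r3 : t.@a != t.@(a.+1) -> t.@(a.+1) != t.@(a.+2) ->
    rk (swt a.+1 t) a = rk (swt a t) a.+1.
  move=> t01 t12; have := rank_swt a an t12; rewrite s1 => ->.
  by have := rank_swt a an1 t01; rewrite swl.
have [t01|t01] := eqVneq t.@a t.@(a.+1).
  have t12 : t.@(a.+1) != t.@(a.+2) by move: neq; rewrite t01 eqxx.
  rewrite (swt_id an1 t01) (psi_at_diff t12) (psi_at_diff (t := swt a.+1 t)).
    rewrite !mulr1 !mul1r /psi_at !at_swt // !(s1, s2, swl, swr) t01 eqxx.
    by rewrite r1 ?t01.
  by rewrite !at_swt // s1 swl t01.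
have [t12|t12] := eqVneq t.@(a.+1) t.@(a.+2).
  rewrite (swt_id an t12) (psi_at_diff t01) (psi_at_diff (t := swt a t) (a := a.+1)).
    rewrite !mulr1 /psi_at !at_swt // !(s1, s2, swl, swr) t12 eqxx mul1r.
    by rewrite r2 -?t12.
  by rewrite !at_swt // s2 swr -t12.
rewrite (psi_at_diff t01) (psi_at_diff t12) !mulr1.
rewrite [X in X * _ = _]psi_at_diff ?[X in _ = X * _]psi_at_diff ?mul1r.
- by rewrite /psi_at !at_swt // !(s1, s2, swl, swr) r3.
- by rewrite !at_swt // !(s1, s2, swl, swr).
- by rewrite !at_swt // !(s1, s2, swl, swr).
Qed.

Section Composition.
Variable l : dcomposition d n.
Hypothesis cl : forall j, c j = val l j.
Local Notation M := (matalg (multinom l) B).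
Local Notation tau := (@tau d n l).
Local Notation acts := (acts tau).

Definition mat_eps a x : M := monomial tau id (fun t => eps_at t a x).
Definition mat_y a : M := monomial tau id (fun t => y_at t a).
Definition mat_psi a : M := monomial tau (swt a) (fun t => psi_at t a).

Definition is_col t := has_content l t.

Lemma is_col_count t : is_col t -> forall j, count_mem j t = c j.
Proof. by move=> /has_contentP ct j; rewrite ct cl. Qed.

Lemma is_col_swt a t : (a.+1 < n)%N -> is_col t -> is_col (swt a t).
Proof. by move=> an /has_contentP ct; apply/has_contentP => j; rewrite count_swt. Qed.

Lemma acts_eps t a x : is_col t -> acts (mat_eps a x) t t (eps_at t a x).
Proof. by move=> /tau_surj[i <-]; apply: (acts_monomial (@tau_inj _ _ l)). Qed.

Lemma acts_y t a : is_col t -> acts (mat_y a) t t (y_at t a).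
Proof. by move=> /tau_surj[i <-]; apply: (acts_monomial (@tau_inj _ _ l)). Qed.

Lemma acts_psi t a : is_col t -> acts (mat_psi a) (swt a t) t (psi_at t a).
Proof. by move=> /tau_surj[i <-]; apply: (acts_monomial (@tau_inj _ _ l)). Qed.

Lemma mat_eq (X Y : M) : (forall t, is_col t -> exists s u, acts X s t u /\ acts Y s t u) ->
  X = Y.
Proof. by move=> XY; apply: (acts_eq (@tau_inj _ _ l)) => i; apply/XY/tau_content. Qed.

(** Each relation is compared on one column t. If the letters that it moves agree, it is the same
    relation of that block at the strand number of a. Otherwise the mixed crossings have coefficient
    1, and [eps_at_mixed] or [braid_corr_at] removes the error term or makes both sides vanish. *)
Lemma matrix_system : qhsys Q n mat_eps mat_y mat_psi.
Proof.
have acts_ee t a b x x' : is_col t ->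
    acts (mat_eps a x * mat_eps b x') t t (eps_at t a x * eps_at t b x').
  by move=> tc; apply: actsM (acts_eps _ _ tc) (acts_eps _ _ tc).
split.
- move=> a an; apply: mat_eq => t tc; exists t, 1; split; last exact: acts1.
  rewrite -(sys_sum (sysK t.@a) (rk_lt (is_col_count tc) an)).
  by apply: acts_sum => x; apply: acts_eps.
- move=> a x x' an; apply: mat_eq => t tc; exists t, (eps_at t a x * eps_at t a x').
  split; first exact: acts_ee.
  rewrite (sys_idem (sysK t.@a)) ?(rk_lt (is_col_count tc)) //.
  by apply: actsM (acts_eps _ _ tc) (acts_nat _ _ _).
- move=> a b x x' an bn; apply: mat_eq => t tc.
  exists t, (eps_at t a x * eps_at t b x'); split; first exact: acts_ee.
  by rewrite (eps_atC (is_col_count tc)) //; apply: acts_ee.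
- move=> a b x an bn; apply: mat_eq => t tc.
  exists t, (y_at t b * eps_at t a x).
  split; first exact: actsM (acts_eps _ _ tc) (acts_y _ tc).
  rewrite (y_at_eps (is_col_count tc)) //; exact: actsM (acts_y _ tc) (acts_eps _ _ tc).
- move=> a b x an bn; apply: mat_eq => t tc; have sc := is_col_swt an tc.
  exists (swt a t), (psi_at t a * eps_at t b x).
  split; first exact: actsM (acts_eps _ _ tc) (acts_psi _ tc).
  rewrite (psi_at_eps (is_col_count tc)) //.
  exact: actsM (acts_psi _ tc) (acts_eps _ _ sc).
- move=> a b an bn; apply: mat_eq => t tc; exists t, (y_at t a * y_at t b).
  split; first exact: actsM (acts_y _ tc) (acts_y _ tc).
  rewrite (y_atC (is_col_count tc)) //; exact: actsM (acts_y _ tc) (acts_y _ tc).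
- move=> a b an bn ba ba1; apply: mat_eq => t tc; have sc := is_col_swt an tc.
  exists (swt a t), (psi_at t a * y_at t b).
  split; first exact: actsM (acts_y _ tc) (acts_psi _ tc).
  rewrite (psi_at_y (is_col_count tc)) //.
  exact: actsM (acts_psi _ tc) (acts_y _ sc).
- move=> a b an bn ab; apply: mat_eq => t tc.
  have sa := is_col_swt an tc; have sb := is_col_swt bn tc.
  exists (swt a (swt b t)), (psi_at t a * psi_at t b); split.
    rewrite -(psi_at_far t an bn) ?ab //; exact: actsM (acts_psi _ tc) (acts_psi _ sb).
  rewrite (psi_atC (is_col_count tc)) // swt_comm // -(psi_at_far t bn an) ?ab ?orbT //.
  exact: actsM (acts_psi _ tc) (acts_psi _ sa).
- move=> a x x' an; apply: mat_eq => t tc; have sc := is_col_swt an tc.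
  have an1 : (a < n)%N by lia.
  have [ta|ta] := eqVneq t.@a t.@(a.+1).
    exists t, (psi_at t a * y_at t a.+1 * (eps_at t a x * eps_at t a.+1 x')).
    have ap : acts (mat_psi a) t t (psi_at t a).
      by have := acts_psi a tc; rewrite swt_id.
    split; first exact: actsM (acts_ee _ _ _ _ _ tc) (actsM (acts_y _ tc) ap).
    rewrite y_atS // eps_atS // psi_at_same // (sys_psiy1 (sysK _)).
      rewrite -eps_atS // -psi_at_same //.
      apply: actsM (acts_ee _ _ _ _ _ tc) (actsD _ (acts_nat _ _ _)).
      exact: actsM ap (acts_y _ tc).
    exact: (rkS_lt (is_col_count tc)).
  have [e0|[_ _ /negPf xx _ _]] := eps_at_mixed (is_col_count tc) x x' an1 an ta.
    exists t, 0; have a0 := acts_ee t a a.+1 x x' tc; rewrite e0 in a0.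
    by split; apply: acts_mul0.
  exists (swt a t), (psi_at t a * y_at t a.+1 * (eps_at t a x * eps_at t a.+1 x')).
  split; first exact: actsM (acts_ee _ _ _ _ _ tc) (actsM (acts_y _ tc) (acts_psi _ tc)).
  (* Here psi has coefficient 1: y at a + 1 in t is y at a in the swapped sequence, and the factor 1
     is written back as the coefficient of psi on the other side. *)
  rewrite xx addr0 psi_at_diff // mul1r -(y_at_sw _ an ta) swr -[y_at _ a]mulr1 -(psi_at_diff ta).
  exact: actsM (acts_ee _ _ _ _ _ tc) (actsM (acts_psi _ tc) (acts_y _ sc)).
- move=> a x x' an; apply: mat_eq => t tc; have sc := is_col_swt an tc.
  have an1 : (a < n)%N by lia.
  have [ta|ta] := eqVneq t.@a t.@(a.+1).
    exists t, (y_at t a.+1 * psi_at t a * (eps_at t a x * eps_at t a.+1 x')).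
    have ap : acts (mat_psi a) t t (psi_at t a).
      by have := acts_psi a tc; rewrite swt_id.
    split; first exact: actsM (acts_ee _ _ _ _ _ tc) (actsM ap (acts_y _ tc)).
    rewrite y_atS // eps_atS // psi_at_same // (sys_y1psi (sysK _)).
      rewrite -eps_atS // -psi_at_same //.
      apply: actsM (acts_ee _ _ _ _ _ tc) (actsD _ (acts_nat _ _ _)).
      exact: actsM (acts_y _ tc) ap.
    exact: (rkS_lt (is_col_count tc)).
  have [e0|[_ _ /negPf xx _ _]] := eps_at_mixed (is_col_count tc) x x' an1 an ta.
    exists t, 0; have a0 := acts_ee t a a.+1 x x' tc; rewrite e0 in a0.
    by split; apply: acts_mul0.
  exists (swt a t), (psi_at t a * y_at t a * (eps_at t a x * eps_at t a.+1 x')).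
  split; last first.
    rewrite xx addr0.
    exact: actsM (acts_ee _ _ _ _ _ tc) (actsM (acts_y _ tc) (acts_psi _ tc)).
  rewrite psi_at_diff // mul1r -(y_at_sw _ an ta) swl -[y_at _ a.+1]mulr1 -(psi_at_diff ta).
  exact: actsM (acts_ee _ _ _ _ _ tc) (actsM (acts_psi _ tc) (acts_y _ sc)).
- move=> a x x' an; apply: mat_eq => t tc; have sc := is_col_swt an tc.
  have an1 : (a < n)%N by lia.
  exists t, (eval2 (Q x x') (y_at t a) (y_at t a.+1) * (eps_at t a x * eps_at t a.+1 x')).
  split; last first.
    apply: actsM (acts_ee _ _ _ _ _ tc) (acts_eval2 _ _ _).
      exact: acts_y.
    exact: acts_y.
  have app : acts (mat_psi a * mat_psi a) t t (psi_at (swt a t) a * psi_at t a).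
    by rewrite -[X in acts _ X](swtK j0 t an); apply: actsM (acts_psi _ tc) (acts_psi _ sc).
  have [ta|ta] := eqVneq t.@a t.@(a.+1).
    rewrite y_atS // eps_atS // -(sys_psi2 (sysK _)).
      rewrite -psi_at_same // -eps_atS //.
      by rewrite swt_id // in app; apply: actsM (acts_ee _ _ _ _ _ tc) app.
    exact: (rkS_lt (is_col_count tc)).
  have [e0|[_ _ _ Q1 _]] := eps_at_mixed (is_col_count tc) x x' an1 an ta.
    have a0 := acts_ee t a a.+1 x x' tc; rewrite e0 in a0.
    by rewrite e0 mulr0; apply: acts_mul0.
  rewrite Q1 eval2_1; apply: actsM (acts_ee _ _ _ _ _ tc) _.
  rewrite !psi_at_diff ?mulr1 // in app.
  by rewrite !at_swt // swl swr eq_sym.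
- move=> a x x' x'' an; apply: mat_eq => t tc.
  have [an1 an2] : (a.+1 < n)%N /\ (a < n)%N by lia.
  have sa := is_col_swt an1 tc; have sb := is_col_swt an tc.
  have sab := is_col_swt an1 sb; have sba := is_col_swt an sa.
  pose eee : B := eps_at t a x * (eps_at t a.+1 x' * eps_at t a.+2 x'').
  have acts_eee : acts (mat_eps a x * (mat_eps a.+1 x' * mat_eps a.+2 x'')) t t eee.
    exact: actsM (acts_ee _ _ _ _ _ tc) (acts_eps _ _ tc).
  pose cor := eval3 (braid_corr Q x x' x'') (y_at t a) (y_at t a.+2) (y_at t a.+1).
  have acts_cor : acts (eval3 (braid_corr Q x x' x'') (mat_y a) (mat_y a.+2) (mat_y a.+1)) t t cor.
    by apply: acts_eval3; apply: acts_y.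
  have aL := actsM (actsM (acts_psi a.+1 tc) (acts_psi a sb)) (acts_psi a.+1 sab).
  have aR := actsM (actsM (acts_psi a tc) (acts_psi a.+1 sa)) (acts_psi a sba).
  case: (boolP ((t.@a == t.@(a.+1)) && (t.@(a.+1) == t.@(a.+2)))) => [/andP[/eqP t01 /eqP t12]|neq].
    (* Three letters in one block: every swap fixes t, and the braid relation of the block holds
       with its correction. *)
    have swa : swt a t = t by rewrite swt_id.
    have swb : swt a.+1 t = t by rewrite swt_id.
    rewrite !(swa, swb) !mulrA in aL aR.
    exists t, (psi_at t a.+1 * psi_at t a * psi_at t a.+1 * eee).
    split; first exact: actsM acts_eee aL.
    have r1 : rk t a.+1 = (rk t a).+1 by rewrite rankS.
    have e1 := eps_atS x' t01; have e2 := eps_atS x'' t12; rewrite r1 -t01 in e2.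
    have y1 := y_atS t01; have y2 := y_atS t12; rewrite r1 -t01 in y2.
    have p0 := psi_at_same t01; have p1 := psi_at_same t12; rewrite r1 -t01 in p1.
    have r2 : ((rk t a).+2 < c t.@a)%N.
      by rewrite -r1 t01; apply: (rkS_lt (is_col_count tc)).
    have := sys_braid (sysK t.@a) x x' x'' r2.
    rewrite -p0 -p1 -y2 -y1 -e2 -e1 -/(eps_at t a x) -/(y_at t a) -/eee -/cor => ->.
    exact: actsM acts_eee (actsD aR acts_cor).
  rewrite !mulrA in aL aR.
  exists (swt a.+1 (swt a (swt a.+1 t))), (psi_at (swt a (swt a.+1 t)) a.+1 *
    psi_at (swt a.+1 t) a * psi_at t a.+1 * eee).
  split; first exact: actsM acts_eee aL.
  have [e0|cor0] := braid_corr_at (is_col_count tc) x x' x'' an neq.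
    rewrite /eee e0 mulr0; apply: acts_mul0.
    by rewrite -[0]e0.
  rewrite cor0 eval3_0 addr0; apply: actsM acts_eee _.
  by rewrite psi_at_braid // swt_braid.
Qed.


End Composition.
End MatrixSystem.

(** * Sorting paths *)

Section BlockIdempotents.
Variables (A : comNzRingType) (K : finType) (Q : K -> K -> {poly {poly A}}).
Variables (d n : nat) (j0 : 'I_d) (KJ : 'I_d -> {set K}).
Hypothesis KJ_cover : \bigcup_j KJ j = setT.
Hypothesis KJ_disjoint : forall j j' : 'I_d, j != j' -> [disjoint KJ j & KJ j'].
Hypothesis Q_blocks : forall (j j' : 'I_d) (k k' : K),
  j != j' -> k \in KJ j -> k' \in KJ j' -> Q k k' = 1.

Variables (H : pzAlgType A) (eps : nat -> K -> H) (y psi : nat -> H).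
Hypothesis sysH : qhsys Q n eps y psi.

Local Notation "t .@ a" := (at_ j0 t a) (at level 2, format "t .@ a").
Local Notation rk t a := (rank (at_ j0 t) a).
Local Notation swt := (swt j0).
Local Notation tsorted := (tsorted j0).
Implicit Types t : n.-tuple 'I_d.

Definition block_eps (a : nat) (j : 'I_d) : H := \sum_(x in KJ j) eps a x.

Definition seq_idem t : H := word block_eps (fun a : 'I_n => t.@a).

Lemma KJ_eq x i j : x \in KJ i -> x \in KJ j -> i = j.
Proof.
move=> xi xj; apply: contraTeq xj => ij; have /pred0P/(_ x) := KJ_disjoint ij.
by rewrite /= xi /= => ->.
Qed.

Lemma block_eps_sum a : (a < n)%N -> \sum_j block_eps a j = 1.
Proof.
move=> an; have [blk blkP] : exists blk, forall x, x \in KJ (blk x).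
  apply: (fin_all_exists (P := fun x j => x \in KJ j)) => x.
  have : x \in \bigcup_j KJ j by rewrite KJ_cover inE.
  by case/bigcupP=> j _ xj; exists j.
rewrite -(sys_sum sysH an) (partition_big blk predT) //=.
apply: eq_bigr => j _; apply: eq_bigl => x.
by apply/idP/eqP => [xj|<- //]; apply: KJ_eq (blkP x) xj.
Qed.

Lemma eps_block_eps a x j : (a < n)%N -> eps a x * block_eps a j = (x \in KJ j)%:R * eps a x.
Proof.
move=> an; rewrite mulr_sumr (eq_bigr _ (fun x' _ => sys_idem sysH x x' an)).
case: (boolP (x \in KJ j)) => xj.
  rewrite (bigD1 x) //= eqxx big1 ?addr0 // => x' /andP[_ /negPf].
  by rewrite eq_sym => ->; rewrite mul0r.
rewrite big1 ?mul0r // => x' x'j; rewrite (_ : x == x' = false) ?mul0r //.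
by apply: contraNF xj => /eqP ->.
Qed.

Lemma block_eps_idem a j j' : (a < n)%N -> block_eps a j * block_eps a j' = (j == j')%:R * block_eps a j.
Proof.
move=> an; rewrite {1}/block_eps mulr_suml mulr_sumr; apply: eq_bigr => x xj.
rewrite eps_block_eps //; congr ((nat_of_bool _)%:R * _).
by apply/idP/eqP => [/(KJ_eq xj)|<- //].
Qed.

Lemma comm_block_eps u a j : (forall x, u * eps a x = eps a x * u) -> u * block_eps a j = block_eps a j * u.
Proof. by move=> uC; rewrite mulr_sumr mulr_suml; apply: eq_bigr => x _. Qed.

Lemma block_epsC a b j j' : (a < n)%N -> (b < n)%N -> block_eps a j * block_eps b j' = block_eps b j' * block_eps a j.
Proof.
move=> an bn; apply: comm_block_eps => x; apply/esym/comm_block_eps => x'.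
exact: sys_epsC sysH _ _ _ _ _ _.
Qed.


Lemma e_absorb t a : (a < n)%N -> block_eps a t.@a * seq_idem t = seq_idem t.
Proof. by move=> an; have := eps_word1 block_eps_idem block_epsC (Ordinal an) (fun a => t.@a). Qed.

Lemma e_idem t : seq_idem t * seq_idem t = seq_idem t.
Proof. exact: word_idem block_eps_idem block_epsC _. Qed.

Lemma e_orth t t' : t != t' -> seq_idem t * seq_idem t' = 0.
Proof.
move=> tt'; have [a ta] : exists a : 'I_n, t.@a != t'.@a.
  apply/existsP; rewrite -negb_forall; apply: contra tt' => /forallP tt'.
  by apply/eqP/(@at_inj _ _ j0) => a an; apply/eqP/(tt' (Ordinal an)).
exact: (word_orth block_eps_idem block_epsC (a := a)).
Qed.

Lemma e_sum : \sum_t seq_idem t = 1.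
Proof.
rewrite -(word_sum block_eps_sum) (reindex (fun t => [ffun a => tnth t a])) /=.
  apply: eq_bigr => t _; apply: eq_word => a.
  by rewrite ffunE (tnth_nth j0).
exists (fun k : {ffun 'I_n -> 'I_d} => [tuple k a | a < n]) => [t _|k _].
  by apply: eq_from_tnth => a; rewrite tnth_mktuple ffunE.
by apply/ffunP => a; rewrite ffunE tnth_mktuple.
Qed.

Lemma psi_e t a : (a.+1 < n)%N -> psi a * seq_idem t = seq_idem (swt a t) * psi a.
Proof.
move=> an; apply: (word_swap block_eps_idem block_epsC an) => [b j bn|b c cb].
  rewrite /block_eps mulr_sumr mulr_suml; apply: eq_bigr => x _.
  exact: sys_psieps sysH _ _ _ _ _.
by rewrite at_swt // cb swK.
Qed.

Lemma y_e t a : (a < n)%N -> y a * seq_idem t = seq_idem t * y a.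
Proof.
move=> an; apply: commr_prod => b _; apply: comm_block_eps => x.
exact: sys_yeps sysH _ _ _ _ _.
Qed.

Lemma eps_e t a x : (a < n)%N -> eps a x * seq_idem t = seq_idem t * eps a x.
Proof.
move=> an; apply: commr_prod => b _; apply: comm_block_eps => x'.
exact: sys_epsC sysH _ _ _ _ _ _.
Qed.

Let block_eps_eq_r a j u v : (forall x, x \in KJ j -> u * eps a x = v * eps a x) ->
  u * block_eps a j = v * block_eps a j.
Proof. by move=> uv; rewrite !mulr_sumr; apply: eq_bigr. Qed.

Let block_eps_eq_l a j u v w : (forall x, x \in KJ j -> u * (eps a x * w) = v * (eps a x * w)) ->
  u * (block_eps a j * w) = v * (block_eps a j * w).
Proof.
by move=> uv; rewrite mulr_suml !mulr_sumr; apply: eq_bigr.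
Qed.

(** The idempotent e(t) absorbs the block idempotents at a and a + 1, which are sums over colours.
    So the relations, stated for colours, can be applied to colours known to lie in the blocks of
    t. *)
Lemma local_eq2 t a u v : (a.+1 < n)%N ->
    (forall x x', x \in KJ t.@a -> x' \in KJ t.@(a.+1) ->
       u * (eps a x * eps a.+1 x') = v * (eps a x * eps a.+1 x')) ->
  u * seq_idem t = v * seq_idem t.
Proof.
move=> an uv; have an1 : (a < n)%N by lia.
have -> : seq_idem t = block_eps a t.@a * block_eps a.+1 t.@(a.+1) * seq_idem t.
  by rewrite -mulrA !e_absorb.
rewrite (mulrA u) (mulrA v); congr (_ * _).
apply: block_eps_eq_l => x xa; rewrite !mulrA; apply: block_eps_eq_r => x' xa'.
by rewrite -!mulrA; apply: uv.
Qed.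

Lemma local_eq3 t a u v : (a.+2 < n)%N ->
    (forall x x' x'', x \in KJ t.@a -> x' \in KJ t.@(a.+1) -> x'' \in KJ t.@(a.+2) ->
       u * (eps a x * (eps a.+1 x' * eps a.+2 x'')) =
       v * (eps a x * (eps a.+1 x' * eps a.+2 x''))) ->
  u * seq_idem t = v * seq_idem t.
Proof.
move=> an uv; have [an1 an2] : (a < n)%N /\ (a.+1 < n)%N by lia.
have -> : seq_idem t = block_eps a t.@a * (block_eps a.+1 t.@(a.+1) * block_eps a.+2 t.@(a.+2)) * seq_idem t.
  by rewrite -!mulrA !e_absorb.
rewrite (mulrA u) (mulrA v); congr (_ * _).
apply: block_eps_eq_l => x xa; rewrite !(mulrA _ (eps a x)); apply: block_eps_eq_l => x' xa'.
rewrite !(mulrA _ (eps a.+1 x')); apply: block_eps_eq_r => x'' xa''.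
by rewrite -!mulrA; apply: uv.
Qed.

Lemma psi2_e t a : (a.+1 < n)%N -> t.@a != t.@(a.+1) -> psi a * psi a * seq_idem t = seq_idem t.
Proof.
move=> an ta; rewrite -[RHS]mul1r; apply: (local_eq2 an) => x x' xa xa'.
by rewrite (sys_psi2 sysH) // (Q_blocks ta) // eval2_1.
Qed.

Lemma psi_y_e t a b : (a.+1 < n)%N -> (b < n)%N -> t.@a != t.@(a.+1) ->
  psi a * y b * seq_idem t = y (sw a b) * psi a * seq_idem t.
Proof.
move=> an bn ta; have xx x x' : x \in KJ t.@a -> x' \in KJ t.@(a.+1) -> (x == x') = false.
  by move=> xa xa'; apply: contraNF ta => /eqP xx; rewrite (KJ_eq xa (j := t.@(a.+1))) // xx.
have [->|ba] := eqVneq b a.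
  rewrite swl; apply: (local_eq2 an) => x x' xa xa'.
  by rewrite (sys_y1psi sysH) // (xx _ _ xa) // addr0.
have [->|ba1] := eqVneq b a.+1.
  rewrite swr; apply: (local_eq2 an) => x x' xa xa'.
  by rewrite (sys_psiy1 sysH) // (xx _ _ xa) // addr0.
by rewrite sw_out // (sys_psiy sysH).
Qed.

Lemma braid_e t a : (a.+2 < n)%N ->
    ~~ ((t.@a == t.@(a.+1)) && (t.@(a.+1) == t.@(a.+2))) ->
  psi a.+1 * psi a * psi a.+1 * seq_idem t = psi a * psi a.+1 * psi a * seq_idem t.
Proof.
move=> an ta; apply: (local_eq3 an) => x x' x'' xa xa' xa''.
rewrite (sys_braid sysH) // /braid_corr; case: eqP => [xx|_]; last first.
  by rewrite eval3_0 addr0.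
have t02 : t.@a = t.@(a.+2) by apply: KJ_eq xa _; rewrite xx.
have t01 : t.@a != t.@(a.+1) by move: ta; rewrite -t02 eq_sym andbb.
by rewrite -xx !(Q_blocks t01) // ddiff1 eval3_0 addr0.
Qed.

(* sorting t h: h is the product of the psi_a along some path of descents from t
   to the sorted sequence; sorting_uniq shows that h depends on t only. *)
Inductive sorting : n.-tuple 'I_d -> H -> Prop :=
| sorting_nil t : tsorted t -> sorting t (seq_idem t)
| sorting_cons t a h : (a.+1 < n)%N -> (t.@(a.+1) < t.@a)%N ->
    sorting (swt a t) h -> sorting t (psi a * h).

Lemma sorting_e t h : sorting t h -> seq_idem t * h = h.
Proof.
elim=> {t h} [t _|t a h an _ _ IH]; first exact: e_idem.
by rewrite mulrA -[in LHS](swtK j0 t an) -psi_e // -mulrA IH.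
Qed.

Lemma sorting_inv t h : sorting t h -> (tsorted t /\ h = seq_idem t) \/
  exists a h', [/\ (a.+1 < n)%N, (t.@(a.+1) < t.@a)%N, sorting (swt a t) h'
    & h = psi a * h'].
Proof. by case=> [{}t ts|{}t a {}h an ta S]; [left|right; exists a, h]. Qed.

Lemma sorting_exists t : exists h, sorting t h.
Proof.
elim/(@descent_ind d n j0) : t => [t ts|t a an ta [h hP]].
  by exists (seq_idem t); apply: sorting_nil.
by exists (psi a * h); apply: sorting_cons hP.
Qed.

Lemma gt_neq t a b : (t.@b < t.@a)%N -> t.@a != t.@b.
Proof. by move=> ta; rewrite -(inj_eq val_inj) /=; lia. Qed.

(** Local confluence, by induction on [sort_weight]. Two first descents a < b are either far apart,
    and their crossings commute, or adjacent, and then t_a > t_(a+1) > t_(a+2) are three different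
    blocks, for which the braid relation has no correction. *)
Lemma sorting_uniq t h h' : sorting t h -> sorting t h' -> h = h'.
Proof.
move: h h'; elim/(@sort_weight_ind d n j0): t => t IH h h'.
have sortedN t1 a : tsorted t1 -> (a.+1 < n)%N -> ~ (t1.@(a.+1) < t1.@a)%N.
  by move=> ts an; rewrite ltnNge => /negP; apply; apply: ts.
case/sorting_inv=> [[ts ->]|[a [h1 [an ta Sa ->]]]].
  case/sorting_inv=> [[_ ->] //|[b [h2 [bn tb _ _]]]].
  by case: (sortedN _ _ ts bn).
case/sorting_inv=> [[ts _]|[b [h2 [bn tb Sb ->]]]].
  by case: (sortedN _ _ ts an).
have main a1 b1 g1 g2 : (a1.+1 < n)%N -> (t.@(a1.+1) < t.@a1)%N ->
    sorting (swt a1 t) g1 -> (b1.+1 < n)%N -> (t.@(b1.+1) < t.@b1)%N ->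
    sorting (swt b1 t) g2 -> (a1 < b1)%N -> psi a1 * g1 = psi b1 * g2.
  move=> {h1 h2 a an ta Sa b bn tb Sb h h'} an ta Sa bn tb Sb ab.
  have ma := sort_weight_swt an ta; have mb := sort_weight_swt bn tb.
  have [ab1|ab1] := eqVneq b1 a1.+1.
    subst b1; have s1 : sw a1.+1 a1 = a1 by rewrite sw_out; lia.
    have s2 : sw a1 a1.+2 = a1.+2 by rewrite sw_out; lia.
    (* Both ways of reversing the three letters end at this sequence; by induction [g1] and [g2] may
       be taken to pass through it. *)
    have [h3 S3] := sorting_exists (swt a1 (swt a1.+1 (swt a1 t))).
    have -> : g1 = psi a1.+1 * (psi a1 * h3).
      apply: (IH _ ma _ _ Sa); apply: sorting_cons => //.
        by rewrite !at_swt // s2 swr; lia.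
      by apply: sorting_cons => //; rewrite !at_swt // !(s1, s2, swl, swr).
    have -> : g2 = psi a1 * (psi a1.+1 * h3).
      apply: (IH _ mb _ _ Sb); apply: sorting_cons => //.
        by rewrite !at_swt // s1 swl; lia.
      apply: sorting_cons => //; first by rewrite !at_swt // !(s1, s2, swl, swr).
      by rewrite swt_braid.
    rewrite -(sorting_e S3) !mulrA braid_e //.
    by rewrite !at_swt // !(s1, s2, swl, swr) -!(inj_eq val_inj) /=; lia.
  have b1a : (a1.+1 < b1)%N by lia.
  have [h3 S3] := sorting_exists (swt a1 (swt b1 t)).
  have -> : g1 = psi b1 * h3.
    apply: (IH _ ma _ _ Sa); apply: sorting_cons => //; last by rewrite -swt_comm.
    by rewrite !at_swt // !sw_out; lia.
  have -> : g2 = psi a1 * h3.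
    apply: (IH _ mb _ _ Sb); apply: sorting_cons => //.
    by rewrite !at_swt // !sw_out; lia.
  by rewrite !mulrA (sys_psipsi sysH).
have [ab|ba|ab] := ltngtP a b.
- exact: main Sa _ _ Sb ab.
- by apply/esym; apply: main Sb _ _ Sa ba.
- by subst b; rewrite (IH _ (sort_weight_swt an ta) _ _ Sa Sb).
Qed.

(** At an ascent of t the rule for psi_a u_t is the construction of the path from s_a t; at a
    descent it follows from that construction for t and psi_a^2 = 1 on mixed crossings. *)
Lemma path_exists : exists u : n.-tuple 'I_d -> H,
  [/\ forall t, tsorted t -> u t = seq_idem t,
      forall t, seq_idem t * u t = u t
    & forall t a, (a.+1 < n)%N -> t.@a != t.@(a.+1) -> psi a * u t = u (swt a t)].
Proof.
have [u uP] := fin_all_exists sorting_exists; exists u.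
have ue t : seq_idem t * u t = u t by apply: sorting_e.
have desc t a : (a.+1 < n)%N -> (t.@(a.+1) < t.@a)%N -> u t = psi a * u (swt a t).
  by move=> an ta; apply: sorting_uniq (uP t) _; apply: sorting_cons.
split=> // [t ts|t a an ta]; first exact: sorting_uniq (uP t) (sorting_nil ts).
have [lt|lt|] := ltngtP (t.@a : nat) (t.@(a.+1)).
- have -> : u (swt a t) = psi a * u (swt a (swt a t)).
    by apply: desc => //; rewrite !at_swt // swl swr.
  by rewrite swtK.
- rewrite (desc t a) // mulrA -{1}ue mulrA psi2_e ?ue //.
  by rewrite !at_swt // swl swr eq_sym.
- by move=> /val_inj E; rewrite E eqxx in ta.
Qed.

Section Paths.
Variables (u : n.-tuple 'I_d -> H) (st : n.-tuple 'I_d).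
Hypothesis u_sorted : forall t, tsorted t -> u t = seq_idem t.
Hypothesis u_e : forall t, seq_idem t * u t = u t.
Hypothesis u_psi : forall t a, (a.+1 < n)%N -> t.@a != t.@(a.+1) ->
  psi a * u t = u (swt a t).
Hypothesis st_sorted : tsorted st.

Definition like_st t := forall j, count_mem j t = count_mem j st.

Lemma like_st_swt t a : (a.+1 < n)%N -> like_st t -> like_st (swt a t).
Proof. by move=> an tst j; rewrite count_swt. Qed.

Lemma like_st_eq t : tsorted t -> like_st t -> t = st.
Proof. by move=> ts tst; apply: tsorted_eq ts st_sorted tst. Qed.

Lemma u_desc t a : (a.+1 < n)%N -> (t.@(a.+1) < t.@a)%N -> u t = psi a * u (swt a t).
Proof.
move=> an /gt_neq ta; rewrite u_psi ?swtK //.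
by rewrite !at_swt // swl swr eq_sym.
Qed.

Lemma u_right t : like_st t -> u t * seq_idem st = u t.
Proof.
elim/(@descent_ind d n j0): t => [t ts /(like_st_eq ts) ->|t a an ta IH tst].
  by rewrite u_sorted // e_idem.
by rewrite (u_desc an ta) -mulrA IH //; apply: like_st_swt.
Qed.

(** The inverse is the product of the same crossings in the opposite order, since each mixed
    crossing is its own inverse. *)
Lemma path_inverse t : like_st t -> exists v, [/\ v * u t = seq_idem st, u t * v = seq_idem t,
  seq_idem st * v = v & v * seq_idem t = v].
Proof.
elim/(@descent_ind d n j0): t => [t ts /(like_st_eq ts) ->|t a an ta IH tst].
  by exists (seq_idem st); rewrite u_sorted // e_idem.
have [v [vu uv ev ve]] := IH (like_st_swt an tst).
have nta := gt_neq ta; have nsta : (swt a t).@a != (swt a t).@(a.+1).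
  by rewrite !at_swt // swl swr eq_sym.
exists (v * psi a); split.
- by rewrite -mulrA u_psi.
- by rewrite (u_desc an ta) -mulrA (mulrA (u _)) uv -psi_e // mulrA psi2_e.
- by rewrite mulrA ev.
- by rewrite -mulrA psi_e // mulrA ve.
Qed.

(** A mixed crossing preserves the block and the strand number, so y can follow its strand one
    crossing at a time, from c in t to c' in the sorted sequence. *)
Lemma y_u t c c' : like_st t -> (c < n)%N -> t.@c = st.@c' -> rk t c = rk st c' ->
  y c * u t = u t * y c'.
Proof.
elim/(@descent_ind d n j0): t c => [t ts|t a an ta IH] c tst cn tc rc.
  by move: tst tc rc => /(like_st_eq ts) -> tc /(rank_inj tc) <-; rewrite u_sorted // y_e.
have nta := gt_neq ta; have nsta : (swt a t).@a != (swt a t).@(a.+1).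
  by rewrite !at_swt // swl swr eq_sym.
rewrite (u_desc an ta) -mulrA -(IH (sw a c)) ?sw_lt //.
- rewrite -(u_e (swt a t)) !mulrA psi_y_e ?sw_lt // swK.
  by rewrite -!mulrA.
- exact: like_st_swt.
- by rewrite at_swt // swK.
- by rewrite rank_swt.
Qed.

Lemma eps_u t c c' x : like_st t -> (c < n)%N -> t.@c = st.@c' -> rk t c = rk st c' ->
  eps c x * u t = u t * eps c' x.
Proof.
elim/(@descent_ind d n j0): t c => [t ts|t a an ta IH] c tst cn tc rc.
  by move: tst tc rc => /(like_st_eq ts) -> tc /(rank_inj tc) <-; rewrite u_sorted // eps_e.
have nta := gt_neq ta.
rewrite (u_desc an ta) -mulrA -(IH (sw a c)) ?sw_lt //.
- by rewrite !mulrA (sys_psieps sysH) ?sw_lt // swK.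
- exact: like_st_swt.
- by rewrite at_swt // swK.
- by rewrite rank_swt.
Qed.

(** A descent far from c commutes with psi_c. A descent next to c separates the two equal strands,
    so the foreign strand is taken across both of them at once with a mixed braid relation. This
    uses two descents, hence the induction on [sort_weight] instead of [descent_ind]. *)
Lemma psi_u t c c' : like_st t -> (c.+1 < n)%N -> t.@c = t.@(c.+1) ->
    (c'.+1 < n)%N -> st.@c' = st.@(c'.+1) -> t.@c = st.@c' -> rk t c = rk st c' ->
  psi c * u t = u t * psi c'.
Proof.
move=> + + + cn' stc'; elim/(@sort_weight_ind d n j0): t c => t IH c tst cn tcc tc rc.
have [ts|[a an ta]] := tsorted_or_descent j0 t.
  move: tst tc rc => /(like_st_eq ts) -> tc /(rank_inj tc) ->.
  by rewrite u_sorted // psi_e // swt_id.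
have nta := gt_neq ta; have mt := sort_weight_swt an ta; have tst' := like_st_swt an tst.
have [ca|ca] := eqVneq c a; first by rewrite -ca tcc ltnn in ta.
have [ca1|ca1] := eqVneq c a.+1.
  (* The larger letter stands left of the equal pair and moves right across it; the pair continues
     at position a. *)
  subst c; have s1 : sw a.+1 a = a by rewrite sw_out; lia.
  have s2 : sw a a.+2 = a.+2 by rewrite sw_out; lia.
  have ta' : ((swt a t).@(a.+2) < (swt a t).@(a.+1))%N.
    by rewrite !at_swt // s2 swr -tcc.
  have n01 : t.@a != t.@(a.+2) by rewrite -tcc.
  rewrite (u_desc an ta) (u_desc cn ta') !mulrA -u_e !mulrA braid_e //; last first.
    by rewrite !at_swt // !(s1, s2, swl, swr) tcc eqxx eq_sym (negPf n01) andbF.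
  rewrite -!mulrA u_e (IH _ _ a) //.
  - by rewrite (mulrA (seq_idem _)) u_e.
  - exact: ltn_trans (sort_weight_swt cn ta') mt.
  - exact: like_st_swt.
  - by rewrite !at_swt // !(s1, s2, swl, swr).
  - by rewrite !at_swt // !(s1, s2, swl, swr).
  - have := rank_swt a cn (gt_neq ta'); rewrite s1 => ->.
    by have := rank_swt a.+1 an nta; rewrite swr => ->.
have [ca2|ca2] := eqVneq a c.+1.
  (* The smaller letter stands right of the equal pair and moves left across it; the pair continues
     at position c + 1. *)
  subst a; have s1 : sw c.+1 c = c by rewrite sw_out; lia.
  have s2 : sw c c.+2 = c.+2 by rewrite sw_out; lia.
  have ta' : ((swt c.+1 t).@(c.+1) < (swt c.+1 t).@c)%N.
    by rewrite !at_swt // s1 swl tcc.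
  have n01 : t.@(c.+2) != t.@c by rewrite tcc eq_sym.
  rewrite (u_desc an ta) (u_desc cn ta') !mulrA -u_e !mulrA -braid_e //; last first.
    by rewrite !at_swt // !(s1, s2, swl, swr) (negPf n01).
  rewrite -!mulrA u_e (IH _ _ c.+1) //.
  - by rewrite (mulrA (seq_idem _)) u_e.
  - exact: ltn_trans (sort_weight_swt cn ta') mt.
  - exact: like_st_swt.
  - by rewrite !at_swt // !(s1, s2, swl, swr).
  - by rewrite !at_swt // !(s1, s2, swl, swr).
  - have := rank_swt c cn (gt_neq ta'); rewrite swl => ->.
    by have := rank_swt c an nta; rewrite s1 => ->.
rewrite (u_desc an ta) mulrA.
have -> : psi c * psi a = psi a * psi c.
  have [lt|lt] := ltnP c a; first by rewrite (sys_psipsi sysH) //; lia.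
  by rewrite -(sys_psipsi sysH) //; lia.
have [o1 o2] : sw a c = c /\ sw a c.+1 = c.+1 by rewrite !sw_out; lia.
rewrite -!mulrA (IH _ mt c) ?at_swt ?o1 ?o2 //.
by have := rank_swt c an nta; rewrite o1 => ->.
Qed.

End Paths.

End BlockIdempotents.

(** * The tensor product inside the corner *)

Section CornerLifts.
Variables (A : comNzRingType) (V : pzAlgType A) (e : V).
Hypothesis ee : e * e = e.
Local Notation C := (corner ee).
Implicit Types (x : C) (u : V).

(** An element of the corner represented by an element u of V that commutes with e. Sums, products
    and polynomials can be computed on the representatives and cut by e only at the end. *)
Definition lifts x u := val x = u * e /\ e * u = u * e.

Lemma lifts_in u : e * u = u * e -> lifts (in_corner ee u) u.
Proof. by move=> eu; split=> //=; rewrite eu -mulrA ee. Qed.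

Lemma lifts_eq x x' u u' : lifts x u -> lifts x' u' -> u * e = u' * e -> x = x'.
Proof. by move=> [xu _] [xu' _] uu'; apply: val_inj; rewrite xu xu'. Qed.

Lemma liftsM x x' u u' : lifts x u -> lifts x' u' -> lifts (x * x') (u * u').
Proof.
move=> [xu eu] [xu' eu']; split; last by rewrite mulrA eu -mulrA eu' mulrA.
rewrite [LHS](corner_mulE x x') xu xu' -mulrA (mulrA e) eu' -!mulrA ee.
by rewrite !mulrA.
Qed.

Lemma liftsD x x' u u' : lifts x u -> lifts x' u' -> lifts (x + x') (u + u').
Proof.
move=> [xu eu] [xu' eu']; split; last by rewrite mulrDr mulrDl eu eu'.
by rewrite [LHS](corner_addE x x') xu xu' mulrDl.
Qed.

Lemma lifts0 : lifts 0 0.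
Proof. by split; [rewrite [LHS](corner_0E ee)|]; rewrite ?mul0r ?mulr0. Qed.

Lemma lifts_algmap a : lifts (algmap a) (algmap a).
Proof. by split; [apply: (corner_algmapE ee) | rewrite algmap_central]. Qed.

Lemma lifts1 : lifts 1 1.
Proof. by rewrite -(rmorph1 (@algmap A C)) -(rmorph1 (@algmap A V)); apply: lifts_algmap. Qed.

Lemma lifts_nat m : lifts m%:R m%:R.
Proof.
elim: m => [|m IHm]; first exact: lifts0.
by rewrite -!natr1; apply: liftsD IHm lifts1.
Qed.

Lemma lifts_sum (I : Type) (r : seq I) (P : pred I) (F : I -> C) (f : I -> V) :
  (forall i, lifts (F i) (f i)) ->
  lifts (\sum_(i <- r | P i) F i) (\sum_(i <- r | P i) f i).
Proof.
move=> Ff; elim/big_rec2: _ => [|i u x _ xu]; first exact: lifts0.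
exact: liftsD.
Qed.

Lemma liftsX x u m : lifts x u -> lifts (x ^+ m) (u ^+ m).
Proof.
move=> xu; elim: m => [|m IHm]; first exact: lifts1.
by rewrite !exprS; apply: liftsM.
Qed.

Lemma lifts_eval2 P x x' u u' : lifts x u -> lifts x' u' ->
  lifts (eval2 P x x') (eval2 P u u').
Proof.
move=> xu xu'; apply: lifts_sum => i; apply: lifts_sum => j.
by apply: liftsM (liftsM (lifts_algmap _) (liftsX _ xu)) (liftsX _ xu').
Qed.

Lemma lifts_eval3 P x x' x'' u u' u'' : lifts x u -> lifts x' u' ->
  lifts x'' u'' -> lifts (eval3 P x x' x'') (eval3 P u u' u'').
Proof.
move=> xu xu' xu''; apply: lifts_sum => i.
by apply: liftsM (liftsX _ xu) (lifts_eval2 _ xu' xu'').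
Qed.

End CornerLifts.

Section BlockEmbedding.
Variables (A : comNzRingType) (K : finType) (Q : K -> K -> {poly {poly A}}).
Variables (d n : nat) (j0 : 'I_d) (KJ : 'I_d -> {set K}).
Hypothesis KJ_disjoint : forall j j' : 'I_d, j != j' -> [disjoint KJ j & KJ j'].

Variables (H : pzAlgType A) (eps : nat -> K -> H) (y psi : nat -> H).
Hypothesis sysH : qhsys Q n eps y psi.

Variables (st : n.-tuple 'I_d) (c : 'I_d -> nat).
Hypothesis st_sorted : tsorted j0 st.
Hypothesis st_count : forall j, count_mem j st = c j.

Local Notation "t .@ a" := (at_ j0 t a) (at level 2, format "t .@ a").
Local Notation e := (seq_idem j0 KJ eps st).

Let ee : e * e = e.
Proof. exact (e_idem j0 KJ_disjoint sysH st). Qed.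

Definition place (j : 'I_d) (r : nat) : nat := pos (at_ j0 st) n j r.

Section OnePlace.
Variable j : 'I_d.

Lemma cntE : cnt (at_ j0 st) n j = c j.
Proof. by rewrite -count_cnt st_count. Qed.

Lemma placeP r : (r < c j)%N ->
  [/\ (place j r < n)%N, st.@(place j r) = j & rank (at_ j0 st) (place j r) = r].
Proof. by rewrite -cntE; apply: posP. Qed.

Lemma placeS r : (r.+1 < c j)%N -> place j r.+1 = (place j r).+1.
Proof. by rewrite -cntE; apply: pos_tsorted. Qed.

Lemma place_inj r r' : (r < c j)%N -> (r' < c j)%N -> place j r = place j r' -> r = r'.
Proof. by move=> /placeP[_ _ pr] /placeP[_ _ pr'] rr'; rewrite -pr -pr' rr'. Qed.

Lemma place_sw r b : (r.+1 < c j)%N -> (b < c j)%N ->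
  place j (sw r b) = sw (place j r) (place j b).
Proof.
move=> rj bj; have rj' : (r < c j)%N by lia.
have [->|br] := eqVneq b r; first by rewrite !swl placeS.
have [->|br1] := eqVneq b r.+1; first by rewrite placeS // !swr.
have p1 : place j b != place j r by apply: contra br => /eqP/place_inj ->.
have p2 : place j b != place j r.+1 by apply: contra br1 => /eqP/place_inj ->.
by rewrite !sw_out // -placeS.
Qed.

End OnePlace.

(** The generators of H that involve only strands of the block i in the sorted sequence. They
    commute with e(st), and for two different blocks with each other. *)
Inductive block_gen (i : 'I_d) : H -> Prop :=
| block_gen_eps a x : (a < n)%N -> st.@a = i -> block_gen i (eps a x)
| block_gen_y a : (a < n)%N -> st.@a = i -> block_gen i (y a)
| block_gen_psi a : (a.+1 < n)%N -> st.@a = i -> st.@(a.+1) = i ->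
    block_gen i (psi a).

Lemma block_gen_e i u : block_gen i u -> e * u = u * e.
Proof.
case=> {u} [a x an _|a an _|a an ai ai1]; first exact/esym/(eps_e j0 KJ sysH).
  exact/esym/(y_e j0 KJ sysH).
by rewrite (psi_e j0 KJ_disjoint sysH) // swt_id // ai ai1.
Qed.

Lemma block_gen_comm i j u v : i != j -> block_gen i u -> block_gen j v -> u * v = v * u.
Proof.
have neq a b k k' : k != k' -> st.@a = k -> st.@b = k' -> a != b.
  by move=> kk' ak bk; apply: contraNneq kk' => ab; rewrite -ak -bk ab.
have pe k k' a b x : k != k' -> (a.+1 < n)%N -> st.@a = k -> st.@(a.+1) = k ->
    (b < n)%N -> st.@b = k' -> psi a * eps b x = eps b x * psi a.
  move=> kk' an ak ak1 bn bk; rewrite (sys_psieps sysH) // sw_out // eq_sym.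
    exact: neq kk' ak bk.
  exact: neq kk' ak1 bk.
have py k k' a b : k != k' -> (a.+1 < n)%N -> st.@a = k -> st.@(a.+1) = k ->
    (b < n)%N -> st.@b = k' -> psi a * y b = y b * psi a.
  move=> kk' an ak ak1 bn bk; rewrite (sys_psiy sysH) // eq_sym.
    exact: neq kk' ak bk.
  exact: neq kk' ak1 bk.
move=> ij; have ji : j != i by rewrite eq_sym.
case=> {u} [a x an ai|a an ai|a an ai ai1];
  case=> {v} [b x' bn bj|b bn bj|b bn bj bj1].
- exact: sys_epsC sysH _ _ _ _ _ _.
- exact/esym/(sys_yeps sysH).
- exact/esym/(pe _ _ _ _ _ ji).
- exact: sys_yeps sysH _ _ _ _ _.
- exact: sys_yy sysH _ _ _ _.
- exact/esym/(py _ _ _ _ ji).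
- exact: pe ij an ai ai1 bn bj.
- exact: py ij an ai ai1 bn bj.
(* The three inequalities make a and b differ by at least 2, so the two crossings are far apart. *)
- have n1 := neq _ _ _ _ ij ai bj; have n2 := neq _ _ _ _ ij ai1 bj.
  have n3 := neq _ _ _ _ ij ai bj1.
  have [ab|ba] := ltnP a b; first by rewrite (sys_psipsi sysH) //; lia.
  by rewrite -(sys_psipsi sysH) //; lia.
Qed.

Variable Bj : 'I_d -> pzAlgType A.
Variables (eb : forall j, nat -> block (KJ j) -> Bj j).
Variables (yb pb : forall j, nat -> Bj j).
Hypothesis Bj_univ : forall j,
  qh_universal (subQ (X := KJ j) Q) (c j) (@eb j) (@yb j) (@pb j).

Local Notation C := (corner ee).
Local Notation inC := (in_corner ee).

Definition corner_eps j r (k : block (KJ j)) : C := inC (eps (place j r) (val k)).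
Definition corner_y j r : C := inC (y (place j r)).
Definition corner_psi j r : C := inC (psi (place j r)).

Lemma gen_place_eps j r x : (r < c j)%N -> block_gen j (eps (place j r) x).
Proof. by move=> /placeP[? ? _]; apply: block_gen_eps. Qed.
Lemma gen_place_y j r : (r < c j)%N -> block_gen j (y (place j r)).
Proof. by move=> /placeP[? ? _]; apply: block_gen_y. Qed.
Lemma gen_place_psi j r : (r.+1 < c j)%N -> block_gen j (psi (place j r)).
Proof.
move=> rj; have [_ a1 _] := placeP (ltnW rj); have [b0 b1 _] := placeP rj.
by rewrite placeS // in b0 b1; apply: block_gen_psi.
Qed.

Lemma lifts_eps j r (k : block (KJ j)) : (r < c j)%N ->
  lifts (corner_eps r k) (eps (place j r) (val k)).
Proof. by move=> rj; apply/lifts_in/(@block_gen_e j)/gen_place_eps. Qed.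
Lemma lifts_y j r : (r < c j)%N -> lifts (corner_y j r) (y (place j r)).
Proof. by move=> rj; apply/lifts_in/(@block_gen_e j)/gen_place_y. Qed.
Lemma lifts_psi j r : (r.+1 < c j)%N -> lifts (corner_psi j r) (psi (place j r)).
Proof. by move=> rj; apply/lifts_in/(@block_gen_e j)/gen_place_psi. Qed.

(** Each relation of the block algebra is the corresponding relation of H at the positions
    [place j r], cut by e(st); adjacency of these positions comes from [placeS]. *)
Lemma corner_system j :
  qhsys (subQ (X := KJ j) Q) (c j) (@corner_eps j) (corner_y j) (corner_psi j).
Proof.
have pn r : (r < c j)%N -> (place j r < n)%N by case/placeP.
have pS r : (r.+1 < c j)%N -> (place j r).+1 = place j r.+1 by move=> rj; rewrite placeS.
have pn1 r : (r.+1 < c j)%N -> ((place j r).+1 < n)%N by move=> rj; rewrite pS // pn.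
have p_neq r r' : (r < c j)%N -> (r' < c j)%N -> r != r' -> place j r != place j r'.
  by move=> rj rj'; apply: contra => /eqP/place_inj ->.
have L_ee r r' (k k' : block (KJ j)) : (r < c j)%N -> (r' < c j)%N ->
    lifts (corner_eps r k * corner_eps r' k')
      (eps (place j r) (val k) * eps (place j r') (val k')).
  by move=> rj rj'; apply: liftsM; apply: lifts_eps.
have val_eq (k k' : block (KJ j)) : (k == k') = (val k == val k') by rewrite (inj_eq val_inj).
split.
- move=> r rj.
  have Ls : lifts (\sum_k corner_eps (j := j) r k)
      (\sum_(k : block (KJ j)) eps (place j r) (val k)).
    by apply: lifts_sum => k; apply: lifts_eps.
  apply: lifts_eq Ls (lifts1 ee) _.
  have [pr ptj _] := placeP rj.
  (* The colours of the block j sum to a block idempotent of H, which acts as 1 only next to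
     e(st). *)
  rewrite mul1r -[RHS](e_absorb j0 KJ_disjoint sysH _ pr) ptj /block_eps.
  by congr (_ * _); exact (esym (big_sub (KJ j) (fun x => eps (place j r) x))).
- move=> r k k' rj.
  apply: lifts_eq (L_ee _ _ _ _ rj rj) (liftsM (lifts_nat _ _) (lifts_eps _ rj)) _.
  by rewrite (sys_idem sysH) ?pn // val_eq.
- move=> r r' k k' rj rj'; apply: lifts_eq (L_ee _ _ _ _ rj rj') (L_ee _ _ _ _ rj' rj) _.
  by rewrite (sys_epsC sysH) ?pn.
- move=> r r' k rj rj'.
  apply: lifts_eq (liftsM (lifts_y rj') (lifts_eps _ rj)) (liftsM (lifts_eps _ rj) (lifts_y rj')) _.
  by rewrite (sys_yeps sysH) ?pn.
- move=> r r' k rj rj'; have sj : (sw r r' < c j)%N by rewrite sw_lt.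
  apply: lifts_eq (liftsM (lifts_psi rj) (lifts_eps _ rj')) (liftsM (lifts_eps _ sj) (lifts_psi rj)) _.
  by rewrite (sys_psieps sysH) ?pn ?pn1 // place_sw.
- move=> r r' rj rj'.
  apply: lifts_eq (liftsM (lifts_y rj) (lifts_y rj')) (liftsM (lifts_y rj') (lifts_y rj)) _.
  by rewrite (sys_yy sysH) ?pn.
- move=> r r' rj rj' n1 n2.
  apply: lifts_eq (liftsM (lifts_psi rj) (lifts_y rj')) (liftsM (lifts_y rj') (lifts_psi rj)) _.
  by rewrite (sys_psiy sysH) ?pn ?pn1 ?pS ?p_neq //; lia.
- move=> r r' rj rj' rr.
  apply: lifts_eq (liftsM (lifts_psi rj) (lifts_psi rj')) (liftsM (lifts_psi rj') (lifts_psi rj)) _.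
  rewrite (sys_psipsi sysH) ?pn1 //.
  have lt m m' : (m' < c j)%N -> (m < m')%N -> (place j m < place j m')%N.
    elim: m' => // m' IH mj; rewrite ltnS leq_eqVlt placeS // => /orP[/eqP -> //|mm].
    by have := IH (ltnW mj) mm; lia.
  by rewrite pS // lt //; lia.
- move=> r k k' rj; have rj' := ltnW rj.
  apply: lifts_eq (liftsM (liftsM (lifts_psi rj) (lifts_y rj)) (L_ee _ _ _ _ rj' rj))
    (liftsM (liftsD (liftsM (lifts_y rj') (lifts_psi rj)) (lifts_nat _ _)) (L_ee _ _ _ _ rj' rj)) _.
  by rewrite placeS // (sys_psiy1 sysH) ?pn1 // val_eq.
- move=> r k k' rj; have rj' := ltnW rj.
  apply: lifts_eq (liftsM (liftsM (lifts_y rj) (lifts_psi rj)) (L_ee _ _ _ _ rj' rj))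
    (liftsM (liftsD (liftsM (lifts_psi rj) (lifts_y rj')) (lifts_nat _ _)) (L_ee _ _ _ _ rj' rj)) _.
  by rewrite placeS // (sys_y1psi sysH) ?pn1 // val_eq.
- move=> r k k' rj; have rj' := ltnW rj.
  apply: lifts_eq (liftsM (liftsM (lifts_psi rj) (lifts_psi rj)) (L_ee _ _ _ _ rj' rj))
    (liftsM (lifts_eval2 _ (lifts_y rj') (lifts_y rj)) (L_ee _ _ _ _ rj' rj)) _.
  by rewrite placeS // (sys_psi2 sysH) ?pn1.
- move=> r k k' k'' rj; have rj' := ltnW rj; have rj'' := ltnW rj'.
  have L3 := liftsM (lifts_eps k rj'') (L_ee _ _ k' k'' rj' rj).
  apply: lifts_eq (liftsM (liftsM (liftsM (lifts_psi rj) (lifts_psi rj')) (lifts_psi rj)) L3)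
    (liftsM (liftsD (liftsM (liftsM (lifts_psi rj') (lifts_psi rj)) (lifts_psi rj'))
       (lifts_eval3 _ (lifts_y rj'') (lifts_y rj) (lifts_y rj'))) L3) _.
  have pr2 : place j r.+2 = (place j r).+2 by rewrite !placeS.
  by rewrite pr2 placeS // (sys_braid sysH) -?pr2 ?pn.
Qed.

(** Each block algebra maps to the corner by its universal property, and the images commute because
    their generators do. [Th] sends 1 to e(st), so as a map to H it is not unital and its properties
    are listed one by one. *)
Lemma block_embedding : exists Th : tensoralg Bj -> H,
  [/\ [/\ zmod_morphism Th, {morph Th : x x' / x * x'}, Th 1 = e
        & forall a, Th (algmap a) = algmap a * e],
      forall j r k, (r < c j)%N ->
        Th (tensor_in (@eb j r k)) = eps (place j r) (val k) * e,
      forall j r, (r < c j)%N -> Th (tensor_in (@yb j r)) = y (place j r) * e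
    & forall j r, (r.+1 < c j)%N -> Th (tensor_in (@pb j r)) = psi (place j r) * e].
Proof.
have lift_j j : exists f : Bj j -> C, [/\ alg_morphism f,
    forall r k, (r < c j)%N -> f (@eb j r k) = corner_eps r k,
    forall r, (r < c j)%N -> f (@yb j r) = corner_y j r
  & forall r, (r.+1 < c j)%N -> f (@pb j r) = corner_psi j r].
  by have [_ lift _] := Bj_univ j; apply: lift; apply: corner_system.
have [f fP] := fin_all_exists lift_j.
have fA j : alg_morphism (f j) by case: (fP j).
have cent_closed j (z : C) : alg_closed (fun x => f j x * z = z * f j x).
  have [g gE ga] := alg_morphism_rmorphism (fA j); rewrite gE; split=> [a|x x' xz xz'|x x' xz xz'].
  - by rewrite ga algmap_central.
  - by rewrite rmorphD mulrDl mulrDr xz xz'.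
  - by rewrite rmorphM -mulrA xz' mulrA xz mulrA.
have lifts_comm i j (x z : C) u v : i != j -> block_gen i u -> block_gen j v ->
    lifts x u -> lifts z v -> x * z = z * x.
  move=> ij iu jv xu zv; apply: lifts_eq (liftsM xu zv) (liftsM zv xu) _.
  by rewrite (block_gen_comm ij iu jv).
(* Commutation is proved in two inductions: any image from the block i against a generator of the
   block j, then against any image from the block j. *)
have fC1 i j (z : C) v : i != j -> block_gen j v -> lifts z v ->
    forall x, f i x * z = z * f i x.
  move=> ij jv zv; have [_ _ ind] := Bj_univ i; have [_ fe fy fp] := fP i.
  apply: ind (cent_closed i z) _ _ _ => [r k ri|r ri|r ri].
  - rewrite fe //; apply: lifts_comm ij _ jv (lifts_eps _ ri) zv; exact: gen_place_eps.
  - rewrite fy //; apply: lifts_comm ij _ jv (lifts_y ri) zv; exact: gen_place_y.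
  - rewrite fp //; apply: lifts_comm ij _ jv (lifts_psi ri) zv; exact: gen_place_psi.
have fC i j x x' : i != j -> GRing.comm (f i x) (f j x').
  move=> ij; rewrite /GRing.comm; apply: esym; move: x'.
  have [_ _ ind] := Bj_univ j; have [_ fe fy fp] := fP j.
  apply: ind (cent_closed j (f i x)) _ _ _ => [r k rj|r rj|r rj]; apply/esym.
  - by rewrite fe //; apply: fC1 ij (gen_place_eps _ rj) (lifts_eps _ rj) x.
  - by rewrite fy //; apply: fC1 ij (gen_place_y rj) (lifts_y rj) x.
  - by rewrite fp //; apply: fC1 ij (gen_place_psi rj) (lifts_psi rj) x.
have [F [FA Fj]] := tensor_lift fA fC; have [FB [F1 FM] Fa] := FA.
exists (fun x => val (F x)); split.
- split=> [x x'|x x'||a].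
  + by rewrite FB [LHS](corner_addE) [X in _ + X](corner_oppE).
  + by rewrite FM; apply: (corner_mulE).
  + by rewrite F1; apply: (corner_1E ee).
  + by rewrite Fa; apply: (corner_algmapE ee).
- by move=> j r k rj; rewrite Fj; have [_ -> // _ _] := fP j; case: (lifts_eps k rj).
- by move=> j r rj; rewrite Fj; have [_ _ -> // _] := fP j; case: (lifts_y rj).
- by move=> j r rj; rewrite Fj; have [_ _ _ -> //] := fP j; case: (lifts_psi rj).
Qed.

End BlockEmbedding.

(** * The two inverse maps *)

Lemma qhsys_morph (A : comNzRingType) (K : finType) (Q : K -> K -> {poly {poly A}})
    (V W : pzAlgType A) (f : V -> W) n eps y psi :
  alg_morphism f -> qhsys Q n eps y psi ->
  qhsys Q n (fun a x => f (eps a x)) (fun a => f (y a)) (fun a => f (psi a)).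
Proof.
move=> fA S; have [g fg ga] := alg_morphism_rmorphism fA; subst f.
split=> *; rewrite -?(eval2_morph _ _ _ fA) -?(eval3_morph _ _ _ _ fA).
- by rewrite -rmorph_sum (sys_sum S) // rmorph1.
- by rewrite -rmorphM (sys_idem S) // rmorphM rmorph_nat.
- by rewrite -!rmorphM (sys_epsC S).
- by rewrite -!rmorphM (sys_yeps S).
- by rewrite -!rmorphM (sys_psieps S).
- by rewrite -!rmorphM (sys_yy S).
- by rewrite -!rmorphM (sys_psiy S).
- by rewrite -!rmorphM (sys_psipsi S).
- by rewrite -!rmorphM (sys_psiy1 S) // !(rmorphM, rmorphD, rmorph_nat).
- by rewrite -!rmorphM (sys_y1psi S) // !(rmorphM, rmorphD, rmorph_nat).
- by rewrite -!rmorphM (sys_psi2 S).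
- by rewrite -!rmorphM (sys_braid S) // -!(rmorphM, rmorphD).
Qed.

Section BlockExtension.
Variables (A : comNzRingType) (K : finType) (Q : K -> K -> {poly {poly A}}).
Variables (X : {set K}) (V : pzAlgType A) (eps : nat -> block X -> V).

(** Colours outside the block get the idempotent 0, so that the systems of all blocks are indexed by
    the same K. *)
Definition ext_eps (a : nat) (x : K) : V := oapp (eps a) 0 (insub x).

Lemma ext_eps_in a (k : block X) : ext_eps a (val k) = eps a k.
Proof. by rewrite /ext_eps valK. Qed.

Lemma ext_eps_out a x : x \notin X -> ext_eps a x = 0.
Proof. by move=> xX; rewrite /ext_eps insubN. Qed.

Lemma ext_system n y psi : qhsys (subQ (X := X) Q) n eps y psi ->
  qhsys Q n ext_eps y psi.
Proof.
move=> S; have xP x : (exists k : block X, x = val k) \/ (forall a, ext_eps a x = 0).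
  case: (boolP (x \in X)) => xX; [left|by right=> a; apply: ext_eps_out].
  by exists (exist _ x xX).
have ext2 a b x x' u v : (forall k k' : block X, x = val k -> x' = val k' ->
      u * (eps a k * eps b k') = v * (eps a k * eps b k')) ->
    u * (ext_eps a x * ext_eps b x') = v * (ext_eps a x * ext_eps b x').
  move=> uv; have [[k xk]|->] := xP x; last by rewrite !(mul0r, mulr0).
  have [[k' xk']|->] := xP x'; last by rewrite !mulr0.
  by rewrite xk xk' !ext_eps_in; apply: uv.
have val_eq (k k' : block X) : (val k == val k') = (k == k') by rewrite (inj_eq val_inj).
split.
- move=> a an; rewrite -(sys_sum S an) (bigID (mem X)) /= [X in _ + X]big1 ?addr0; last first.
    by move=> x; apply: ext_eps_out.
  rewrite (big_sub X (ext_eps a)).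
  by apply: eq_bigr => k _; apply: ext_eps_in.
- move=> a x x' an; have [[k ->]|x0] := xP x; last by rewrite !x0 mulr0 mul0r.
  have [[k' ->]|x0'] := xP x'.
    by rewrite !ext_eps_in (sys_idem S) // val_eq.
  by rewrite x0' mulr0; case: eqP => [->|_]; rewrite ?x0' ?mulr0 ?mul0r.
- move=> a b x x' an bn; have [[k ->]|x0] := xP x; last by rewrite !x0 mulr0 mul0r.
  have [[k' ->]|x0'] := xP x'; last by rewrite !x0' mulr0 mul0r.
  by rewrite !ext_eps_in (sys_epsC S).
- move=> a b x an bn; have [[k ->]|x0] := xP x; last by rewrite !x0 mulr0 mul0r.
  by rewrite !ext_eps_in (sys_yeps S).
- move=> a b x an bn; have [[k ->]|x0] := xP x; last by rewrite !x0 mulr0 mul0r.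
  by rewrite !ext_eps_in (sys_psieps S).
- exact: sys_yy S.
- exact: sys_psiy S.
- exact: sys_psipsi S.
- by move=> a x x' an; apply: ext2 => k k' -> ->; rewrite (sys_psiy1 S) // val_eq.
- by move=> a x x' an; apply: ext2 => k k' -> ->; rewrite (sys_y1psi S) // val_eq.
- by move=> a x x' an; apply: ext2 => k k' -> ->; rewrite (sys_psi2 S).
- move=> a x x' x'' an.
  have [[k ->]|x0] := xP x; last by rewrite !x0 mul0r !mulr0.
  have [[k' ->]|x0] := xP x'; last by rewrite !x0 mul0r !mulr0.
  have [[k'' ->]|x0] := xP x''; last by rewrite !x0 !mulr0.
  by rewrite !ext_eps_in (sys_braid S) // /braid_corr val_eq.
Qed.

End BlockExtension.

(** * One composition: the maps Phi and Psi and their composites *)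

Section Layer.
Variables (A : comNzRingType) (K : finType) (Q : K -> K -> {poly {poly A}}).
Variables (d n : nat) (j0 : 'I_d) (KJ : 'I_d -> {set K}).
Hypothesis KJ_cover : \bigcup_j KJ j = setT.
Hypothesis KJ_disjoint : forall j j' : 'I_d, j != j' -> [disjoint KJ j & KJ j'].
Hypothesis Q_blocks : forall (j j' : 'I_d) (k k' : K),
  j != j' -> k \in KJ j -> k' \in KJ j' -> Q k k' = 1.

Variables (H : pzAlgType A) (eps : nat -> K -> H) (y psi : nat -> H).
Hypothesis H_univ : qh_universal Q n eps y psi.

Variables (l : dcomposition d n).
Let c (j : 'I_d) : nat := val l j.
Variable Bj : 'I_d -> pzAlgType A.
Variables (eb : forall j, nat -> block (KJ j) -> Bj j).
Variables (yb pb : forall j, nat -> Bj j).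
Hypothesis Bj_univ : forall j,
  qh_universal (subQ (X := KJ j) Q) (c j) (@eb j) (@yb j) (@pb j).

Variables (T : pzAlgType A) (tin : forall j, Bj j -> T).
Hypothesis tin_morph : forall j, alg_morphism (@tin j).
Hypothesis tin_comm : forall i j x x', i != j -> GRing.comm (@tin i x) (@tin j x').
Hypothesis T_ind : forall P : T -> Prop, alg_closed P ->
  (forall j x, P (@tin j x)) -> forall z, P z.

Local Notation M := (matalg (multinom l) T).
Local Notation tau := (@tau d n l).
Local Notation "t .@ a" := (at_ j0 t a) (at level 2, format "t .@ a").
Local Notation swt := (swt j0).
Local Notation rk t a := (rank (at_ j0 t) a).
Local Notation e := (seq_idem j0 KJ eps).
Local Notation dcol := (dcol (B := T) tau).
Local Notation acts := (acts (B := T) tau).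
Implicit Types t : n.-tuple 'I_d.

Let sysH : qhsys Q n eps y psi. Proof. by case: H_univ. Qed.

Let EK j : nat -> K -> T := ext_eps (fun r k => tin (@eb j r k)).
Let YK j r : T := tin (@yb j r).
Let PK j r : T := tin (@pb j r).
Let in_block j (u : T) := exists x, u = tin (j := j) x.

Let sysK j : qhsys Q (c j) (EK j) (YK j) (PK j).
Proof.
have [S _ _] := Bj_univ j.
exact: ext_system (qhsys_morph (tin_morph j) S).
Qed.

Let in_block_comm i j u v : i != j -> in_block i u -> in_block j v -> u * v = v * u.
Proof. by move=> ij [x ->] [x' ->]; apply: tin_comm. Qed.

Let EK_block j r x : in_block j (EK j r x).
Proof.
rewrite /EK /ext_eps; case: insub => [k|] /=; first by exists (@eb j r k).
have [g gE _] := alg_morphism_rmorphism (tin_morph j).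
by exists 0; rewrite gE rmorph0.
Qed.

Let Msys := matrix_system j0 KJ_disjoint Q_blocks sysK
  (fun j r x _ => @ext_eps_out _ _ _ _ _ r x) in_block_comm
  (fun j r x _ => EK_block j r x) (fun j r _ => ex_intro _ _ erefl)
  (fun j r _ => ex_intro _ _ erefl) (l := l) (fun j => erefl).


Let PhiP := let: And3 _ lift _ := H_univ in lift _ _ _ _ Msys.

Lemma eps_e0 (t : n.-tuple 'I_d) a x : (a < n)%N -> x \notin KJ t.@a -> eps a x * e t = 0.
Proof.
move=> an xa; rewrite -(e_absorb j0 KJ_disjoint sysH t an) mulrA.
by rewrite (eps_block_eps KJ sysH) // (negPf xa) !mul0r.
Qed.

Section Images.
Variable Phi : H -> M.
Hypothesis PhiA : alg_morphism Phi.
Hypothesis Phi_eps : forall t a x, (a < n)%N -> has_content l t ->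
  acts (Phi (eps a x)) t t (eps_at j0 EK t a x).
Hypothesis Phi_y : forall t a, (a < n)%N -> has_content l t ->
  acts (Phi (y a)) t t (y_at j0 YK t a).
Hypothesis Phi_psi : forall t a, (a.+1 < n)%N -> has_content l t ->
  acts (Phi (psi a)) (swt a t) t (psi_at j0 PK t a).

Variable st : n.-tuple 'I_d.
Hypothesis st_sorted : tsorted j0 st.
Hypothesis st_content : has_content l st.

Variable Th : T -> H.
Hypothesis ThB : zmod_morphism Th.
Hypothesis ThM : {morph Th : x x' / x * x'}.
Hypothesis Th1 : Th 1 = e st.
Hypothesis Th_algmap : forall a, Th (algmap a) = algmap a * e st.
Local Notation place := (place j0 st).
Hypothesis Th_eps : forall j r k, (r < c j)%N ->
  Th (tin (@eb j r k)) = eps (place j r) (val k) * e st.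
Hypothesis Th_y : forall j r, (r < c j)%N ->
  Th (tin (@yb j r)) = y (place j r) * e st.
Hypothesis Th_psi : forall j r, (r.+1 < c j)%N ->
  Th (tin (@pb j r)) = psi (place j r) * e st.

Variable u : n.-tuple 'I_d -> H.
Hypothesis u_sorted : forall t, tsorted j0 t -> u t = e t.
Hypothesis u_e : forall t, e t * u t = u t.
Hypothesis u_psi : forall t a, (a.+1 < n)%N -> t.@a != t.@(a.+1) ->
  psi a * u t = u (swt a t).

Variable v : n.-tuple 'I_d -> H.
Hypothesis vP : forall t, has_content l t -> [/\ v t * u t = e st,
  u t * v t = e t, e st * v t = v t & v t * e t = v t].

Let rk_c t a : has_content l t -> (a < n)%N -> (rk t a < c t.@a)%N.
Proof. by move=> /has_contentP ct an; apply: rk_lt. Qed.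

Let like_st_content t : has_content l t -> like_st st t.
Proof.
by move=> /has_contentP ct j; have /has_contentP cst := st_content; rewrite ct cst.
Qed.

Let st_count j : count_mem j st = c j.
Proof. by have /has_contentP := st_content. Qed.

Let placeE j r := @placeP d n j0 st c st_count j r.

Let u_st t : has_content l t -> u t * e st = u t.
Proof.
move=> /like_st_content ct.
exact (u_right KJ_disjoint sysH u_sorted u_psi st_sorted ct).
Qed.

Let Th0 : Th 0 = 0. Proof. by rewrite -(subrr 0) ThB subrr. Qed.
Let ThD z z' : Th (z + z') = Th z + Th z'.
Proof. by rewrite -{1}[z']opprK ThB -[- z']sub0r ThB Th0 sub0r opprK. Qed.

(** The coefficient by which eps a x acts on the column t, taken through [Th] and u_t, becomes eps a
    x itself: its place in the sorted sequence has the same block and strand number as a in t, so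
    [eps_u] applies. *)
Lemma u_Th_eps t a x z : has_content l t -> (a < n)%N ->
  u t * Th (eps_at j0 EK t a x * z) = eps a x * (u t * Th z).
Proof.
move=> ct an; rewrite ThM mulrA [RHS]mulrA; congr (_ * _).
rewrite /eps_at /EK; have ra := rk_c ct an; have [pn pt pr] := placeE ra.
(* For a colour outside t_a, the coefficient is 0 on the left and eps a x kills e(t) on the
   right. *)
case: (boolP (x \in KJ t.@a)) => xa; last first.
  by rewrite ext_eps_out // Th0 mulr0 -u_e mulrA eps_e0 ?mul0r.
rewrite -[x]/(val (exist (fun x => x \in KJ t.@a) x xa)) ext_eps_in Th_eps // /=.
rewrite mulrA -(eps_u sysH u_sorted u_psi st_sorted _ (like_st_content ct) an) //.
by rewrite -mulrA u_st.
Qed.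

Lemma u_Th_y t a z : has_content l t -> (a < n)%N ->
  u t * Th (y_at j0 YK t a * z) = y a * (u t * Th z).
Proof.
move=> ct an; rewrite ThM mulrA [RHS]mulrA; congr (_ * _).
rewrite /y_at /YK; have ra := rk_c ct an; have [pn pt pr] := placeE ra.
rewrite Th_y // mulrA.
rewrite -(y_u KJ_disjoint sysH u_sorted u_e u_psi st_sorted (like_st_content ct) an) //.
by rewrite -mulrA u_st.
Qed.

Lemma u_Th_psi t a z : has_content l t -> (a.+1 < n)%N ->
  u (swt a t) * Th (psi_at j0 PK t a * z) = psi a * (u t * Th z).
Proof.
move=> ct an; rewrite /psi_at; case: eqVneq => ta; last first.
  by rewrite mul1r mulrA u_psi.
rewrite swt_id // ThM mulrA [RHS]mulrA; congr (_ * _).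
have ra : ((rk t a).+1 < c t.@a)%N by rewrite -rankS // ta rk_c.
have [pn pt pr] := placeE (ltnW ra); have [qn qt qr] := placeE ra.
rewrite (placeS st_sorted st_count) // in qn qt qr.
rewrite /PK Th_psi // mulrA.
rewrite -(psi_u KJ_disjoint Q_blocks sysH u_sorted u_e u_psi st_sorted
  (like_st_content ct) an) //; last by rewrite pt qt.
by rewrite -mulrA u_st.
Qed.

(** The map from the free module on the sequences to H e(st) with t z |-> u_t Th(z). *)
Definition Psi_col (C : 'cV[T]_(multinom l)) : H := \sum_i u (tau i) * Th (C i 0).

Lemma Psi_dcol t z : has_content l t -> Psi_col (dcol t z) = u t * Th z.
Proof.
move=> /tau_surj[i <-]; rewrite /Psi_col (bigD1 i) //= mxE eqxx big1 ?addr0 //.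
by move=> i' ii'; rewrite mxE (inj_eq (@tau_inj d n l)) (negPf ii') Th0 mulr0.
Qed.

Lemma Psi_colD C C' : Psi_col (C + C') = Psi_col C + Psi_col C'.
Proof.
by rewrite /Psi_col -big_split; apply: eq_bigr => i _; rewrite mxE ThD mulrDr.
Qed.

Lemma Psi_col0 : Psi_col 0 = 0.
Proof. by rewrite /Psi_col big1 // => i _; rewrite mxE Th0 mulr0. Qed.

Lemma col_dcol (C : 'cV[T]_(multinom l)) : C = \sum_i dcol (tau i) (C i 0).
Proof.
apply/colP => i; rewrite summxE (bigD1 i) //= mxE eqxx big1 ?addr0 // => i' ii'.
by rewrite mxE (inj_eq (@tau_inj d n l)) eq_sym (negPf ii').
Qed.

(** This is H-linearity of [Psi_col]. Because it is asked for all C at once, it is stable under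
    products of x, so it can be checked on generators and on single columns. *)
Lemma Psi_Phi x C : Psi_col ((Phi x : 'M_(multinom l)) *m C) = x * Psi_col C.
Proof.
have [g gE ga] := alg_morphism_rmorphism PhiA.
have on_dcol w : (forall t z, has_content l t ->
      Psi_col ((Phi w : 'M_(multinom l)) *m dcol t z) = w * (u t * Th z)) ->
    forall C, Psi_col ((Phi w : 'M_(multinom l)) *m C) = w * Psi_col C.
  move=> wP C'; rewrite {1}[C']col_dcol mulmx_sumr (big_morph _ Psi_colD Psi_col0).
  by rewrite mulr_sumr; apply: eq_bigr => i _; rewrite wP ?tau_content.
have [_ _ ind] := H_univ; move: C.
apply: (ind (fun x => forall C, Psi_col ((Phi x : 'M_(multinom l)) *m C) = x * Psi_col C))
  => {x} [|a x an|a an|a an].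
- split=> [a|x x' xP xP' C|x x' xP xP' C].
  + apply: on_dcol => t z ct; rewrite gE ga (acts_algmap tau a t z) Psi_dcol //.
    (* The extra e(st) in the image of a scalar is Th 1, and Th z absorbs it. *)
    by rewrite ThM Th_algmap -(mulrA (algmap a)) mulrA -[u t * algmap a]algmap_central
      -mulrA -Th1 -ThM mul1r.
  + have -> : Phi (x + x') = (Phi x + Phi x' : 'M_(multinom l)).
      by rewrite gE rmorphD.
    by rewrite mulmxDl Psi_colD xP xP' mulrDl.
  + have -> : Phi (x * x') = (Phi x : 'M_(multinom l)) *m (Phi x' : 'M_(multinom l)).
      by rewrite gE rmorphM.
    by rewrite -mulmxA xP xP' mulrA.
- by apply: on_dcol => t z ct; rewrite Phi_eps // Psi_dcol // u_Th_eps.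
- by apply: on_dcol => t z ct; rewrite Phi_y // Psi_dcol // u_Th_y.
- apply: on_dcol => t z ct; rewrite Phi_psi // Psi_dcol ?u_Th_psi //.
  by apply/has_contentP => j; rewrite count_swt //; apply/has_contentP.
Qed.

Lemma Phi_mul w w' : Phi (w * w') = Phi w * Phi w'.
Proof. by have [_ []] := PhiA. Qed.

Lemma Phi_sum_mulmx (I : finType) (F : I -> H) (C : 'cV[T]_(multinom l)) :
  (Phi (\sum_i F i) : 'M_(multinom l)) *m C =
  \sum_i (Phi (F i) : 'M_(multinom l)) *m C.
Proof.
have [g gE _] := alg_morphism_rmorphism PhiA.
by rewrite gE rmorph_sum /= mulmx_suml.
Qed.

(** At a position where t' and t differ, a colour in the block of t' lies outside the block of t,
    and its idempotent acts on the column t by 0. *)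
Lemma Phi_e_other t t' s : has_content l t -> t' != t -> acts (Phi (e t')) s t 0.
Proof.
move=> ct tt'; have [a ta] : exists a : 'I_n, t'.@a != t.@a.
  apply/existsP; rewrite -negb_forall; apply: contra tt' => /forallP tt'.
  by apply/eqP/(@at_inj _ _ j0) => a an; apply/eqP/(tt' (Ordinal an)).
have eE : e t' = e t' * block_eps KJ eps a t'.@a.
  by have := word_eps1 (block_eps_idem KJ_disjoint sysH) (block_epsC KJ sysH) a (fun b => t'.@b).
rewrite eE Phi_mul; apply: acts_mul0.
have [g gE _] := alg_morphism_rmorphism PhiA.
have -> : Phi (block_eps KJ eps a t'.@a) = \sum_(x in KJ t'.@a) Phi (eps a x).
  by rewrite gE rmorph_sum.
have -> : 0 = \sum_(x in KJ t'.@a) (if x \in KJ t'.@a then 0 else eps_at j0 EK t a x) :> T.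
  by rewrite big1 // => x ->.
rewrite big_mkcond [X in acts _ _ _ X]big_mkcond; apply: acts_sum => x.
case: ifP => xa; last exact: acts0.
rewrite -[0](_ : eps_at j0 EK t a x = 0); first exact: Phi_eps.
rewrite /eps_at /EK ext_eps_out //; apply/negP => xa'.
by rewrite (KJ_eq KJ_disjoint xa xa') eqxx in ta.
Qed.

(** The e(t') sum to 1, and all of them but e(t) vanish on the column t. *)
Lemma Phi_e t : has_content l t -> acts (Phi (e t)) t t 1.
Proof.
move=> ct z; rewrite mul1r; have [_ [Phi1 _] _] := PhiA.
rewrite -[RHS]mul1mx -[1%:M]/(1 : M) -Phi1 -(e_sum j0 KJ_cover KJ_disjoint sysH).
rewrite Phi_sum_mulmx (bigD1 t) //= big1 ?addr0 // => t' tt'.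
by rewrite (Phi_e_other t ct tt') mul0r dcol0.
Qed.

Lemma Phi_u t : has_content l t -> acts (Phi (u t)) t st 1.
Proof.
elim/(@descent_ind d n j0): t => [t ts|t a an ta IH] ct.
  have -> : t = st by apply: like_st_eq st_sorted _ ts (like_st_content ct).
  by rewrite u_sorted //; apply: Phi_e.
have ct' : has_content l (swt a t).
  by apply/has_contentP => j; rewrite count_swt //; apply/has_contentP.
have nta : (swt a t).@a != (swt a t).@(a.+1).
  by rewrite !at_swt // swl swr eq_sym gt_neq.
rewrite (u_desc u_psi an ta) Phi_mul -[1]mulr1.
apply: actsM (IH ct') _; have := Phi_psi an ct'.
by rewrite swtK // psi_at_diff.
Qed.

(** No path is followed for v_t: Phi(u_t) moves the column st to t with coefficient 1, and Phi(v_t)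
    Phi(u_t) = Phi(e(st)). *)
Lemma Phi_v t : has_content l t -> acts (Phi (v t)) st t 1.
Proof.
move=> ct z; have [vu _ _ _] := vP ct; rewrite -[in LHS](mul1r z) -(Phi_u ct z).
have -> : (Phi (v t) : 'M_(multinom l)) *m ((Phi (u t) : 'M_(multinom l)) *m dcol st z)
    = (Phi (e st) : 'M_(multinom l)) *m dcol st z.
  by rewrite mulmxA -vu Phi_mul.
exact: Phi_e.
Qed.

(** Both [Th] and Phi are multiplicative, so it suffices to take z among the generators of one
    block. On the sorted column these act with block j and strand number r at [place j r], which is
    the generator one started from. *)
Lemma Phi_Th z : acts (Phi (Th z)) st st z.
Proof.
have est : acts (Phi (e st)) st st 1 by apply: Phi_e.
have [g gE ga] := alg_morphism_rmorphism PhiA.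
have closed (V : pzAlgType A) (f : V -> T) : alg_morphism f ->
    alg_closed (fun x => acts (Phi (Th (f x))) st st (f x)).
  move=> fA; have [h hE ha] := alg_morphism_rmorphism fA; rewrite hE.
  split=> [a|x x' xP xP'|x x' xP xP'].
  - rewrite ha Th_algmap Phi_mul -[algmap a in X in acts _ _ _ X]mulr1.
    by apply: actsM est _; rewrite gE ga; apply: acts_algmap.
  - by rewrite rmorphD ThD gE rmorphD -gE; apply: actsD.
  - by rewrite rmorphM ThM Phi_mul; apply: actsM.
have idA : alg_morphism (@id T) by [].
apply: (T_ind (closed T id idA)) => j.
have [_ _ ind] := Bj_univ j.
apply: (ind _ (closed _ _ (tin_morph j))) => [r k rj|r rj|r rj].
- have [pn pt pr] := placeE rj.
  rewrite Th_eps // Phi_mul -[X in acts _ _ _ X]mulr1; apply: actsM est _.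
  have := Phi_eps (val k) pn st_content.
  by rewrite /eps_at pt pr /EK ext_eps_in.
- have [pn pt pr] := placeE rj.
  rewrite Th_y // Phi_mul -[X in acts _ _ _ X]mulr1; apply: actsM est _.
  by have := Phi_y pn st_content; rewrite /y_at pt pr.
- have [pn pt pr] := placeE (ltnW rj); have [qn qt qr] := placeE rj.
  rewrite (placeS st_sorted st_count) // in qn qt qr.
  rewrite Th_psi // Phi_mul -[X in acts _ _ _ X]mulr1; apply: actsM est _.
  have := Phi_psi qn st_content.
  by rewrite swt_id ?pt ?qt // /psi_at pt qt eqxx pr.
Qed.

Lemma Phi_Psi_col C : (Phi (Psi_col C) : 'M_(multinom l)) *m dcol st 1 = C.
Proof.
rewrite /Psi_col Phi_sum_mulmx [RHS]col_dcol; apply: eq_bigr => i _.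
by rewrite Phi_mul (actsM (Phi_Th (C i 0)) (Phi_u (tau_content i))) mul1r mulr1.
Qed.

(** The double sum of the u_t Th(X_(t, t')) v_t', grouped by columns so that [Psi_Phi] applies to
    each of them. *)
Definition Psi (X : M) : H :=
  \sum_i Psi_col (col i (X : 'M_(multinom l))) * v (tau i).

Lemma Psi_mul x X : Psi (Phi x * X) = x * Psi X.
Proof.
rewrite /Psi mulr_sumr; apply: eq_bigr => i _; rewrite mulrA -Psi_Phi.
congr (Psi_col _ * _); rewrite -[Phi x * X]/((Phi x : 'M_(multinom l)) *m (X : 'M_(multinom l))).
by rewrite !colE mulmxA.
Qed.

Lemma Psi_1 : Psi 1 = \sum_i e (tau i).
Proof.
apply: eq_bigr => i _; have [_ uv ev _] := vP (tau_content i).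
have -> : col i (1 : M) = dcol (tau i) 1.
  apply/colP => k; rewrite !mxE (inj_eq (@tau_inj d n l)).
  by case: eqP.
by rewrite Psi_dcol ?tau_content // Th1 -mulrA ev uv.
Qed.

Lemma v_e i k : v (tau i) * e (tau k) = if k == i then v (tau i) else 0.
Proof.
have [_ _ _ ve] := vP (tau_content i); rewrite -[in LHS]ve -mulrA.
case: eqVneq => [->|ki]; first by rewrite (e_idem j0 KJ_disjoint sysH) ve.
by rewrite (e_orth j0 KJ_disjoint sysH) ?mulr0 // (inj_eq (@tau_inj d n l)) eq_sym.
Qed.

(** On the column t only the summand with v_t survives, since v_t' = v_t' e(t') and e(t') kills that
    column. Then v_t leads to the column st, where [Phi_Psi_col] returns the column of X. *)
Lemma Phi_Psi X : Phi (Psi X) = X.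
Proof.
apply/matrixP => k i; rewrite -[LHS]mulr1 -(mulmx_dcol (@tau_inj d n l)).
rewrite /Psi Phi_sum_mulmx (bigD1 i) //= big1 ?addr0 => [|i' ii'].
  have -> : (Phi (Psi_col (col i X) * v (tau i)) : 'M_(multinom l)) *m dcol (tau i) 1
      = (Phi (Psi_col (col i X)) : 'M_(multinom l)) *m dcol st 1.
    by rewrite Phi_mul -mulmxA (Phi_v (tau_content i)) mul1r.
  by rewrite Phi_Psi_col mxE.
have [_ _ _ ve] := vP (tau_content i'); rewrite -ve mulrA Phi_mul.
have ii : tau i' != tau i by rewrite (inj_eq (@tau_inj d n l)).
by rewrite (acts_mul0 _ st (Phi_e_other (tau i) (tau_content i) ii)) mul0r dcol0.
Qed.

Lemma Psi_e X : Psi X = Psi X * \sum_i e (tau i).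
Proof.
rewrite mulr_suml; apply: eq_bigr => i _; rewrite -mulrA mulr_sumr.
rewrite (bigD1 i) //= v_e eqxx big1 ?addr0 // => k ki.
by rewrite v_e (negPf ki).
Qed.

Lemma Phi_e0 t : ~~ has_content l t -> Phi (e t) = 0.
Proof.
move=> ct; apply: (acts_eq (@tau_inj d n l)) => i; exists (tau i), 0; split.
  apply: Phi_e_other; first exact: tau_content.
  by apply: contraNneq ct => ->; apply: tau_content.
exact: acts0.
Qed.

End Images.

(** The two maps form one witness, so that they can be chosen together for all compositions. *)
Lemma layer (st : n.-tuple 'I_d) (Th : T -> H) :
    tsorted j0 st -> has_content l st ->
    [/\ [/\ zmod_morphism Th, {morph Th : x x' / x * x'}, Th 1 = e st
        & forall a, Th (algmap a) = algmap a * e st],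
      forall j r k, (r < c j)%N ->
        Th (tin (@eb j r k)) = eps (place j0 st j r) (val k) * e st,
      forall j r, (r < c j)%N -> Th (tin (@yb j r)) = y (place j0 st j r) * e st
    & forall j r, (r.+1 < c j)%N ->
        Th (tin (@pb j r)) = psi (place j0 st j r) * e st] ->
  exists Phi_Psi : (H -> M) * (M -> H),
  let Phi := Phi_Psi.1 in let Psi := Phi_Psi.2 in
  [/\ alg_morphism Phi,
      forall x X, Psi (Phi x * X) = x * Psi X,
      Psi 1 = \sum_i e (tau i),
      forall X, Phi (Psi X) = X
    & (forall X, Psi X = Psi X * \sum_i e (tau i)) /\
      forall t, ~~ has_content l t -> Phi (e t) = 0].
Proof.
move=> st_sorted st_content [[ThB ThM Th1 Tha] The Thy Thp].
have [Phi [PhiA Phi_eps0 Phi_y0 Phi_psi0]] := PhiP.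
have [u [u_sorted u_e u_psi]] := path_exists j0 KJ_disjoint Q_blocks sysH.
have like t : has_content l t -> like_st st t.
  by move=> /has_contentP ct j; rewrite ct; have /has_contentP -> := st_content.
have [v vP] : exists v : n.-tuple 'I_d -> H, forall t, has_content l t ->
    [/\ v t * u t = e st, u t * v t = e t, e st * v t = v t & v t * e t = v t].
  apply: (fin_all_exists (P := fun t w => has_content l t -> [/\ w * u t = e st,
    u t * w = e t, e st * w = w & w * e t = w])) => t.
  (* The choice needs a value at every t; 0 serves for sequences of another content. *)
  case: (boolP (has_content l t)) => ct; last by exists 0.
  have [w wP] := path_inverse KJ_disjoint Q_blocks sysH u_sorted u_psi st_sorted (like t ct).
  by exists w.
have Phi_eps t a x : (a < n)%N -> has_content l t ->
    acts (Phi (eps a x)) t t (eps_at j0 EK t a x).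
  by move=> an ct; rewrite Phi_eps0 //; apply: acts_eps.
have Phi_y t a : (a < n)%N -> has_content l t ->
    acts (Phi (y a)) t t (y_at j0 YK t a).
  by move=> an ct; rewrite Phi_y0 //; apply: acts_y.
have Phi_psi t a : (a.+1 < n)%N -> has_content l t ->
    acts (Phi (psi a)) (swt a t) t (psi_at j0 PK t a).
  by move=> an ct; rewrite Phi_psi0 //; apply: acts_psi.
exists (Phi, Psi Th u v); split=> //=.
- by move=> x X; apply: (@Psi_mul Phi PhiA Phi_eps Phi_y Phi_psi st).
- by apply: (@Psi_1 st).
- by move=> X; apply: (@Phi_Psi Phi PhiA Phi_eps Phi_y Phi_psi st).
- split=> [X|t]; first by apply: (@Psi_e st).
  by apply: (@Phi_e0 Phi PhiA Phi_eps).
Qed.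

End Layer.

(** The inverse is the sum of the Psi_l. One composite sends x to x times the sum of the [one l],
    which is x. In the other, Psi_l'(X) ends in [one l'], which Phi_l kills for l != l'. *)
Lemma layers_isomorphic (A : comNzRingType) (H : pzAlgType A) (L : finType)
    (M : L -> pzAlgType A) (Phi : forall l, H -> M l) (Psi : forall l, M l -> H)
    (one : L -> H) :
    (forall l, alg_morphism (Phi l)) ->
    (forall l x X, Psi l (Phi l x * X) = x * Psi l X) ->
    (forall l, Psi l 1 = one l) -> \sum_l one l = 1 ->
    (forall l X, Phi l (Psi l X) = X) ->
    (forall l X, Psi l X = Psi l X * one l) ->
    (forall l l', l != l' -> Phi l (one l') = 0) ->
  alg_isomorphic H (prodalg M).
Proof.
move=> PhiA PsiM Psi1 sum1 PhiK Psi_one Phi_one.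
pose f x : prodalg M := [ffun l => Phi l x].
pose g (X : prodalg M) : H := \sum_l Psi l (X l).
exists f; split.
  split=> [x y||a]; [|split=> [|x y]|]; apply/ffunP => l; rewrite !ffunE;
    have [PB [P1 PM] Pa] := PhiA l.
  - by rewrite PB.
  - by rewrite P1.
  - by rewrite PM.
  - by rewrite Pa.
exists g => [x|X].
  rewrite /g; under eq_bigr => l _ do rewrite ffunE -[Phi l x]mulr1 PsiM Psi1.
  by rewrite -mulr_sumr sum1 mulr1.
apply/ffunP => l; rewrite ffunE /g; have [h hE _] := alg_morphism_rmorphism (PhiA l).
rewrite hE rmorph_sum (bigD1 l) //= -hE PhiK big1 ?addr0 // => l' ll'.
by rewrite Psi_one hE rmorphM -!hE Phi_one ?mulr0 // eq_sym.
Qed.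

Theorem theorem6p26 (A : comNzRingType) (d n : nat) (hd : (1 <= d)%N)
    (hn : (1 <= n)%N) (K : finType) (KJ : 'I_d -> {set K})
    (KJ_cover : \bigcup_j KJ j = setT)
    (KJ_disjoint : forall j j' : 'I_d, j != j' -> [disjoint KJ j & KJ j'])
    (Q : K -> K -> {poly {poly A}})
    (Q_sym : forall k k' : K, Q k k' = swapXY (Q k' k))
    (Q_diag : forall k : K, Q k k = 0)
    (Q_blocks : forall (j j' : 'I_d) (k k' : K),
       j != j' -> k \in KJ j -> k' \in KJ j' -> Q k k' = 1) :
  alg_isomorphic (qhecke Q n)
    (prodalg (fun l : dcomposition d n =>
       matalg (multinom l) (qheckecomp KJ Q l))).
Proof.
pose j0 : 'I_d := Ordinal hd; pose H := qhecke Q n.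
pose eps : nat -> K -> H := @heps A K Q n.
have H_univ := qhecke_universal Q n; have [sysH _ _] := H_univ.
pose e (t : n.-tuple 'I_d) : H := seq_idem j0 KJ eps t.
have layers (l : dcomposition d n) : exists Phi_Psi :
    (H -> matalg (multinom l) (qheckecomp KJ Q l)) *
    (matalg (multinom l) (qheckecomp KJ Q l) -> H),
  let Phi := Phi_Psi.1 in let Psi := Phi_Psi.2 in
  [/\ alg_morphism Phi,
      forall x X, Psi (Phi x * X) = x * Psi X,
      Psi 1 = \sum_i e (@tau d n l i),
      forall X, Phi (Psi X) = X
    & (forall X, Psi X = Psi X * \sum_i e (@tau d n l i)) /\
      forall t, ~~ has_content l t -> Phi (e t) = 0].
  have [st [st_content st_sorted]] := tsorted_exists j0 l.
  have st_count j : count_mem j st = val l j by have /has_contentP := st_content.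
  have B_univ j := qhecke_universal (subQ (X := KJ j) Q) (val l j).
  have [Th ThP] := block_embedding KJ_disjoint sysH st_sorted st_count B_univ.
  apply: (layer KJ_cover KJ_disjoint Q_blocks H_univ B_univ
    (tensor_in_morphism _) (@tensor_in_comm _ _ _) (@tensoralg_ind _ _ _)
    st_sorted st_content ThP).
have [PP PPP] := fin_all_exists layers.
apply: (@layers_isomorphic _ _ _ _ (fun l => (PP l).1) (fun l => (PP l).2)
  (fun l => \sum_i e (@tau d n l i))) => [l|l|l||l|l|l l' ll'].
- by have [] := PPP l.
- by have [] := PPP l.
- by have [] := PPP l.
(* Every sequence has exactly one content, so the idempotents of the layers add up to the sum of all
   e(t). *)
- by rewrite -(sum_tau e); exact (e_sum j0 KJ_cover KJ_disjoint sysH).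
- by have [] := PPP l.
- by have [_ _ _ _ []] := PPP l.
have [PA _ _ _ [_ P0]] := PPP l.
have [h hE _] := alg_morphism_rmorphism PA.
rewrite hE rmorph_sum big1 // => i _; rewrite -hE P0 //.
apply: contra ll' => li; apply/eqP.
exact: has_content_uniq li (tau_content i).
Qed.
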